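(* Let $1\le p<\infty$. Assume $(X,d,\mu)$ is complete and unbounded, $\mu$ is doubling, $X$ supports a $p$-Poincaré inequality with dilation constant $\lambda$, there are $s,C_s>0$ with $\frac{\mu(B(a,r))}{\mu(B(a,R))}\ge C_s(r/R)^s$ whenever $1\le r\le R<\infty$, and $X$ is annularly connected for large radii around $a$ with constants $A,R_A\ge1$. Then for every $q>s$ the sphericalization $(\widehat X,\hat d,\hat\mu_q)$ supports a $p$-Poincaré inequality, with constants depending only on the constants above (doubling constant of $\mu$, Poincaré constants, $s$, $C_s$, $q$, $A$, $R_A$, $p$), and with dilation constant $\hat\lambda=100\lambda\max\{A,2R_A\}$.
   Context: $\mu$ is a positive complete Borel measure on $(X,d)$ with $0<\mu(B)<\infty$ for every (open) ball; $\mu$ is doubling if $\mu(B(x,2r))\le C_\mu\mu(B(x,r))$ for all balls. A Borel $g\ge0$ is an upper gradient of $u$ if $|u(\gamma(0))-u(\gamma(1))|\le\int_\gamma g\,ds$ for all nonconstant rectifiable curves $\gamma$ (left side $=\infty$ if either value is infinite). A metric measure space $(Y,\rho,\nu)$ supports a $p$-Poincaré inequality (with constants $C_{PI}>0$ and dilation $\lambda\ge1$) if for all balls $B$ of radius $r_B$, all integrable $u$ and all upper gradients $g$ of $u$: $\frac1{\nu(B)}\int_B|u-u_B|\,d\nu\le C_{PI}\,r_B\bigl(\frac1{\nu(\lambda B)}\int_{\lambda B}g^p\,d\nu\bigr)^{1/p}$, where $u_B=\frac1{\nu(B)}\int_Bu\,d\nu$ and $\lambda B$ is the concentric ball of radius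 $\lambda r_B$. With $|x|=d(x,a)$, $X$ is annularly connected for large radii around $a$ if there are $A,R_A\ge1$ such that any $x,y$ with $|x|=|y|\ge R_A$ can be joined by a (not necessarily rectifiable) curve in $B(a,A|x|)\setminus\overline{B(a,|x|/A)}$. Sphericalization: $\widehat X=X\cup\{\infty\}$, $d_a(x,y)=\frac{d(x,y)}{(1+|x|)(1+|y|)}$ for $x,y\in X$, $d_a(x,\infty)=d_a(\infty,x)=\frac1{1+|x|}$, $d_a(\infty,\infty)=0$; $\hat d(x,y)=\inf\sum_{j=1}^k d_a(x_{j-1},x_j)$ over finite chains $x=x_0,\dots,x_k=y$ in $\widehat X$. The measure $\hat\mu_q$ is $d\hat\mu_q(x)=\frac{d\mu(x)}{(1+|x|)^q}$ on $X$ with $\hat\mu_q(\{\infty\})=0$. *)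

(* Defs.v *)
From HB Require Import structures.
From mathcomp Require Import all_boot all_order all_algebra.
From mathcomp Require Import all_classical all_reals all_analysis.
From mathcomp Require Import measurable_realfun.

Set Implicit Arguments.
Unset Strict Implicit.
Unset Printing Implicit Defensive.

Import Order.TTheory GRing.Theory Num.Theory.
Local Open Scope classical_set_scope.
Local Open Scope ring_scope.

Section metric_defs.
Context {R : realType} {Y : Type}.
Variable rho : Y -> Y -> R.

Definition is_metric : Prop :=
  [/\ forall x y, 0 <= rho x y,
      forall x y, rho x y = 0 <-> x = y,
      forall x y, rho x y = rho y x &
      forall x y z, rho x z <= rho x y + rho y z].

Definition dball (x : Y) (r : R) : set Y := [set y | rho x y < r].

Definition dopen (O : set Y) : Prop :=
  forall x, O x -> exists2 e : R, 0 < e & dball x e `<=` O.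

Definition dclosure (S : set Y) : set Y :=
  [set z | forall e : R, 0 < e -> exists w, S w /\ rho z w < e].

Definition dborel : set (set Y) := smallest (sigma_algebra setT) dopen.

Definition dborel_fun (g : Y -> \bar R) : Prop :=
  forall B : set (\bar R), measurable B -> dborel (g @^-1` B).

Definition complete_metric : Prop :=
  forall u : nat -> Y,
    (forall e : R, 0 < e -> exists N, forall m n, (N <= m)%N -> (N <= n)%N ->
        rho (u m) (u n) < e) ->
    exists l, forall e : R, 0 < e -> exists N, forall n, (N <= n)%N -> rho (u n) l < e.

Definition dcurve (gam : R -> Y) : Prop :=
  forall t, 0 <= t <= 1 -> forall e : R, 0 < e ->
    exists2 del : R, 0 < del & forall t', 0 <= t' <= 1 -> `|t - t'| < del ->
      rho (gam t) (gam t') < e.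

Definition curve_length (gam : R -> Y) (a b : R) : \bar R :=
  ereal_sup [set e | exists (n : nat) (t : nat -> R),
    [/\ t 0%N = a, t n = b, (forall i, (i < n)%N -> t i <= t i.+1) &
        e = ((\sum_(i < n) rho (gam (t i)) (gam (t i.+1)))%:E)]].

Definition rectifiable (gam : R -> Y) : Prop :=
  (curve_length gam 0 1 < +oo)%E.

Definition nonconstant (gam : R -> Y) : Prop :=
  exists t, 0 <= t <= 1 /\ gam t <> gam 0.

Definition length_fun (gam : R -> Y) (t : R) : R := fine (curve_length gam 0 t).

(** arc-length parametrization: gam~(s) = gam(t) for any t with s_gam(t) = s *)
Definition arclength_param (gam : R -> Y) (s : R) : Y :=
  gam (inf [set t | 0 <= t <= 1 /\ s <= length_fun gam t]).

Definition line_integral (gam : R -> Y) (g : Y -> \bar R) : \bar R :=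
  let I : set R := `[0, fine (curve_length gam 0 1)]%classic in
  (\int[lebesgue_measure]_(s in I) g (arclength_param gam s))%E.

Definition upper_gradient (u g : Y -> \bar R) : Prop :=
  [/\ forall y, (0 <= g y)%E, dborel_fun g &
    forall gam, dcurve gam -> rectifiable gam -> nonconstant gam ->
      ((if (u (gam 0%R) \is a fin_num) && (u (gam 1%R) \is a fin_num)
        then `|u (gam 0%R) - u (gam 1%R)|
        else +oo) <= line_integral gam g)%E].

End metric_defs.

Section poincare.
Context {R : realType}.

Definition avg d (Y : measurableType d) (nu : {measure set Y -> \bar R})
    (B : set Y) (u : Y -> \bar R) : \bar R :=
  (((fine (nu B))^-1)%:E * \int[nu]_(x in B) u x)%E.

Definition supports_PI d (Y : measurableType d) (rho : Y -> Y -> R)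
    (nu : {measure set Y -> \bar R}) (p C lam : R) : Prop :=
  [/\ 0 < C, 1 <= lam &
    forall (x : Y) (r : R), 0 < r ->
    forall u g : Y -> \bar R, nu.-integrable setT u -> upper_gradient rho u g ->
      (avg nu (dball rho x r)
          (fun y => `|u y - avg nu (dball rho x r) u|)
       <= (C * r)%:E *
          poweR (avg nu (dball rho x (lam * r)) (fun y => poweR (g y) p)) p^-1)%E].

End poincare.

Definition hatX (X : Type) : Type := option X.

HB.instance Definition _ (X : choiceType) := Choice.on (hatX X).
HB.instance Definition _ (X : choiceType) := Pointed.on (hatX X).

Section hatX_measurable.
Context d (X : measurableType d).

Definition hat_measurable : set (set (hatX X)) :=
  [set E | measurable ((@Some X) @^-1` E)].

Let hm0 : hat_measurable set0.
Proof. by rewrite /hat_measurable /= preimage_set0. Qed.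

Let hmC A : hat_measurable A -> hat_measurable (~` A).
Proof. by rewrite /hat_measurable /= preimage_setC => mA; exact: measurableC. Qed.

Let hmU (F : (set (hatX X))^nat) :
  (forall i, hat_measurable (F i)) -> hat_measurable (\bigcup_i F i).
Proof. by move=> mF; rewrite /hat_measurable /= preimage_bigcup; by apply: bigcup_measurable => i _; exact: mF. Qed.

HB.instance Definition _ := @isMeasurable.Build default_measure_display
  (hatX X) hat_measurable hm0 hmC hmU.

End hatX_measurable.

Section sphericalization.
Context {R : realType} {X : Type}.
Variables (dist : X -> X -> R) (a : X).

Definition nrm (x : X) : R := dist x a.

Definition d_a (x y : hatX X) : R :=
  match x, y with
  | Some x, Some y => dist x y / ((1 + nrm x) * (1 + nrm y))
  | Some x, None => (1 + nrm x)^-1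
  | None, Some y => (1 + nrm y)^-1
  | None, None => 0
  end.

Definition hat_d (x y : hatX X) : R :=
  inf [set e | exists (k : nat) (z : nat -> hatX X),
    [/\ z 0%N = x, z k = y & e = \sum_(j < k) d_a (z j) (z j.+1)]].

Definition hat_density (q : R) (x : X) : \bar R :=
  (((1 + nrm x) `^ q)^-1)%:E.

End sphericalization.

(* Main.v *)
(* Fix a ball of the sphericalization. If it is small compared with the distance of its
   centre to infinity, then on a comparable ball of X the metric and the measure are
   constant multiples of the original ones up to bounded factors, and the Poincare
   inequality of X can be transported. Otherwise the ball lies in a neighbourhood of
   infinity, i.e. in the complement of a ball B(a,R), which is cut into the dyadic annuli
   2^j R <= |x| < 2^(j+1) R. Inside an annulus, the averages of u over small balls are
   compared by chaining: annular connectivity joins points of equal norm, and different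
   norms are joined through a chain from a to a far away point, which exists because the
   Poincare inequality makes X connected. As q > s, the weighted measures of the annuli
   decay geometrically, so the estimates can be summed by telescoping.
   Only balls contained in the region considered are ever used, because a function may be
   changed to 0 outside a closed set F, with an upper gradient equal to +oo there. *)

Require Import Defs.
From HB Require Import structures.
From mathcomp Require Import all_boot all_order all_algebra.
From mathcomp Require Import all_classical all_reals all_analysis.
From mathcomp Require Import measurable_realfun.
From mathcomp Require Import ring lra zify.
Import Order.TTheory GRing.Theory Num.Theory.
Import numFieldNormedType.Exports.
Local Open Scope classical_set_scope.
Local Open Scope ring_scope.

Set Implicit Arguments.
Unset Strict Implicit.
Unset Printing Implicit Defensive.

(** * Integral comparison and mean oscillation *)

(** The hypothesis on [g] speaks of curves for [hat_d], the known Poincare inequality of curves in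
    X. Where [hat_d <= K * dist], a curve of X is also one for [hat_d], and [K * g] is an upper
    gradient in X; so this transfer needs only upper bounds for [hat_d], and never a curve through
    infinity. The price is the arc-length theory below: line integrals are defined by arc-length
    parametrizations, which differ for the two metrics.

    The two cases of the overview leave a gap: the neighbourhood of infinity that holds the ball may
    reach into norms below [R_A], where annular connectivity says nothing. The radius is then
    bounded below, and the factor [2 * R_A] in the dilation makes the dilated ball the whole space;
    the tail estimate from radius [R_A] and one use of the inequality on B(a, 2 R_A) suffice.

    In the telescoping, the oscillation at the i-th annulus may grow with i. Only its product with
    the weight of a later annulus j is summable, with bound [tail_ratio ^+ (j - i)] times 2^-i; here
    p >= 1 enters, as m^(1-1/p) is nondecreasing. *)

Lemma le_integral_of_measure_le {R : realType} {d} {T : measurableType d}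
    (m1 m2 : {measure set T -> \bar R}) (D : set T) (k : R) (f : T -> \bar R) :
  measurable D -> 0 <= k -> measurable_fun D f -> (forall x, 0 <= f x)%E ->
  (forall E, measurable E -> E `<=` D -> (m1 E <= k%:E * m2 E)%E) ->
  (\int[m1]_(x in D) f x <= k%:E * \int[m2]_(x in D) f x)%E.
Proof.
move=> mD k0 mf f0 m12.
(* Restricting [m1] to [D] and cutting [f] off outside [D] turns a comparison on subsets of [D] into
   one on all measurable sets. *)
have mf' : measurable_fun setT (f \_ D) by exact/(measurable_restrictT _ _).1.
have e1 : (\int[m1]_(x in D) f x = \int[mrestr m1 mD]_(x in D) (f \_ D) x)%E.
  rewrite (@eq_measure_integral _ _ _ D m1 (mrestr m1 mD)); last first.
    by move=> A mA AD; rewrite /= /mrestr (setIidl AD).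
  by apply: eq_integral => x xD; rewrite patchE xD.
have e2 : (k%:E * \int[m2]_(x in D) f x
    = \int[mscale (NngNum k0) m2]_(x in D) (f \_ D) x)%E.
  rewrite ge0_integral_mscale//=; last 2 first.
  - exact: measurable_funTS.
  - by move=> x Dx; rewrite patchE mem_set.
  by congr (_ * _)%E; apply: eq_integral => x xD; rewrite patchE xD.
rewrite e1 e2; apply: ge0_le_measure_integral => //.
- move=> S mS /=; rewrite /mrestr /mscale /=.
  apply: (le_trans (m12 _ _ _)) => //; first exact: measurableI.
  apply: lee_wpmul2l; first by rewrite lee_fin.
  apply: le_measure => //; rewrite ?inE//; exact: measurableI.
- by move=> x; rewrite patchE; case: ifP.
Qed.

Section oscillation.
Context {R : realType} {d} {T : measurableType d} (mu : {measure set T -> \bar R}).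
Variables (U : T -> \bar R) (mU : measurable_fun setT U).
Implicit Types (E F : set T) (c b v : R).

(** The constant [c] is free, not the mean: it can then be handed from one set to another and from
    [mu] to [nu]. Means reappear only at the end, through [osc_mean]. *)
Definition osc E c b : Prop := (\int[mu]_(x in E) `|U x - c%:E| <= b%:E)%E.

Lemma measurable_abse_subr E c : measurable_fun E (fun x => `|U x - c%:E|%E).
Proof.
apply: (measurableT_comp (@abse_measurable R setT)).
by apply: emeasurable_funB => //; exact: measurable_funTS.
Qed.
Local Hint Resolve measurable_abse_subr : core.

Lemma osc_le E c b b' : b <= b' -> osc E c b -> osc E c b'.
Proof. by move=> bb h; apply: (le_trans h); rewrite lee_fin. Qed.

Lemma osc_sub E F c b : measurable E -> measurable F -> E `<=` F ->
  osc F c b -> osc E c b.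
Proof. by move=> mE mF EF; apply: le_trans; apply: ge0_subset_integral. Qed.

Lemma osc_shift E c c' b v : measurable E -> (mu E <= v%:E)%E ->
  osc E c b -> osc E c' (b + `|c - c'| * v).
Proof.
move=> mE Ev Eb.
have h : (\int[mu]_(x in E) `|U x - c'%:E|
    <= \int[mu]_(x in E) (`|U x - c%:E| + `|c - c'|%:E))%E.
  apply: ge0_le_integral => //.
  - by apply: emeasurable_funD => //; exact: measurable_cst.
  - move=> x _; case: (U x) => [r||] //=; rewrite lee_fin.
    by rewrite (_ : r - c' = (r - c) + (c - c')); [exact: ler_normD|ring].
apply: (le_trans h); rewrite ge0_integralD//.
rewrite EFinD EFinM; apply: leeD => //.
rewrite (integral_cst _ mE); apply: lee_wpmul2l => //.
Qed.

(** The link of all chaining arguments: constants that suit two balls are compared on a common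
    subset that is not too small, by integrating the triangle inequality there. *)
Lemma osc_diff E c c' b b' v : measurable E -> (v%:E <= mu E)%E ->
  osc E c b -> osc E c' b' -> `|c - c'| * v <= b + b'.
Proof.
move=> mE vE Eb Eb'; rewrite -lee_fin.
apply: (@le_trans _ _ (\int[mu]_(x in E) `|c - c'|%:E)%E).
  rewrite (integral_cst _ mE) EFinM; apply: lee_wpmul2l => //.
apply: (@le_trans _ _ (\int[mu]_(x in E) (`|U x - c%:E| + `|U x - c'%:E|))%E).
  apply: ge0_le_integral => //.
  - by apply: emeasurable_funD.
  - move=> x _; case: (U x) => [r||] /=; rewrite ?leey// -EFinD lee_fin.
    rewrite (_ : c - c' = (r - c') - (r - c)); last by ring.
    by rewrite [leRHS]addrC; exact: ler_normB.
by rewrite ge0_integralD// EFinD; apply: leeD.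
Qed.

Lemma osc_setU E F c b b' : measurable E -> measurable F ->
  osc E c b -> osc F c b' -> osc (E `|` F) c (b + b').
Proof.
move=> mE mF Eb Fb; rewrite /osc.
have -> : E `|` F = E `|` (F `\` E).
  apply/seteqP; split=> x /=; last tauto.
  by case: (pselect (E x)); tauto.
rewrite ge0_integral_setU//; [|exact: measurableD|]; last first.
  by apply/disj_setPRL => x [].
rewrite EFinD; apply: leeD => //; apply: osc_sub Fb => //.
by apply: measurableD.
Qed.

Lemma osc_cover (n : nat) (F : nat -> set T) E c b :
  measurable E -> (forall i, measurable (F i)) ->
  (forall x, E x -> exists2 i, (i < n)%N & F i x) ->
  (forall i, (i < n)%N -> osc (F i) c b) -> osc E c (n%:R * b).
Proof.
move=> + mF; elim: n E => [|n IH] E mE cov h.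
  have -> : E = set0 by apply/seteqP; split=> // x /cov [].
  by rewrite /osc integral_set0 mul0r.
have -> : E = (E `\` F n) `|` (E `&` F n).
  by rewrite setUC -[LHS](setIT E) -(setUv (F n)) setIUr.
rewrite -addn1 natrD mulrDl mul1r; apply: osc_setU.
- exact: measurableD.
- exact: measurableI.
- apply: IH => [|x [Ex nFx]|i i_n]; [exact: measurableD| |exact/h/ltnW].
  have [i] := cov _ Ex; rewrite ltnS leq_eqVlt => /orP[/eqP -> //|i_n Fi].
  by exists i.
- by apply: osc_sub (h n _) => //; exact: measurableI.
Qed.

(** The mean m satisfies v |m - c| <= b, because m - c is the mean of U - c; shifting from c to m
    therefore costs b once more. *)
Lemma osc_mean E c b v : measurable E -> mu E = v%:E -> 0 < v ->
  mu.-integrable E U -> osc E c b -> osc E (fine (avg mu E U)) (2 * b).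
Proof.
move=> mE Ev v0 iU Eb.
have fI : (\int[mu]_(x in E) U x)%E \is a fin_num by exact: integrable_fin_num.
set m := fine _; have em : m = v^-1 * fine (\int[mu]_(x in E) U x)%E.
  by rewrite /m /avg Ev /= fineM.
have ic : mu.-integrable E (cst c%:E).
  apply/integrableP; split; first exact: measurable_cst.
  by rewrite (integral_cst _ mE) Ev -EFinM ltry.
have h : (`|(v * (m - c))%:E| <= b%:E)%E.
  apply: le_trans Eb; have -> : (v * (m - c))%:E = (\int[mu]_(x in E) (U x - c%:E))%E.
    rewrite integralB// (integral_cst _ mE) Ev -(fineK fI) -EFinM -EFinB; congr (_ %:E).
    by rewrite em; field; rewrite gt_eqF.
  apply: le_abse_integral => //; apply: emeasurable_funB => //.
  exact: measurable_funTS.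
have := osc_shift m mE (_ : mu E <= v%:E)%E Eb; rewrite Ev lexx => /(_ isT).
apply: osc_le; rewrite mulr2n mulrDl mul1r lerD2l.
by move: h; rewrite lee_fin normrM gtr0_norm// distrC mulrC.
Qed.

End oscillation.

(** * Arc length *)

Section curves.
Context {R : realType} {Y : Type} (rho : Y -> Y -> R).
Hypothesis rhoM : is_metric rho.

Lemma is_metric_ge0 x y : 0 <= rho x y. Proof. by case: rhoM. Qed.
Lemma is_metric_xx x : rho x x = 0. Proof. by case: rhoM => _ + _ _ => ->. Qed.
Lemma is_metric_eq0 x y : rho x y = 0 -> x = y.
Proof. by case: rhoM => _ + _ _ => ->. Qed.
Lemma is_metric_sym x y : rho x y = rho y x. Proof. by case: rhoM. Qed.
Lemma is_metric_tri y x z : rho x z <= rho x y + rho y z.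
Proof. by case: rhoM. Qed.

Section partitions.
Variable gam : R -> Y.

Definition is_part (f : nat -> R) (n : nat) (a b : R) : Prop :=
  [/\ f 0%N = a, f n = b & forall i, (i < n)%N -> f i <= f i.+1].

Definition psum (f : nat -> R) (n : nat) : R :=
  \sum_(i < n) rho (gam (f i)) (gam (f i.+1)).

Definition arclen (a b : R) : R := fine (curve_length rho gam a b).

Lemma psum_ge0 f n : 0 <= psum f n.
Proof. by apply: sumr_ge0 => i _; exact: is_metric_ge0. Qed.

Lemma psumS f n : psum f n.+1 = psum f n + rho (gam (f n)) (gam (f n.+1)).
Proof. by rewrite /psum big_ord_recr. Qed.

Lemma is_partS f n a b : is_part f n.+1 a b -> is_part f n a (f n) /\ f n <= b.
Proof.
case=> f0 fn fm; split; last by rewrite -fn; exact: fm.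
by split=> // i i_n; apply: fm; rewrite ltnS ltnW.
Qed.

Lemma is_part_le f n a b : is_part f n a b -> a <= b.
Proof.
elim: n b => [|n IH] b; first by case=> -> ->.
by move=> /is_partS[/IH]; exact: le_trans.
Qed.

Lemma is_part1 a b : a <= b -> is_part (fun i => if i is 0%N then a else b) 1 a b.
Proof. by move=> ab; split=> // -[]. Qed.

Lemma psum_cat f n g m a b c : is_part f n a b -> is_part g m b c ->
  exists h, is_part h (n + m) a c /\ psum h (n + m) = psum f n + psum g m.
Proof.
move=> [f0 fn fm] [g0 gm gmo].
pose h i := if (i <= n)%N then f i else g (i - n)%N.
have hn i : h (n + i)%N = g i.
  rewrite /h; case: i => [|i]; first by rewrite addn0 leqnn fn g0.
  by rewrite leqNgt addnS ltnS leq_addr /= -addnS addKn.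
have hl i : (i <= n)%N -> h i = f i by rewrite /h => ->.
exists h; split.
  split; first by rewrite hl.
    by rewrite hn.
  move=> i i_nm; case: (ltnP i n) => in_; first by rewrite !hl ?(ltnW in_)//; exact: fm.
  rewrite -(subnKC in_) -addnS !hn; apply: gmo; lia.
rewrite /psum big_split_ord /=; congr (_ + _); apply: eq_bigr => i _.
  by rewrite !hl ?(ltnW (ltn_ord i))//.
by rewrite -addnS !hn.
Qed.

Lemma psum_le_length f n a b : is_part f n a b ->
  ((psum f n)%:E <= curve_length rho gam a b)%E.
Proof. by case=> f0 fn fm; apply: ereal_sup_ubound; exists n, f. Qed.

Hypothesis gamR : rectifiable rho gam.

Lemma curve_length_fin a b : 0 <= a -> a <= b -> b <= 1 ->
  curve_length rho gam a b \is a fin_num.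
Proof.
move=> a0 ab b1; rewrite fin_numE; apply/andP; split.
  rewrite -ltNye. apply: lt_le_trans _ (psum_le_length (is_part1 ab)).
  by rewrite ltNyr.
(* A partition of [a, b] extends by the points 0 and 1 to one of [0, 1] with no smaller sum. *)
rewrite -ltey; apply: le_lt_trans gamR; apply: ge_ereal_sup => _ [n [f [f0 fn fm ->]]].
have pf : is_part f n a b by [].
have [h [ph hs]] := psum_cat (is_part1 a0) pf.
have [k [pk ks]] := psum_cat ph (is_part1 b1).
apply: le_trans _ (psum_le_length pk); rewrite ks hs lee_fin -/(psum f n).
have := psum_ge0 (fun i => if i is 0%N then 0 else a) 1.
have := psum_ge0 (fun i => if i is 0%N then b else 1) 1; lra.
Qed.

Lemma psum_le_arclen f n a b : 0 <= a -> b <= 1 -> is_part f n a b ->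
  psum f n <= arclen a b.
Proof.
move=> a0 b1 pf; have ab := is_part_le pf.
by rewrite -lee_fin fineK ?curve_length_fin//; exact: psum_le_length.
Qed.

Lemma arclen_le a b L : 0 <= a -> a <= b -> b <= 1 ->
  (forall f n, is_part f n a b -> psum f n <= L) -> arclen a b <= L.
Proof.
move=> a0 ab b1 h; rewrite -lee_fin fineK ?curve_length_fin//.
by apply: ge_ereal_sup => _ [n [f [f0 fn fm ->]]]; rewrite lee_fin; exact: h.
Qed.

Lemma arclen_gt_psum a b e : 0 <= a -> a <= b -> b <= 1 -> 0 < e ->
  exists f n, is_part f n a b /\ arclen a b - e < psum f n.
Proof.
move=> a0 ab b1 e0; apply: contrapT => h.
have : arclen a b <= arclen a b - e; last by lra.
apply: arclen_le => // f n pf; rewrite leNgt; apply/negP => hf.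
by apply: h; exists f, n.
Qed.

Lemma dist_le_arclen a b : 0 <= a -> a <= b -> b <= 1 ->
  rho (gam a) (gam b) <= arclen a b.
Proof.
move=> a0 ab b1; apply: le_trans _ (psum_le_arclen a0 b1 (is_part1 ab)).
by rewrite /psum big_ord1.
Qed.

Lemma arclen_ge0 a b : 0 <= a -> a <= b -> b <= 1 -> 0 <= arclen a b.
Proof.
by move=> *; apply: le_trans _ (dist_le_arclen _ _ _) => //; exact: is_metric_ge0.
Qed.

Lemma arclen_superadd a b c : 0 <= a -> a <= b -> b <= c -> c <= 1 ->
  arclen a b + arclen b c <= arclen a c.
Proof.
move=> a0 ab bc c1; rewrite -lerBrDr; apply: arclen_le => // [|f n pf]; first lra.
rewrite lerBrDr -lerBrDl; apply: arclen_le => // [|g m pg]; first lra.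
rewrite lerBrDl; have [h [ph <-]] := psum_cat pf pg.
exact: psum_le_arclen.
Qed.

Lemma arclen0 a : 0 <= a -> a <= 1 -> arclen a a = 0.
Proof.
move=> a0 a1; have := @arclen_superadd a a a a0 (lexx _) (lexx _) a1.
have := arclen_ge0 a0 (lexx _) a1; lra.
Qed.

(** One inequality is concatenation of partitions. For the other, b is inserted into a partition of
    [a, c], by induction on its size: either b precedes the last node and the induction hypothesis
    applies, or it lies in the last piece. *)
Lemma arclen_add a b c : 0 <= a -> a <= b -> b <= c -> c <= 1 ->
  arclen a c = arclen a b + arclen b c.
Proof.
move=> a0 ab bc c1; apply/eqP; rewrite eq_le arclen_superadd// andbT.
apply: arclen_le => // [|f n]; first lra.
elim: n c bc c1 => [|n IH] c bc c1 pf.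
  case: pf => f0 fn _; have e : b = a by lra.
  rewrite /psum big_ord0 addr_ge0// arclen_ge0//; lra.
rewrite psumS; have [pfn fnc] := is_partS pf.
have fc : f n.+1 = c by case: pf.
have an := is_part_le pfn.
case: (lerP b (f n)) => bn.
  have := IH _ bn (le_trans fnc c1) pfn.
  have := dist_le_arclen (le_trans a0 an) fnc c1; rewrite fc.
  have := @arclen_superadd b (f n) c (le_trans a0 ab) bn fnc c1; lra.
have n1 : f n <= 1 by lra.
have := psum_le_arclen a0 n1 pfn.
have := @arclen_superadd a (f n) b a0 an (ltW bn) (le_trans bc c1).
have := dist_le_arclen (le_trans a0 an) (ltW bn) (le_trans bc c1).
have := dist_le_arclen (le_trans a0 ab) bc c1.
have := is_metric_tri (gam b) (gam (f n)) (gam c); rewrite fc; lra.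
Qed.

Lemma le_arclen b c : 0 <= b -> b <= c -> c <= 1 -> arclen 0 b <= arclen 0 c.
Proof.
by move=> b0 bc c1; rewrite (@arclen_add 0 b c)// lerDl arclen_ge0.
Qed.

Hypothesis gamC : dcurve rho gam.

(** A partition of [t, 1] whose sum is within e/2 of the length may have its start moved to a
    slightly later t', at a cost of e/2 by continuity of the curve. So the length from t' to 1 is
    within e of the length from t to 1. *)
Lemma arclen_right_cont t e : 0 <= t -> t < 1 -> 0 < e ->
  exists2 t', t < t' <= 1 & arclen t t' <= e.
Proof.
move=> t0 t1 e0.
have [del del0 hdel] : exists2 del, 0 < del & forall t', 0 <= t' <= 1 ->
    `|t - t'| < del -> rho (gam t) (gam t') < e / 2.
  by apply: gamC; [lra|rewrite divr_gt0].
have key f n b : is_part f n t b -> t < b -> b <= 1 -> exists t',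
    [/\ t < t', t' <= b & psum f n <= e / 2 + arclen t' b].
  elim: n b => [|n IH] b pf tb b1.
    by exfalso; case: pf => f0 fn _; move: tb; rewrite -f0 -fn ltxx.
  have fc : f n.+1 = b by case: pf.
  have [pfn fnb] := is_partS pf; rewrite psumS.
  case: (ltrP t (f n)) => tn.
    have [t' [tt' t'n h]] := IH _ pfn tn (le_trans fnb b1).
    exists t'; split; [by []|lra|].
    have := @arclen_superadd t' (f n) b _ t'n fnb b1.
    have := @dist_le_arclen (f n) b _ fnb b1; rewrite fc => h1 h2.
    have {}h1 := h1 ltac:(lra); have {}h2 := h2 ltac:(lra); lra.
  have ent : f n = t by apply/eqP; rewrite eq_le tn (is_part_le pfn).
  have -> : psum f n = 0.
    apply/eqP; rewrite eq_le psum_ge0 andbT.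
    by have := psum_le_arclen t0 _ pfn; rewrite ent arclen0 ?(ltW t1)//; exact.
  exists (Num.min b (t + del / 2)); split.
  - by rewrite lt_min tb ltrDl divr_gt0.
  - by rewrite ge_min lexx.
  - set t' := Num.min _ _.
    have tt' : t < t' by rewrite lt_min tb ltrDl divr_gt0.
    have t'b : t' <= b by rewrite ge_min lexx.
    have t'd : t' <= t + del / 2 by rewrite ge_min lexx orbT.
    rewrite ent fc; have := is_metric_tri (gam t') (gam t) (gam b).
    have := @dist_le_arclen t' b ltac:(lra) t'b b1.
    have := hdel t' ltac:(lra) _.
    by rewrite ltr_norml => /(_ ltac:(lra)); lra.
have [f [n [pf hf]]] := @arclen_gt_psum t 1 (e / 2) t0 (ltW t1) (lexx _) ltac:(lra).
have [t' [tt' t'1 h]] := key _ _ _ pf t1 (lexx _).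
exists t'; first by rewrite tt'.
have := @arclen_add t t' 1 t0 (ltW tt') t'1 (lexx _); lra.
Qed.

Lemma arclen_left_cont t e : 0 < t -> t <= 1 -> 0 < e ->
  exists2 t', 0 <= t' < t & arclen t' t <= e.
Proof.
move=> t0 t1 e0.
have [del del0 hdel] : exists2 del, 0 < del & forall t', 0 <= t' <= 1 ->
    `|t - t'| < del -> rho (gam t) (gam t') < e / 2.
  by apply: gamC; [lra|rewrite divr_gt0].
have key f n : is_part f n 0 t -> exists t',
    [/\ 0 <= t', t' < t & psum f n <= e / 2 + arclen 0 t'].
  elim: n => [|n IH] pf.
    by exfalso; case: pf => f0 fn _; move: t0; rewrite -f0 -fn ltxx.
  have fc : f n.+1 = t by case: pf.
  have [pfn fnt] := is_partS pf; rewrite psumS.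
  have fn0 := is_part_le pfn.
  case: (ltrP (f n) t) => tn; last first.
    have ent : f n = t by apply/eqP; rewrite eq_le tn fnt.
    have [t' [t'0 t't h]] := IH ltac:(by move: pfn; rewrite ent).
    by exists t'; split=> //; rewrite ent fc is_metric_xx addr0.
  set t' := Num.max (f n) (t - del / 2).
  have nt' : f n <= t' by rewrite le_max lexx.
  have t't : t' < t by rewrite gt_max tn /= ltrBlDr ltrDl divr_gt0.
  have t'd : t - del / 2 <= t' by rewrite le_max lexx orbT.
  exists t'; split=> //; first lra.
  have := psum_le_arclen (lexx _) _ pfn => /(_ ltac:(lra)).
  have := @dist_le_arclen (f n) t' fn0 nt' ltac:(lra).
  have := @arclen_superadd 0 (f n) t' (lexx _) fn0 nt' ltac:(lra).
  have := is_metric_tri (gam t') (gam (f n)) (gam t).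
  have := hdel t' ltac:(lra) _; rewrite ltr_norml => /(_ ltac:(lra)).
  rewrite fc (is_metric_sym (gam t')); lra.
have [f [n [pf hf]]] := @arclen_gt_psum 0 t (e / 2) (lexx _) (ltW t0) t1 ltac:(lra).
have [t' [t'0 t't h]] := key _ _ pf.
exists t'; first by rewrite t'0.
have := @arclen_add 0 t' t (lexx _) t'0 (ltW t't) t1; lra.
Qed.

Definition arctime (s : R) : R := inf [set t | 0 <= t <= 1 /\ s <= arclen 0 t].

(** Continuity of the length function makes the infimum exact: left continuity gives
    [arclen 0 (arctime s) <= s], right continuity the converse. *)
Lemma arctimeP s : 0 <= s <= arclen 0 1 ->
  [/\ 0 <= arctime s, arctime s <= 1, arclen 0 (arctime s) = s &
      forall t, 0 <= t <= 1 -> s <= arclen 0 t -> arctime s <= t].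
Proof.
move=> /andP[s0 sL]; set S := [set t | 0 <= t <= 1 /\ s <= arclen 0 t].
have S1 : S 1 by rewrite /S /= ler01 lexx.
have lbS : has_lbound S by exists 0 => t [/andP[]].
have hS : has_inf S by split; [exists 1|].
set w := arctime s.
have w0 : 0 <= w by apply: lb_le_inf; [exists 1|move=> t [/andP[]]].
have wle t : 0 <= t <= 1 -> s <= arclen 0 t -> w <= t.
  by move=> t01 st; apply: ge_inf.
have w1 : w <= 1 by apply: wle; rewrite ?ler01 ?lexx.
split=> //; apply/eqP; rewrite eq_le; apply/andP; split; apply/ler_addgt0Pr => e e0.
- move: w0; rewrite le_eqVlt => /orP[/eqP <-|w0].
    by rewrite arclen0//; lra.
  have [t' /andP[t'0 t'w] h] := arclen_left_cont w0 w1 e0.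
  rewrite (@arclen_add 0 t' w)// ?(ltW t'w)//; apply: lerD => //.
  rewrite leNgt; apply/negP => h'.
  have := wle t' ltac:(lra) (ltW h'); lra.
- have [wlt1|w1'] := ltP w 1; last first.
    have -> : w = 1 by apply/eqP; rewrite eq_le w1.
    lra.
  have [t' /andP[wt' t'1] h] := arclen_right_cont w0 wlt1 e0.
  have [x [/andP[x0 x1] sx] xw] := @inf_adherent R S (t' - w) ltac:(lra) hS.
  have xt' : x < t' by move: xw; rewrite -/w -/(arctime s) -/w; lra.
  have := le_arclen x0 (ltW xt') t'1.
  rewrite (@arclen_add 0 w t')// ?(ltW wt')//; lra.
Qed.

Lemma arclength_paramE s : arclength_param rho gam s = gam (arctime s).
Proof. by []. Qed.

Lemma arclength_param_lip s s' : 0 <= s <= arclen 0 1 -> 0 <= s' <= arclen 0 1 ->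
  rho (arclength_param rho gam s) (arclength_param rho gam s') <= `|s - s'|.
Proof.
wlog ss' : s s' / s <= s'.
  move=> h hs hs'; case: (leP s s') => [|/ltW] ss'; first exact: h.
  by rewrite is_metric_sym distrC; exact: h.
move=> hs hs'; rewrite distrC ger0_norm ?subr_ge0// !arclength_paramE.
have [w0 w1 ws _] := arctimeP hs; have [v0 v1 vs vm] := arctimeP hs'.
case: (lerP (arctime s) (arctime s')) => [wv|vw]; last first.
  have := le_arclen v0 (ltW vw) w1; rewrite ws vs => s's.
  have es : s = s' by apply/eqP; rewrite eq_le ss'.
  by move: vw; rewrite es ltxx.
have := @arclen_add 0 _ _ (lexx _) w0 wv v1; rewrite ws vs => e.
have := dist_le_arclen w0 wv v1; lra.
Qed.

(** The first time at which the length [arclen 0 t] is reached may precede [t], but the piece in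
    between has length 0, so the curve is constant on it. *)
Lemma arclength_param_arclen t : 0 <= t <= 1 ->
  arclength_param rho gam (arclen 0 t) = gam t.
Proof.
move=> /andP[t0 t1].
have h : 0 <= arclen 0 t <= arclen 0 1 by rewrite arclen_ge0// le_arclen.
have [w0 w1 ws wm] := arctimeP h; rewrite arclength_paramE.
have wt : arctime (arclen 0 t) <= t by apply: wm; rewrite ?lexx// t0.
apply: is_metric_eq0; apply/eqP; rewrite eq_le is_metric_ge0 andbT.
have := @arclen_add 0 _ _ (lexx _) w0 wt t1; rewrite ws.
have := dist_le_arclen w0 wt t1; lra.
Qed.

End partitions.
End curves.

(** * Change of variables for Lipschitz maps *)

Section lipschitz_change_of_variables.
Context {R : realType}.
Variables (K : R) (psi : R -> R).
Hypothesis K0 : 0 < K.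
Hypothesis psiK : forall x y, `|psi x - psi y| <= K * `|x - y|.

Lemma lipschitz_measurable_fun : measurable_fun setT psi.
Proof.
apply: continuous_measurable_fun => x; apply/cvgrPdist_lt => e e0.
have eK : 0 < e / K by rewrite divr_gt0.
near=> y; apply: (le_lt_trans (psiK _ _)).
rewrite mulrC -ltr_pdivlMr//; near: y.
Unshelve. all: by end_near. Qed.

(** Lebesgue measure is the infimum over covers by open intervals, and [psi] maps an interval of
    length l into the closed interval of length K l centred at the image of its midpoint ([J]
    below). *)
Lemma lebesgue_lipschitz_image (E S : set R) : measurable E -> 
  E `<=` psi @` S ->
  (lebesgue_measure E <= K%:E * lebesgue_measure S)%E.
Proof.
move=> mE ES; rewrite -lee_pdivrMl//.
rewrite [leRHS](_ : _ = (wlength idfun)^*%mu S)// outer_measure_open_itv_cover.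
apply: le_ereal_inf_tmp => _ /= [F [Fitv SF] <-].
rewrite lee_pdivrMl// -nneseriesZl; last first.
  by move=> i _; have [ab ->] := Fitv i; exact: wlength_itv_ge0.
have /choice[ab Fab] : forall i, exists ab, F i = `]ab.1, ab.2[%classic by [].
pose J i : set R := if (ab i).1 < (ab i).2 then
  `[psi (((ab i).1 + (ab i).2) / 2) - K * (((ab i).2 - (ab i).1) / 2),
    psi (((ab i).1 + (ab i).2) / 2) + K * (((ab i).2 - (ab i).1) / 2)]%classic
  else set0.
have mJ i : measurable (J i) by rewrite /J; case: ifP.
apply: (@le_trans _ _ (\sum_(0 <= i <oo) lebesgue_measure (J i))%E).
  apply: measure_sigma_subadditive => // y /ES[x /SF[i _ Fx] <-]; exists i => //.
  move: Fx; rewrite Fab /J /= in_itv /= => /andP[ax xb].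
  rewrite (lt_trans ax xb) /= in_itv /=; move: ax xb.
  move: (ab i) => [a b] /= ax xb; set m := (a + b) / 2.
  have h : `|x - m| <= (b - a) / 2 by rewrite ler_norml /m; apply/andP; split; lra.
  have := psiK x m; have : K * `|x - m| <= K * ((b - a) / 2) by rewrite ler_pM2l.
  move=> h1 h2; have := le_trans h2 h1; rewrite ler_norml => /andP[]; lra.
apply: lee_nneseries => // i _; rewrite Fab /J wlength_itv /= lte_fin.
case: ifPn => [ab12|_]; last by rewrite measure0 mule0.
rewrite lebesgue_measure_itv /= lte_fin; case: ifPn => _.
  by rewrite -EFinD -EFinD -EFinM lee_fin; lra.
by rewrite -EFinD -EFinM lee_fin mulr_ge0 ?ltW// subr_gt0.
Qed.

End lipschitz_change_of_variables.

(** The 1-Lipschitz retraction of the line onto [0, L]; it extends Lipschitz maps given on [0, L] to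
    the whole line. *)
Definition clamp {R : realType} (L x : R) : R := Num.max 0 (Num.min L x).

Lemma clamp_itv {R : realType} (L x : R) : 0 <= L -> 0 <= clamp L x <= L.
Proof. by move=> L0; rewrite /clamp le_max lexx /= ge_max L0 ge_min lexx. Qed.

Lemma clamp_id {R : realType} (L x : R) : 0 <= x <= L -> clamp L x = x.
Proof. by move=> /andP[x0 xL]; rewrite /clamp min_r// max_r. Qed.

Lemma clamp_lip {R : realType} (L x y : R) : `|clamp L x - clamp L y| <= `|x - y|.
Proof.
rewrite /clamp; case: (leP L x) => h1; case: (leP L y) => h2;
rewrite /Num.max; repeat case: ifP => ?;
rewrite ler_norml; apply/andP; split;
have := ler_norm (x - y); have := ler_norm (y - x); rewrite (distrC y x); lra.
Qed.

Definition pushforward_measure {R : realType} {d d'} {T1 : measurableType d}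
    {T2 : measurableType d'} (m : {measure set T1 -> \bar R}) (f : T1 -> T2)
    (mf : measurable_fun setT f) : {measure set T2 -> \bar R}.
Proof. unshelve refine (pushforward m f : {measure set T2 -> \bar R}); exact: mf. Defined.

(** Since [phi] is onto, every E in [0, L'] is the image of its preimage; hence Lebesgue measure on
    [0, L'] is at most K times the image under [phi] of Lebesgue measure on [0, L]. *)
Lemma lipschitz_integral_le {R : realType} (K L L' : R) (phi : R -> R) (G : R -> \bar R) :
  0 < K -> 0 <= L ->
  (forall x y, 0 <= x <= L -> 0 <= y <= L -> `|phi x - phi y| <= K * `|x - y|) ->
  (forall y, 0 <= y <= L' -> exists2 x, 0 <= x <= L & phi x = y) ->
  (forall x, 0 <= x <= L -> 0 <= phi x <= L') ->
  (forall y, 0 <= G y)%E -> measurable_fun (`[0, L'] : set R) G ->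
  (\int[lebesgue_measure]_(y in (`[0%R, L']%classic : set R)) G y <=
   K%:E * \int[lebesgue_measure]_(x in (`[0%R, L]%classic : set R)) G (phi x))%E.
Proof.
move=> K0 L0 phiK phi_onto phi_into G0 mG.
have clampI x : 0 <= clamp L x <= L by exact: clamp_itv.
pose psi x := phi (clamp L x).
have psiK x y : `|psi x - psi y| <= K * `|x - y|.
  apply: (le_trans (phiK _ _ (clampI x) (clampI y))); rewrite ler_pM2l//.
  exact: clamp_lip.
have mpsi := lipschitz_measurable_fun K0 psiK.
have mI : measurable (`[0, L] : set (measurableTypeR R)) by exact: measurable_itv.
pose leb0 : {measure set (measurableTypeR R) -> \bar R} := mrestr (@lebesgue_measure R) mI.
pose m2 := pushforward_measure leb0 (mpsi : measurable_fun setT (psi : measurableTypeR R -> measurableTypeR R)).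
have psi_into x : 0 <= psi x <= L' by exact/phi_into/clampI.
have H1 : (\int[lebesgue_measure]_(y in (`[0%R, L']%classic : set R)) G y <= K%:E * \int[m2]_(y in (`[0%R, L']%classic : set R)) G y)%E.
  apply: le_integral_of_measure_le => // [|E mE EI]; first exact: ltW.
  rewrite /m2 /= /pushforward /leb0 /= /mrestr.
  apply: (@lebesgue_lipschitz_image _ K psi) => // y Ey.
  have /phi_onto[x xI xy] : 0 <= y <= L' by have := EI _ Ey; rewrite /= in_itv.
  by exists x => //=; rewrite ?in_itv /psi ?clamp_id ?xy.
apply: (le_trans H1); apply: lee_wpmul2l; first by rewrite lee_fin ltW.
rewrite /m2 ge0_integral_pushforward//.
rewrite (_ : _ @^-1` _ = setT); last first.
  by apply/seteqP; split => // x _ /=; rewrite in_itv /=; exact: psi_into.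
have mGpsi : measurable_fun setT (G \o psi).
  apply: (measurable_comp _ _ mG) => // y [x _ <-] /=.
  by rewrite in_itv /=; exact: psi_into.
rewrite (@ge0_negligible_integral _ _ _ leb0 _ (~` `[0, L]%classic))//; first last.
- by rewrite /leb0 /= /mrestr setICl measure0.
- by move=> x _; exact: G0.
- exact: measurableC.
rewrite setTD setCK (@eq_measure_integral _ _ _ _ lebesgue_measure); last first.
  by move=> A _ AI; rewrite /leb0 /= /mrestr (setIidl AI).
rewrite (@eq_integral _ _ _ lebesgue_measure _ (G \o phi)) => // x.
by rewrite inE /= in_itv /= => xI; rewrite /psi clamp_id.
Qed.

(** * Upper gradients along curves *)

(** Connectedness of [0, 1]: the supremum of the times up to which [P] holds throughout satisfies
    [P], and cannot be smaller than 1. *)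
Lemma unit_interval_ind {R : realType} (P : R -> Prop) :
  P 0 ->
  (forall t, 0 <= t <= 1 -> exists2 e, 0 < e &
    forall t', 0 <= t' <= 1 -> `|t - t'| < e -> P t <-> P t') ->
  forall t, 0 <= t <= 1 -> P t.
Proof.
move=> P0 loc.
pose S := [set t : R | 0 <= t <= 1 /\ forall t', 0 <= t' <= t -> P t'].
have S0 : S 0.
  split; first by rewrite lexx ler01.
  by move=> t' t'0; have -> : t' = 0 by lra.
have hS : has_sup S by split; [exists 0|exists 1 => t [/andP[]]].
set w := sup S.
have w0 : 0 <= w by apply: ub_le_sup S0; case: hS.
have w1 : w <= 1 by apply: ge_sup; [exists 0|move=> t [/andP[]]].
have [e e0 he] := loc w ltac:(lra).
have [x [xI xP] xw] : exists2 x, S x & w - e < x by apply: sup_adherent.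
have xlew : x <= w by apply: ub_le_sup; [case: hS|].
have Pw : P w.
  apply/(he x) => //; last by apply: xP; lra.
  by rewrite ger0_norm ?subr_ge0//; lra.
have Pall t : 0 <= t <= 1 -> t < w + e -> P t.
  move=> tI te; case: (leP t x) => tx; first by apply: xP; lra.
  by apply/(he t) => //; rewrite ltr_norml; lra.
case: (ltP w 1) => [wlt|w1' t tI]; last by apply: Pall => //; lra.
exfalso; pose z := Num.min 1 (w + e / 2).
have zw : w < z by rewrite lt_min wlt /=; lra.
have z1 : z <= 1 by rewrite ge_min lexx.
have ze : z <= w + e / 2 by rewrite ge_min lexx orbT.
have : z <= w; last by lra.
apply: ub_le_sup; first by case: hS.
by split=> [|t' t'I]; [lra|apply: Pall; lra].
Qed.

Section borel.
Context {R : realType} {Y : pointedType} (rho : Y -> Y -> R).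
Hypothesis rhoM : is_metric rho.

(** [Y] with the Borel sets of [rho] as its measurable sets, so that [dborel_fun] becomes ordinary
    measurability. *)
Definition borelType := g_sigma_algebraType (dopen rho).
HB.instance Definition _ := Measurable.on borelType.

Lemma dborel_funP (g : Y -> \bar R) :
  dborel_fun rho g <-> measurable_fun setT (g : borelType -> \bar R).
Proof.
split=> [h _ B mB|h B mB]; first by rewrite setTI; exact: h.
by have := h measurableT B mB; rewrite setTI.
Qed.

Lemma dopen_dball x r : dopen rho (dball rho x r).
Proof.
rewrite /dopen /dball /= => y xy; exists (r - rho x y); first by rewrite subr_gt0.
move=> z /= yz; have := is_metric_tri rhoM y x z; lra.
Qed.

Definition cball (x : Y) (r : R) : set Y := [set y | rho x y <= r].

Lemma dopen_cballC x r : dopen rho (~` cball x r).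
Proof.
rewrite /cball => y /= /negP; rewrite -ltNge => xy.
exists (rho x y - r); first lra.
rewrite /dball => z /= yz; apply/negP; rewrite -ltNge.
have := is_metric_tri rhoM z x y; rewrite (is_metric_sym rhoM z y); lra.
Qed.

Lemma dborel_sub (S : set (set Y)) : sigma_algebra setT S ->
  dopen rho `<=` S -> forall B, dborel rho B -> S B.
Proof. by move=> sS oS B; apply: smallest_sub. Qed.

Lemma dborel_dopen O : dopen rho O -> dborel rho O.
Proof. exact: sub_sigma_algebra. Qed.

Lemma dborel_fun_patch (F : set Y) (g : Y -> \bar R) (c : \bar R) :
  dopen rho (~` F) -> dborel_fun rho g ->
  dborel_fun rho (fun y => if y \in F then g y else c).
Proof.
move=> oF /dborel_funP mg; apply/dborel_funP.
apply: measurable_fun_ifT => //.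
apply: (measurable_fun_bool true) => //.
rewrite setTI (_ : _ @^-1` _ = F); last first.
  by apply/seteqP; split=> y /=; [move/set_mem|move=> yF; exact: mem_set].
by rewrite -(setCK F); apply: measurableC; exact: dborel_dopen.
Qed.

Lemma lipschitz_preimage_measurable (f : R -> Y) (g : Y -> \bar R) :
  (forall x y, rho (f x) (f y) <= `|x - y|) -> dborel_fun rho g ->
  measurable_fun setT (g \o f).
Proof.
move=> fl gb _ B mB; rewrite setTI comp_preimage.
pose S : set (set Y) := [set B | measurable (f @^-1` B)].
apply: (@dborel_sub S _ _ _ (gb _ mB)); last first.
  move=> O oO; apply: open_measurable; rewrite openE => x /= /oO[e e0 eO].
  apply/nbhs_ballP; exists e => //= y xy; apply: eO => /=.
  exact: le_lt_trans (fl _ _) _.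
split.
- by rewrite /S /= preimage_set0.
- by move=> A mA; rewrite /S /= setTD preimage_setC; exact: measurableC.
- by move=> F mF; rewrite /S /= preimage_bigcup; by apply: bigcup_measurable => k _; exact: mF.
Qed.

Section line_integrals.
Variable gam : R -> Y.
Hypotheses (gamC : dcurve rho gam) (gamR : rectifiable rho gam).
Let L := arclen rho gam 0 1.

Lemma arclen01_ge0 : 0 <= L. Proof. by apply: arclen_ge0. Qed.

Lemma measurable_arclength_param g : dborel_fun rho g ->
  measurable_fun (`[0, L]%classic : set R) (fun s => g (arclength_param rho gam s)).
Proof.
move=> gb; pose f s := arclength_param rho gam (clamp L s).
have mf : measurable_fun setT (g \o f).
  apply: lipschitz_preimage_measurable => // x y.
  apply: (le_trans _ (clamp_lip L x y)).
  by apply: (arclength_param_lip rhoM gamR gamC); exact/clamp_itv/arclen01_ge0.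
apply: (@eq_measurable_fun _ _ _ _ _ (g \o f)); last exact: measurable_funTS.
by move=> s; rewrite inE /= in_itv /= => sI; rewrite /f clamp_id.
Qed.

Lemma arclength_param_image s : 0 <= s <= L ->
  exists2 t, 0 <= t <= 1 & arclength_param rho gam s = gam t.
Proof.
move=> sI; have [w0 w1 _ _] := arctimeP rhoM gamR gamC sI.
by exists (arctime rho gam s) => //; rewrite w0.
Qed.

Lemma line_integral_eq g1 g2 :
  (forall t, 0 <= t <= 1 -> g1 (gam t) = g2 (gam t)) ->
  line_integral rho gam g1 = line_integral rho gam g2.
Proof.
move=> g12; apply: eq_integral => s; rewrite inE /= in_itv /= => sI.
by have [t tI ->] := arclength_param_image sI; exact: g12.
Qed.

Lemma line_integral_pinfty g (F : set Y) : nonconstant gam ->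
  dopen rho (~` F) -> dborel_fun rho g -> (forall y, 0 <= g y)%E ->
  (forall y, ~ F y -> g y = +oo%E) ->
  (exists2 t, 0 <= t <= 1 & ~ F (gam t)) -> line_integral rho gam g = +oo%E.
Proof.
move=> [t1 [t1I nc]] oF gb g0 goo [t tI nF].
have L0 : 0 < L.
  rewrite lt_neqAle arclen01_ge0 andbT; apply/eqP => L0; apply: nc.
  apply/esym/(is_metric_eq0 rhoM)/eqP; rewrite eq_le is_metric_ge0// andbT.
  have /andP[t10 t11] := t1I.
  have := dist_le_arclen rhoM gamR (lexx _) t10 t11.
  by have := le_arclen rhoM gamR t10 t11 (lexx 1); move: L0; rewrite /L; lra.
have /andP[t0 t1'] := tI.
set s := arclen rho gam 0 t.
have sI : 0 <= s <= L by rewrite arclen_ge0// le_arclen.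
have [e e0 he] := oF _ nF.
(* Around the parameter s of an exit point the parametrization, being 1-Lipschitz, stays outside F.
   Cut down to [0, L] the interval keeps positive length, because 0 < L for a nonconstant curve. *)
pose a := Num.max 0 (s - e / 2); pose b := Num.min L (s + e / 2).
have ab : a < b.
  rewrite /a /b gt_max !lt_min; lra.
have a0 : 0 <= a by rewrite le_max lexx.
have bL : b <= L by rewrite ge_min lexx.
have as' : s - e / 2 <= a by rewrite le_max lexx orbT.
have bs : b <= s + e / 2 by rewrite ge_min lexx orbT.
have far x : a <= x <= b -> ~ F (arclength_param rho gam x).
  move=> xI; apply: he => /=; rewrite -(arclength_param_arclen rhoM gamR gamC tI).
  apply: (le_lt_trans (arclength_param_lip rhoM gamR gamC sI _)).
    by rewrite -/L; lra.
  by rewrite -/s ltr_norml; lra.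
apply/eqP; rewrite -leye_eq /line_integral.
apply: (@le_trans _ _ (\int[lebesgue_measure]_(x in (`[a, b]%classic : set R))
    g (arclength_param rho gam x))%E); last first.
  apply: ge0_subset_integral => //; first exact: measurable_arclength_param.
  move=> x /=; rewrite !in_itv /= => /andP[ax xb].
  by rewrite (le_trans a0 ax) (le_trans xb bL).
rewrite (@eq_integral _ _ _ _ _ (cst +oo%E)) => [|x]; last first.
  by rewrite inE /= in_itv /= => xI; apply: goo; exact: far.
rewrite integral_cst//.
have hab : (lebesgue_measure (`[a, b]%classic : set R) = (b - a)%:E)%E.
  by rewrite lebesgue_measure_itv /= lte_fin ab.
by rewrite [X in (_ * X)%E]hab gt0_mulye ?leey// lte_fin subr_gt0.
Qed.

End line_integrals.

(** A curve leaving the closed set [F] spends a set of positive length outside [F],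
    so the value [+oo] off [F] makes every such curve irrelevant. *)
Lemma upper_gradient_patch (F : set Y) (v g : Y -> \bar R) :
  dopen rho (~` F) -> (forall y, 0 <= g y)%E -> dborel_fun rho g ->
  (forall gam, dcurve rho gam -> rectifiable rho gam -> nonconstant gam ->
    (forall t, 0 <= t <= 1 -> F (gam t)) ->
    ((if (v (gam 0%R) \is a fin_num) && (v (gam 1%R) \is a fin_num)
      then `|v (gam 0%R) - v (gam 1%R)| else +oo) <= line_integral rho gam g)%E) ->
  upper_gradient rho (v \_ F) (fun y => if y \in F then g y else +oo%E).
Proof.
move=> oF g0 gb hg; split.
- by move=> y; case: ifP.
- exact: dborel_fun_patch.
- move=> gam gamC gamR gamN.
  case: (pselect (forall t, 0 <= t <= 1 -> F (gam t))) => [inF|].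
    rewrite !patchE !mem_set; [|by apply: inF; rewrite lexx ler01..].
    rewrite (@line_integral_eq _ gamC gamR _ g) => [|t tI]; first exact: hg.
    by rewrite mem_set//; exact: inF.
  move=> /existsNP[t /not_implyP[tI nF]].
  rewrite (@line_integral_pinfty _ gamC gamR _ F) ?leey//.
  + exact: dborel_fun_patch.
  + by move=> y; case: ifP.
  + by move=> y nFy; rewrite memNset.
  + by exists t.
Qed.

End borel.

(** * Curves and line integrals under Lipschitz maps *)

Section lipschitz_curves.
Context {R : realType} {X Y : pointedType} (dist : X -> X -> R) (rho : Y -> Y -> R).
Hypotheses (distM : is_metric dist) (rhoM : is_metric rho).
Variables (j : X -> Y) (K : R) (gam : R -> X).
Hypothesis K0 : 0 < K.
Hypothesis jK : forall t t', 0 <= t <= 1 -> 0 <= t' <= 1 ->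
  rho (j (gam t)) (j (gam t')) <= K * dist (gam t) (gam t').
Hypotheses (gamC : dcurve dist gam) (gamR : rectifiable dist gam).

Lemma dcurve_lipschitz : dcurve rho (j \o gam).
Proof.
move=> t tI e e0; have [d d0 hd] := gamC tI (divr_gt0 e0 K0).
exists d => // t' t'I tt'; apply: (le_lt_trans (jK tI t'I)).
by rewrite mulrC -ltr_pdivlMr//; exact: hd.
Qed.

Lemma psum_lipschitz f n a b : 0 <= a -> b <= 1 -> is_part f n a b ->
  psum rho (j \o gam) f n <= K * psum dist gam f n.
Proof.
move=> a0; elim: n b => [|n IH] b b1 pf; first by rewrite /psum !big_ord0 mulr0.
have [pfn fb] := is_partS pf; have an := is_part_le pfn.
have fb' : f n.+1 = b by case: pf.
rewrite !psumS mulrDr lerD//; first exact: IH (le_trans fb b1) pfn.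
by apply: jK; rewrite ?fb'; lra.
Qed.

Lemma rectifiable_lipschitz : rectifiable rho (j \o gam).
Proof.
apply: (@le_lt_trans _ _ (K * arclen dist gam 0 1)%:E); last by rewrite ltry.
apply: ge_ereal_sup => _ [n [f [f0 fn fm ->]]].
have pf : is_part f n (0 : R) 1 by [].
rewrite lee_fin; apply: le_trans (psum_lipschitz (lexx _) (lexx _) pf) _.
by rewrite ler_pM2l//; apply: psum_le_arclen.
Qed.

Lemma arclen_lipschitz a b : 0 <= a -> a <= b -> b <= 1 ->
  arclen rho (j \o gam) a b <= K * arclen dist gam a b.
Proof.
move=> a0 ab b1; apply: arclen_le => // [|f n pf]; first exact: rectifiable_lipschitz.
apply: le_trans (psum_lipschitz a0 b1 pf) _.
by rewrite ler_pM2l//; apply: psum_le_arclen.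
Qed.

(** [phi] sends the arc length of [gam] to that of [j \o gam] at the same time. It is K-Lipschitz
    and onto, and the two arc-length parametrizations meet the same points under it, so the change
    of variables applies. *)
Lemma line_integral_lipschitz (g : Y -> \bar R) :
  (forall y, 0 <= g y)%E -> dborel_fun rho g ->
  (line_integral rho (j \o gam) g <= K%:E * line_integral dist gam (g \o j))%E.
Proof.
move=> g0 gb; have C' := dcurve_lipschitz; have R' := rectifiable_lipschitz.
set L := arclen dist gam 0 1; set L' := arclen rho (j \o gam) 0 1.
pose phi s := arclen rho (j \o gam) 0 (arctime dist gam s).
have atP s : 0 <= s <= L -> _ := fun h => arctimeP distM gamR gamC h.
have phi_into s : 0 <= s <= L -> 0 <= phi s <= L'.
  by move=> /atP[w0 w1 _ _]; rewrite arclen_ge0// le_arclen.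
have phiK1 x y : 0 <= x <= L -> 0 <= y <= L -> x <= y ->
    `|phi x - phi y| <= K * (y - x).
  move=> xI yI xy; have [w0 w1 ws wm] := atP _ xI; have [v0 v1 vs vm] := atP _ yI.
  have wv : arctime dist gam x <= arctime dist gam y by apply: wm; rewrite ?vs ?v0.
  have h1 := arclen_add rhoM R' (lexx _) w0 wv v1.
  have h2 := arclen_add distM gamR (lexx _) w0 wv v1.
  have h3 := arclen_lipschitz w0 wv v1.
  have h4 := arclen_ge0 rhoM R' w0 wv v1.
  rewrite /phi h1 distrC addrAC subrr add0r ger0_norm//.
  by apply: (le_trans h3); rewrite ler_pM2l//; move: h2; rewrite ws vs; lra.
have phiK x y : 0 <= x <= L -> 0 <= y <= L -> `|phi x - phi y| <= K * `|x - y|.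
  move=> xI yI; case: (leP x y) => xy.
    by rewrite (distrC x y) (@ger0_norm _ (y - x)) ?subr_ge0//; exact: phiK1.
  by rewrite distrC (@ger0_norm _ (x - y)) ?subr_ge0 ?(ltW xy)//; apply: phiK1 => //; exact: ltW.
(* [arctime] returns the first time of a given length; up to [t] the curve [gam] adds no length,
   hence neither does its Lipschitz image. This also yields that [phi] is onto. *)
have phi_arclen t : 0 <= t <= 1 -> phi (arclen dist gam 0 t) = arclen rho (j \o gam) 0 t.
  move=> /andP[t0 t1].
  have sI : 0 <= arclen dist gam 0 t <= L by rewrite arclen_ge0// le_arclen.
  have [w0 w1 ws wm] := atP _ sI.
  have wt : arctime dist gam (arclen dist gam 0 t) <= t by apply: wm; rewrite ?t0.
  have h1 := arclen_add rhoM R' (lexx _) w0 wt t1.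
  have h2 := arclen_add distM gamR (lexx _) w0 wt t1.
  have := arclen_lipschitz w0 wt t1.
  have -> : arclen dist gam (arctime dist gam (arclen dist gam 0 t)) t = 0.
    by move: h2; rewrite ws; lra.
  rewrite mulr0 /phi; have := arclen_ge0 rhoM R' w0 wt t1; lra.
apply: (@le_trans _ _ (K%:E * \int[lebesgue_measure]_(x in (`[0%R, L]%classic : set R))
   g (arclength_param rho (j \o gam) (phi x)))%E).
  apply: (@lipschitz_integral_le _ K L L' phi
     (fun s => g (arclength_param rho (j \o gam) s))) => //.
  - exact: arclen01_ge0.
  - move=> y /(arctimeP rhoM R' C')[w0 w1 ws _].
    exists (arclen dist gam 0 (arctime rho (j \o gam) y)).
      by rewrite arclen_ge0// le_arclen.
    by rewrite phi_arclen ?w0// ws.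
  - exact: measurable_arclength_param.
apply: lee_wpmul2l; first by rewrite lee_fin ltW.
rewrite le_eqVlt; apply/orP; left; apply/eqP; apply: eq_integral => s; rewrite inE /= in_itv /= => sI.
have [w0 w1 ws wm] := atP _ sI.
by rewrite /phi (arclength_param_arclen rhoM R' C')// w0.
Qed.

End lipschitz_curves.

(** * The Poincare inequality on a ball of X *)

Section poincare_space.
Context {R : realType} (p C lam : R) {dX : measure_display} {X : measurableType dX}.
Variables (dist : X -> X -> R) (mu : {measure set X -> \bar R}).
Hypothesis p1 : 1 <= p.
Hypothesis distM : is_metric dist.
Hypothesis mO : forall O, dopen dist O -> measurable O.
Hypothesis mub : forall x r, 0 < r -> (0 < mu (dball dist x r) < +oo)%E.
Hypothesis PI : supports_PI dist mu p C lam.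

Let C0 : 0 < C. Proof. by case: PI. Qed.
Let lam1 : 1 <= lam. Proof. by case: PI. Qed.
Let lamM r : 0 < r -> 0 < lam * r.
Proof. by move=> r0; rewrite mulr_gt0//; exact: lt_le_trans lam1. Qed.

Definition vol (x : X) (r : R) : R := fine (mu (dball dist x r)).

Lemma volE x r : 0 < r -> mu (dball dist x r) = (vol x r)%:E.
Proof.
move=> r0; have /andP[h0 h1] := mub x r0.
by rewrite /vol fineK// ge0_fin_numE// ltW.
Qed.

Lemma vol_gt0 x r : 0 < r -> 0 < vol x r.
Proof. by move=> r0; have := mub x r0; rewrite volE// lte_fin => /andP[]. Qed.

Lemma measurable_dball x r : measurable (dball dist x r).
Proof. by apply: mO; exact: dopen_dball. Qed.

Lemma measurable_cball x r : measurable (cball dist x r).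
Proof. by rewrite -(setCK (cball _ _ _)); apply/measurableC/mO/dopen_cballC. Qed.

Hint Resolve measurable_dball measurable_cball : core.

Lemma mu_sub_dball E x r : measurable E -> 0 < r -> E `<=` dball dist x r ->
  (mu E <= (vol x r)%:E)%E.
Proof. by move=> mE r0 Es; rewrite -volE//; apply: le_measure => //; rewrite inE. Qed.

Lemma le_vol x r y r' : 0 < r -> 0 < r' ->
  dball dist x r `<=` dball dist y r' -> vol x r <= vol y r'.
Proof. by move=> r0 r'0 h; rewrite -lee_fin -volE//; exact: mu_sub_dball. Qed.

(** The set for the patch is the closed ball of radius [lam * r]: its complement is open, and it
    contains the open ball of the right-hand side, so that the average of g^p never meets the value
    +oo. Only [v] on that closed ball and curves inside it matter. *)
Lemma local_poincare (x : X) (r : R) (v g : X -> \bar R) (G : R) :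
  0 < r -> measurable_fun setT v ->
  (\int[mu]_(y in cball dist x (lam * r)) `|v y| < +oo)%E ->
  (forall y, 0 <= g y)%E -> dborel_fun dist g ->
  (forall gam, dcurve dist gam -> rectifiable dist gam -> nonconstant gam ->
    (forall t, 0 <= t <= 1 -> cball dist x (lam * r) (gam t)) ->
    ((if (v (gam 0%R) \is a fin_num) && (v (gam 1%R) \is a fin_num)
      then `|v (gam 0%R) - v (gam 1%R)| else +oo) <= line_integral dist gam g)%E) ->
  (\int[mu]_(y in dball dist x (lam * r)) poweR (g y) p <= G%:E)%E ->
  exists c, osc mu v (dball dist x r) c
    (vol x r * (C * r * (G / vol x (lam * r)) `^ p^-1)).
Proof.
move=> r0 mv iv g0 gb hg hG; have p0 : 0 < p by exact: lt_le_trans p1.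
set F := cball dist x (lam * r); set B := dball dist x r.
have BF : B `<=` F.
  rewrite /B /F /dball /cball => y /= /ltW; move/le_trans; apply.
  by rewrite ler_peMl// ltW.
have ug := upper_gradient_patch distM (@dopen_cballC _ _ _ distM x (lam * r)) g0 gb hg.
have iF : mu.-integrable F v.
  by apply/integrableP; split=> //; apply: measurable_funTS.
have mF : measurable F by exact: measurable_cball.
have mB : measurable B by exact: measurable_dball.
have iv' : mu.-integrable setT (v \_ F) by apply/(integrable_mkcond v mF).
have iB : mu.-integrable B v by apply: integrableS BF iF.
case: PI => _ _ /(_ x r r0 _ _ iv' ug); rewrite -/B -/F.
have eB : avg mu B (v \_ F) = avg mu B v.
  congr (_ * _)%E; apply: eq_integral => y; rewrite inE => By.
  by rewrite patchE mem_set//; exact: BF.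
have fB : avg mu B v \is a fin_num.
  by rewrite fin_numM//; exact: integrable_fin_num.
pose c := fine (avg mu B v); rewrite eB -(fineK fB) -/c.
have -> : avg mu B (fun y => `|(v \_ F) y - c%:E|%E) = avg mu B (fun y => `|v y - c%:E|%E).
  congr (_ * _)%E; apply: eq_integral => y; rewrite inE => By.
  by rewrite patchE mem_set//; exact: BF.
have -> : avg mu (dball dist x (lam * r)) (fun y => poweR (if y \in F then g y else +oo%E) p)
    = avg mu (dball dist x (lam * r)) (fun y => poweR (g y) p).
  congr (_ * _)%E; apply: eq_integral => y; rewrite inE => By.
  by rewrite mem_set//; exact: ltW.
have hA : (avg mu (dball dist x (lam * r)) (fun y => poweR (g y) p)
    <= (G / vol x (lam * r))%:E)%E.
  rewrite /avg -/(vol x (lam * r)) (mulrC G) EFinM lee_wpmul2l// lee_fin invr_ge0 ltW//.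
  by rewrite vol_gt0// lamM.
move=> h; exists c.
have {h} : (avg mu B (fun y => `|v y - c%:E|%E)
    <= (C * r * (G / vol x (lam * r)) `^ p^-1)%:E)%E.
  apply: (le_trans h); rewrite [leRHS]EFinM -poweR_EFin lee_wpmul2l//.
    by rewrite lee_fin mulr_ge0 ?ltW.
  have A0 : (0 <= avg mu (dball dist x (lam * r)) (fun y => poweR (g y) p))%E.
    rewrite mule_ge0 ?lee_fin ?invr_ge0 ?fine_ge0//.
    by apply: integral_ge0 => y _; exact: poweR_ge0.
  apply: gt0_ler_poweR => //.
  - by rewrite invr_ge0 ltW.
  - by rewrite in_itv /= A0 leey.
  - by rewrite in_itv /= leey andbT; exact: le_trans hA.
by rewrite /avg lee_pdivrMl ?vol_gt0// EFinM.
Qed.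

(** The Poincare inequality for an indicator function with upper gradient [0]: a
    relatively clopen part of the ball [lam B] cannot split [B]. *)
Lemma cball_connected (x : X) (r : R) (U : set X) : 0 < r ->
  (forall z, cball dist x (lam * r) z -> exists2 e : R, 0 < e &
    forall w, cball dist x (lam * r) w -> dist z w < e -> U z <-> U w) ->
  forall y y', dball dist x r y -> dball dist x r y' -> U y -> U y'.
Proof.
move=> r0 loc y y' By By' Uy; apply: contrapT => nUy'.
have p0 : 0 < p by exact: lt_le_trans p1.
set F := cball dist x (lam * r) in loc; set B := dball dist x r in By By'.
have BF : B `<=` F.
  rewrite /B /F /dball /cball => z /= /ltW; move/le_trans; apply.
  by rewrite ler_peMl// ltW.
(* [U] is only relatively open in [F]; it is the trace on [F] of an open set, which makes the
   intersection measurable. *)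
pose O := [set w | exists z e, [/\ F z, U z, dist z w < e &
  forall w, F w -> dist z w < e -> U w]].
have oO : dopen dist O.
  move=> w [z [e [Fz Uz zw h]]]; exists (e - dist z w); first by rewrite subr_gt0.
  move=> t; rewrite /dball /= => wt; exists z, e; split=> //.
  by have := is_metric_tri distM w z t; lra.
have UF : U `&` F = O `&` F.
  apply/seteqP; split=> [z [Uz Fz]|z [[w [e [Fw Uw wz h]]] Fz]]; split=> //.
  - have [e e0 he] := loc z Fz; exists z, e; split=> //.
      by rewrite is_metric_xx.
    by move=> w Fw /(he _ Fw)[]; tauto.
  - exact: h.
have mUF : measurable (U `&` F).
  by rewrite UF; apply: measurableI; [exact: mO|exact: measurable_cball].
pose v z : \bar R := (\1_(U `&` F) z)%:E.
have mv : measurable_fun setT v.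
  by apply/measurable_EFinP; exact: measurable_indic.
have lr0 := lamM r0.
have iv : (\int[mu]_(z in F) `|v z| < +oo)%E.
  rewrite (@eq_integral _ _ _ mu F v); last first.
    by move=> z _; rewrite gee0_abs// lee_fin.
  rewrite integral_indic//; last exact: measurable_cball.
  apply: (@le_lt_trans _ _ (vol x (lam * r + 1))%:E); last by rewrite ltry.
  apply: mu_sub_dball; [|lra|].
    by apply: measurableI => //; exact: measurable_cball.
  by move=> z [_ Fz]; move: Fz; rewrite /F /cball /dball /=; lra.
have ug gam : dcurve dist gam -> rectifiable dist gam -> nonconstant gam ->
    (forall t, 0 <= t <= 1 -> F (gam t)) ->
    ((if (v (gam 0%R) \is a fin_num) && (v (gam 1%R) \is a fin_num)
      then `|v (gam 0%R) - v (gam 1%R)| else +oo) <= line_integral dist gam (cst 0))%E.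
  move=> gC _ _ gF.
  have h : U (gam 1) <-> U (gam 0).
    apply: (@unit_interval_ind _ (fun t => U (gam t) <-> U (gam 0))) => // [t tI|]; last first.
      by rewrite ler01 lexx.
    have [e e0 he] := loc _ (gF _ tI).
    have [del d0 hd] := gC t tI e e0.
    exists del => // t' t'I tt'; have := he _ (gF _ t'I) (hd _ t'I tt'); tauto.
  have -> : v (gam 0) = v (gam 1).
    rewrite /v !indicE; congr ((nat_of_bool _)%:R%:E); apply/idP/idP; rewrite !inE => -[? ?].
      by split; [tauto|apply: gF; rewrite ler01 lexx].
    by split; [tauto|apply: gF; rewrite ler01 lexx].
  have vf z : v z \is a fin_num by [].
  by rewrite !vf subee// abse0; apply: integral_ge0.
have [] := @local_poincare x r v (cst 0) 0 r0 mv iv _ _ ug.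
- by [].
- by apply/dborel_funP.
- rewrite integral0_eq// => z _; rewrite poweR0r//; lra.
move=> c; rewrite mul0r powR0 ?mulr0; last by rewrite invr_eq0; lra.
move=> hc.
(* On a small ball about z the indicator is constantly b, while its integrated distance to c
   vanishes, so c = b. Applied to y and y' this gives both c = 1 and c = 0. *)
have key z (b : R) : B z -> (forall w, F w -> (U z <-> U w) -> v w = b%:E) -> c = b.
  move=> Bz hb; have [e e0 he] := loc _ (BF _ Bz).
  pose e' := Num.min e (r - dist x z).
  have e'0 : 0 < e' by rewrite lt_min e0 subr_gt0.
  have e'e : e' <= e by rewrite ge_min lexx.
  have e'r : e' <= r - dist x z by rewrite ge_min lexx orbT.
  have sB : dball dist z e' `<=` B.
    move=> w; rewrite /B /dball /= => zw.
    by have := is_metric_tri distM z x w; lra.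
  have h0 : osc mu v (dball dist z e') b 0.
    rewrite /osc integral0_eq// => w zw.
    have Fw : F w by apply/BF/sB.
    rewrite (hb w)// ?subee ?abse0//; apply: he => //.
    by move: zw; rewrite /dball /=; lra.
  have h1 : osc mu v (dball dist z e') c 0 by apply: osc_sub hc => //.
  have := osc_diff mv (measurable_dball z e') _ h1 h0.
  move=> /(_ (vol z e')); rewrite volE// lexx addr0 => /(_ isT).
  rewrite pmulr_lle0 ?vol_gt0// normr_le0 subr_eq0 => /eqP //.
have c1 : c = 1.
  apply: (key y) => // w Fw h; rewrite /v indicE mem_set//.
  by split=> //; tauto.
have c0 : c = 0.
  apply: (key y') => // w Fw h; rewrite /v indicE memNset// => -[]; tauto.
by have := oner_neq0 R; rewrite -c1 c0 eqxx.
Qed.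

End poincare_space.

(** * The spherical metric *)

Section spherical_metric.
Context {R : realType} {X : Type} (dist : X -> X -> R) (a : X).
Hypothesis distM : is_metric dist.

Local Notation nrm := (nrm dist a).
Local Notation d_a := (d_a dist a).
Local Notation hat_d := (hat_d dist a).

(** The distance to infinity: it is [d_a x None], and by [hat_d_le] and [hat_d_height] also
    [hat_d x None]. *)
Definition height (x : hatX X) : R := if x is Some x then (1 + nrm x)^-1 else 0.

Lemma nrm_ge0 x : 0 <= nrm x. Proof. exact: (is_metric_ge0 distM). Qed.

Lemma nrm1_gt0 x : 0 < 1 + nrm x. Proof. by have := nrm_ge0 x; lra. Qed.

Lemma nrm_lip x y : nrm x <= nrm y + dist x y.
Proof. by rewrite addrC; apply: (is_metric_tri distM). Qed.

Lemma height_ge0 x : 0 <= height x.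
Proof. by case: x => //= x; rewrite invr_ge0 ltW// nrm1_gt0. Qed.

Lemma height_gt0 x : 0 < height (Some x).
Proof. by rewrite /= invr_gt0 nrm1_gt0. Qed.

Lemma height_le1 x : height x <= 1.
Proof.
case: x => //= x; rewrite invf_le1 ?nrm1_gt0//; have := nrm_ge0 x; lra.
Qed.

(** Later estimates multiply by this product instead of manipulating inverses, which keeps them
    within reach of [ring] and [lra]. *)
Lemma height_inv x : height (Some x) * (1 + nrm x) = 1.
Proof. by rewrite /= mulVf// gt_eqF// nrm1_gt0. Qed.

Lemma d_aE x y : d_a (Some x) (Some y) = dist x y * (height (Some x) * height (Some y)).
Proof. by rewrite /= -invfM. Qed.

Lemma d_a_ge0 x y : 0 <= d_a x y.
Proof.
have N0 z : 0 <= 1 + nrm z by rewrite ltW// nrm1_gt0.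
case: x y => [x|] [y|] //=; rewrite ?invr_ge0//.
by rewrite divr_ge0 ?(is_metric_ge0 distM)// mulr_ge0.
Qed.

Lemma d_a_sym x y : d_a x y = d_a y x.
Proof.
by case: x y => [x|] [y|] //=; rewrite (is_metric_sym distM) (mulrC (1 + nrm x)).
Qed.

Lemma d_a_xx x : d_a x x = 0.
Proof. by case: x => [x|] //=; rewrite (is_metric_xx distM) mul0r. Qed.

Lemma d_a_eq0 x y : d_a x y = 0 -> x = y.
Proof.
case: x y => [x|] [y|] //=; last 2 first.
- by move/eqP; rewrite invr_eq0 gt_eqF// nrm1_gt0.
- by move/eqP; rewrite invr_eq0 gt_eqF// nrm1_gt0.
move/eqP; rewrite mulf_eq0 invr_eq0 mulf_eq0 !(gt_eqF (nrm1_gt0 _)) !orbF => /eqP.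
by move/(is_metric_eq0 distM) => ->.
Qed.

Lemma height_subE x y :
  height (Some x) - height (Some y) = (nrm y - nrm x) * (height (Some x) * height (Some y)).
Proof.
move: (height_inv x) (height_inv y); move: (height (Some x)) (height (Some y)) => u v e1 e2.
have h1 : u * (v * (1 + nrm y)) = u by rewrite e2 mulr1.
have h2 : v * (u * (1 + nrm x)) = v by rewrite e1 mulr1.
lra.
Qed.

Lemma d_a_height x y : `|height x - height y| <= d_a x y.
Proof.
case: x y => [x|] [y|]; last 3 first.
- by rewrite /= subr0 ger0_norm// invr_ge0 ltW// nrm1_gt0.
- by rewrite /= sub0r normrN ger0_norm// invr_ge0 ltW// nrm1_gt0.
- by rewrite /= subrr normr0.
have hh : 0 <= height (Some x) * height (Some y) by rewrite mulr_ge0 ?height_ge0.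
rewrite d_aE height_subE normrM (ger0_norm hh) ler_wpM2r// ler_norml.
have := nrm_lip x y; have := nrm_lip y x; rewrite (is_metric_sym distM y); lra.
Qed.

Lemma d_a_le_height x y : d_a x y <= height x + height y.
Proof.
case: x y => [x|] [y|]; last 3 first.
- by rewrite /= addr0.
- by rewrite /= add0r.
- by rewrite /= addr0.
rewrite d_aE; have hx := height_gt0 x; have hy := height_gt0 y.
have hd : dist x y <= nrm x + nrm y.
  by rewrite /Defs.nrm (is_metric_sym distM y a); exact: is_metric_tri.
apply: (@le_trans _ _ ((nrm x + nrm y) * (height (Some x) * height (Some y)))).
  by rewrite ler_wpM2r// mulr_ge0// ltW.
have := height_inv x; have := height_inv y.
move: (height (Some x)) (height (Some y)) (nrm x) (nrm y) hx hy => u v m n u0 v0 e1 e2.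
have -> : (m + n) * (u * v) = (u * (1 + m)) * v + (v * (1 + n)) * u - 2 * (u * v) by ring.
by rewrite e1 e2; have := mulr_gt0 u0 v0; lra.
Qed.

Definition chain_sum (z : nat -> hatX X) (k : nat) : R :=
  \sum_(j < k) d_a (z j) (z j.+1).

Lemma chain_sumS z k : chain_sum z k.+1 = chain_sum z k + d_a (z k) (z k.+1).
Proof. by rewrite /chain_sum big_ord_recr. Qed.

Lemma chain_sum_ge0 z k : 0 <= chain_sum z k.
Proof. by apply: sumr_ge0 => i _; exact: d_a_ge0. Qed.

(** The height is 1-Lipschitz for [d_a], so a chain through [z i] pays for the way there and for the
    way on. *)
Lemma chain_sum_height2 z i k : (i <= k)%N ->
  `|height (z 0%N) - height (z i)| + `|height (z i) - height (z k)| <= chain_sum z k.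
Proof.
elim: k i => [|k IH] i; first by rewrite leqn0 => /eqP ->; rewrite subrr normr0 addr0 /chain_sum big_ord0.
rewrite leq_eqVlt => /orP[/eqP ->|]; last first.
  rewrite ltnS => /IH h; rewrite chain_sumS; have := d_a_height (z k) (z k.+1).
  have := ler_normD (height (z i) - height (z k)) (height (z k) - height (z k.+1)).
  rewrite addrA subrK; move: h; lra.
rewrite subrr normr0 addr0 chain_sumS; have := IH k (leqnn k).
rewrite subrr normr0 addr0; have := d_a_height (z k) (z k.+1).
have := ler_normD (height (z 0%N) - height (z k)) (height (z k) - height (z k.+1)).
rewrite addrA subrK; lra.
Qed.

Lemma chain_sum_height z k : `|height (z 0%N) - height (z k)| <= chain_sum z k.
Proof. by have := @chain_sum_height2 z k k (leqnn k); rewrite subrr normr0 addr0. Qed.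

(** The value at infinity is a mere default: a positive lower bound on the heights keeps the chains
    concerned inside X. *)
Let proj (x : hatX X) : X := odflt a x.

(** As long as the heights are at least m, a step of length d_a is at least m^2 times its length in
    X. *)
Lemma chain_sum_dist (m : R) z k : 0 < m ->
  (forall i, (i <= k)%N -> m <= height (z i)) ->
  dist (proj (z 0%N)) (proj (z k)) * m ^+ 2 <= chain_sum z k.
Proof.
move=> m0; elim: k => [|k IH] hm.
  by rewrite (is_metric_xx distM) mul0r /chain_sum big_ord0.
rewrite chain_sumS; have {}IH := IH (fun i ik => hm i (leqW ik)).
have := hm k (leqnSn k); have := hm k.+1 (leqnn _).
have := is_metric_tri distM (proj (z k)) (proj (z 0%N)) (proj (z k.+1)).
case: (z k) IH => [x|] IH; last by move=> _ _ /=; lra.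
case: (z k.+1) => [y|]; last by move=> _ /=; lra.
rewrite d_aE [proj (Some x)]/= [proj (Some y)]/= => h1 h2 h3.
have h4 : m ^+ 2 <= height (Some x) * height (Some y).
  by rewrite expr2 ler_pM// ltW.
have := ler_wpM2l (is_metric_ge0 distM x y) h4.
have := ler_wpM2r (ltW (exprn_gt0 2 m0)) h1; rewrite mulrDl.
by move: IH => /=; lra.
Qed.

(** Let hm be the larger height of the two ends. If the chain descends below hm/2, the variation of
    the height alone exceeds hm/2, whereas d_a is at most 2 hm. Otherwise each step is at least
    (hm/2)^2 times its length in X, whereas d_a is at most hm^2 times the distance in X. Both cases
    give the factor 4. *)
Lemma d_a_le_chain z k : d_a (z 0%N) (z k) <= 4 * chain_sum z k.
Proof.
pose hm := Num.max (height (z 0%N)) (height (z k)).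
have h0m : height (z 0%N) <= hm by rewrite le_max lexx.
have hkm : height (z k) <= hm by rewrite le_max lexx orbT.
have hm0 : 0 <= hm by apply: le_trans h0m; exact: height_ge0.
have dm := d_a_le_height (z 0%N) (z k).
case: (pselect (exists2 i, (i <= k)%N & height (z i) < hm / 2)) => [[i ik him]|all].
  have := chain_sum_height2 z ik.
  have : hm - height (z i) <= `|height (z 0%N) - height (z i)| + `|height (z i) - height (z k)|.
    have := ler_norm (height (z 0%N) - height (z i)).
    have := normr_ge0 (height (z 0%N) - height (z i)).
    have := normr_ge0 (height (z i) - height (z k)).
    have := ler_norm (height (z k) - height (z i)); rewrite (distrC (height (z k))).
    by rewrite /hm /Num.max; case: ifP; lra.
  by lra.
have {}all i : (i <= k)%N -> hm / 2 <= height (z i).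
  by move=> ik; rewrite leNgt; apply/negP => h; apply: all; exists i.
move: hm0; rewrite le_eqVlt => /orP[/eqP hm0|hm0].
  have := chain_sum_ge0 z k; lra.
have := @chain_sum_dist (hm / 2) z k ltac:(lra) all.
have := all 0%N isT; have := all k (leqnn k); move: h0m hkm.
case: (z 0%N) => [x|]; last by move=> _ _ _ /=; lra.
case: (z k) => [y|]; last by move=> _ _ /=; lra.
move=> h1 h2 _ _; rewrite d_aE /proj [odflt _ _]/= [odflt _ _]/=.
have hxy : height (Some x) * height (Some y) <= hm ^+ 2.
  by rewrite expr2 ler_pM// height_ge0.
have := ler_wpM2l (is_metric_ge0 distM x y) hxy; rewrite exprMn; lra.
Qed.

Let S (x y : hatX X) := [set e | exists (k : nat) (z : nat -> hatX X),
    [/\ z 0%N = x, z k = y & e = \sum_(j < k) d_a (z j) (z j.+1)]].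

Lemma hat_d_has_inf x y : has_inf (S x y).
Proof.
split; last first.
  by exists 0 => _ [k [z [_ _ ->]]]; exact: chain_sum_ge0.
exists (d_a x y), 1%N, (fun i => if i is 0%N then x else y); split=> //.
by rewrite big_ord1.
Qed.

Lemma hat_d_le_chain z k : hat_d (z 0%N) (z k) <= chain_sum z k.
Proof. by apply: ge_inf; [case: (hat_d_has_inf (z 0%N) (z k))|exists k, z]. Qed.

Lemma le_hat_d x y L :
  (forall z k, z 0%N = x -> z k = y -> L <= chain_sum z k) -> L <= hat_d x y.
Proof.
move=> h; apply: lb_le_inf; first by case: (hat_d_has_inf x y).
by move=> _ [k [z [z0 zk ->]]]; exact: h.
Qed.

Lemma hat_d_le x y : hat_d x y <= d_a x y.
Proof.
have := hat_d_le_chain (fun i => if i is 0%N then x else y) 1.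
by rewrite /chain_sum big_ord1.
Qed.

Lemma d_a_le_hat x y : d_a x y <= 4 * hat_d x y.
Proof.
rewrite -ler_pdivrMl//; apply: le_hat_d => z k <- <-.
by rewrite ler_pdivrMl//; exact: d_a_le_chain.
Qed.

Lemma hat_d_height x y : `|height x - height y| <= hat_d x y.
Proof. by apply: le_hat_d => z k <- <-; exact: chain_sum_height. Qed.

Lemma hat_d_le_height x y : hat_d x y <= height x + height y.
Proof. exact: le_trans (hat_d_le x y) (d_a_le_height x y). Qed.

Lemma hat_d_adherent x y e : 0 < e ->
  exists z k, [/\ z 0%N = x, z k = y & chain_sum z k < hat_d x y + e].
Proof.
move=> e0; have [_ [k [z [z0 zk ->]]] h] := inf_adherent e0 (hat_d_has_inf x y).
by exists z, k.
Qed.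

Lemma hat_d_sym_le x y : hat_d x y <= hat_d y x.
Proof.
apply: le_hat_d => z k <- <-.
have := hat_d_le_chain (fun i => z (k - i)%N) k; rewrite /= subn0 subnn => /le_trans; apply.
rewrite /chain_sum (reindex_inj rev_ord_inj) /= le_eqVlt; apply/orP; left; apply/eqP.
apply: eq_bigr => i _; rewrite d_a_sym; congr (Defs.d_a _ _ (z _) (z _));
  have := ltn_ord i; lia.
Qed.

Lemma hat_d_metric : is_metric hat_d.
Proof.
split.
- by move=> x y; apply: le_trans (hat_d_height x y); exact: normr_ge0.
- move=> x y; split=> [h|->].
    apply: d_a_eq0; apply/eqP; rewrite eq_le d_a_ge0 andbT.
    by have := d_a_le_hat x y; rewrite h mulr0.
  apply/eqP; rewrite eq_le; apply/andP; split; first by rewrite (le_trans (hat_d_le _ _))// d_a_xx.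
  by apply: le_trans (hat_d_height y y); exact: normr_ge0.
- by move=> x y; apply/eqP; rewrite eq_le !hat_d_sym_le.
- move=> x y w; apply/ler_addgt0Pr => e e0.
  have [z [k [z0 zk hz]]] := @hat_d_adherent x y (e / 2) ltac:(lra).
  have [t [l [t0 tl ht]]] := @hat_d_adherent y w (e / 2) ltac:(lra).
  pose u i := if (i <= k)%N then z i else t (i - k)%N.
  have uz i : (i <= k)%N -> u i = z i by rewrite /u => ->.
  have ut i : u (k + i)%N = t i.
    rewrite /u; case: i => [|i]; first by rewrite addn0 leqnn zk t0.
    by rewrite leqNgt addnS ltnS leq_addr /= -addnS addKn.
  have := hat_d_le_chain u (k + l); rewrite uz// ut z0 tl.
  have -> : chain_sum u (k + l) = chain_sum z k + chain_sum t l; last by lra.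
  rewrite /chain_sum big_split_ord /=; congr (_ + _); apply: eq_bigr => i _.
    by rewrite !uz ?(ltnW (ltn_ord i)).
  by rewrite -addnS !ut.
Qed.

End spherical_metric.

(** * The weighted measure *)

Lemma powR_div {R : realType} (x y r : R) : 0 <= x -> 0 <= y ->
  (x / y) `^ r = x `^ r / y `^ r.
Proof. by move=> x0 y0; rewrite powRM ?invr_ge0// -(powR_inv1 y0) -powRrM mulN1r powRN. Qed.

Lemma powR_ge1 {R : realType} (x r : R) : 1 <= x -> 0 <= r -> 1 <= x `^ r.
Proof. by move=> x1 r0; rewrite -(powRr0 x); apply: ler_powR. Qed.

Lemma geometric_sum_le {R : realType} (x : R) n : 0 <= x -> x < 1 ->
  \sum_(k < n) x ^+ k <= (1 - x)^-1.
Proof.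
move=> x0 x1; have h : 0 < 1 - x by rewrite subr_gt0.
elim: n => [|n IH]; first by rewrite big_ord0 invr_ge0 ltW.
rewrite big_ord_recl expr0; under eq_bigr do rewrite exprS.
rewrite -mulr_sumr; apply: (@le_trans _ _ (1 + x * (1 - x)^-1)).
  by rewrite lerD2l ler_wpM2l.
by rewrite le_eqVlt; apply/orP; left; apply/eqP; field; rewrite gt_eqF.
Qed.

Lemma nneseries_le {R : realType} (f : nat -> R) (b : R) : (forall k, 0 <= f k) ->
  (forall n, \sum_(k < n) f k <= b) -> (\sum_(0 <= k <oo) (f k)%:E <= b%:E)%E.
Proof.
move=> f0 h; apply: lime_le.
  by apply: is_cvg_ereal_nneg_natsum => k _; rewrite lee_fin.
by apply: nearW => n; rewrite big_mkord sumEFin lee_fin.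
Qed.

Lemma powR_exprn {R : realType} (x r : R) n : 0 <= x -> (x ^+ n) `^ r = (x `^ r) ^+ n.
Proof.
move=> x0; elim: n => [|n IH]; first by rewrite !expr0 powR1.
by rewrite !exprS powRM ?exprn_ge0// IH.
Qed.

(* The next three facts are the linear arithmetic of the telescoping argument along the
   dyadic annuli. *)
Lemma telescope_step {R : realType} (C K s1 s2 v w n : R) :
  C * s2 * w <= C * s2 * (K * v) -> 0 <= (K - 1) * (C * s1 * v) ->
  n * v <= C * s1 * v + C * s2 * w -> n * v <= C * K * (s1 + s2) * v.
Proof. lra. Qed.

Lemma telescope_sum {R : realType} (C s1 s2 S n0 n1 n : R) :
  n0 + C * s1 <= 2 * C * S -> n1 <= C * (s1 + s2) -> n <= n1 + n0 ->
  n + C * s2 <= 2 * C * (S + s2).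
Proof. lra. Qed.

Lemma telescope_osc {R : realType} (C1 C2 D v s S n : R) :
  n * (D * v) <= 2 * C2 * S * (D * v) -> C1 * v * s <= C1 * v * S ->
  C1 * (v * s) + n * (D * v) <= (C1 + 2 * C2 * D) * (v * S).
Proof. lra. Qed.

Lemma dyadic_bracket {R : realType} (P t : R) : 0 < P -> P <= t ->
  exists k, 2 ^+ k * P <= t < 2 ^+ k.+1 * P.
Proof.
move=> P0 Pt; have ex_ : exists k, t < 2 ^+ k.+1 * P.
  exists (Num.truncn (t / P)); rewrite -ltr_pdivrMr//.
  by apply: (lt_trans (truncnS_gt _)); rewrite -natrX ltr_nat; exact: ltn_expl.
case: (ex_minnP ex_) => k hk mink; exists k; rewrite hk andbT.
case: k hk mink => [|k] hk mink; first by rewrite expr0 mul1r.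
by rewrite leNgt; apply/negP => /mink; rewrite ltnn.
Qed.

(** The double sum S n satisfies S (n+1) = x S n + (1 + y + ... + y^n), and the claimed bound is the
    fixed point of this recursion with the geometric sum replaced by its limit. *)
Lemma double_geometric_sum_le {R : realType} (x y : R) n :
  0 <= x -> x < 1 -> 0 <= y -> y < 1 ->
  \sum_(j < n) \sum_(i < j.+1) x ^+ (j - i) * y ^+ i <= (1 - x)^-1 * (1 - y)^-1.
Proof.
move=> x0 x1 y0 y1; have hx : 0 < 1 - x by rewrite subr_gt0.
elim: n => [|n IH].
  by rewrite big_ord0 mulr_ge0 ?invr_ge0 ?ltW// subr_gt0.
have step j : \sum_(i < j.+2) x ^+ (j.+1 - i) * y ^+ i =
    x * (\sum_(i < j.+1) x ^+ (j - i) * y ^+ i) + y ^+ j.+1.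
  rewrite big_ord_recr /= subnn expr0 mul1r; congr (_ + _); rewrite mulr_sumr.
  apply: eq_bigr => i _; rewrite mulrA -exprS; congr (x ^+ _ * _).
  by rewrite subSn// -ltnS.
rewrite big_ord_recl /= big_ord1 subnn expr0 mul1r expr0.
under eq_bigr => j _ do rewrite /bump /= add1n step.
rewrite big_split /= -mulr_sumr addrCA.
have e : 1 + \sum_(i < n) y ^+ i.+1 = \sum_(i < n.+1) y ^+ i.
  by rewrite big_ord_recl expr0; congr (_ + _); apply: eq_bigr.
rewrite e; have g := geometric_sum_le n.+1 y0 y1.
apply: (@le_trans _ _ (x * ((1 - x)^-1 * (1 - y)^-1) + (1 - y)^-1)).
  by rewrite lerD// ler_wpM2l.
have -> : x * ((1 - x)^-1 * (1 - y)^-1) + (1 - y)^-1 =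
  (x * (1 - x)^-1 + 1) * (1 - y)^-1 by ring.
rewrite ler_wpM2r ?invr_ge0 ?subr_ge0 ?(ltW y1)//.
by rewrite le_eqVlt; apply/orP; left; apply/eqP; field; rewrite gt_eqF.
Qed.

(** [m (G/m)^(1/p) = m^(1-1/p) G^(1/p)] is nondecreasing in [m]. *)
Lemma mul_powR_div_le {R : realType} (p m m' C G : R) :
  1 <= p -> 0 < m -> 0 < m' -> 1 <= C -> m <= C * m' -> 0 <= G ->
  m * (G / m) `^ p^-1 <= C * (m' * (G / m') `^ p^-1).
Proof.
move=> p1 m0 m'0 C1 mm' G0; have C0 : 0 < C by exact: lt_le_trans C1.
have p0 : 0 < p by exact: lt_le_trans p1.
have Cm0 : 0 < C * m' by rewrite mulr_gt0.
have -> : G / m = (C * m' / m) * (G / (C * m')).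
  by field; rewrite !gt_eqF.
rewrite powRM ?divr_ge0 ?(ltW m0) ?(ltW Cm0)// !mulrA; apply: ler_pM.
- by rewrite mulr_ge0 ?powR_ge0// ltW.
- exact: powR_ge0.
- apply: (@le_trans _ _ (m * (C * m' / m))).
    rewrite ler_pM2l// ler1_powR ?invf_le1//.
    by rewrite ler_pdivlMr// mul1r.
  by rewrite mulrC divfK// gt_eqF.
- apply: ge0_ler_powR; rewrite ?nnegrE ?divr_ge0 ?invr_ge0 ?(ltW p0) ?(ltW Cm0) ?(ltW m'0)//.
  rewrite ler_wpM2l// lef_pV2 ?posrE// ler_peMl//.
  exact: ltW.
Qed.

Section weighted_measure.
Context {R : realType} (q : R) {dX : measure_display} {X : measurableType dX}.
Variables (dist : X -> X -> R) (mu : {measure set X -> \bar R}) (a : X).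
Variable nu : {measure set (hatX X) -> \bar R}.
Hypothesis q0 : 0 < q.
Hypothesis distM : is_metric dist.
Hypothesis mO : forall O, dopen dist O -> measurable O.
Hypothesis hnu : forall E : set (hatX X), measurable E ->
  nu E = (\int[mu]_(x in (@Some X) @^-1` E) hat_density dist a q x)%E.

Local Notation nrm := (nrm dist a).
Local Notation hat_d := (hat_d dist a).
Local Notation height := (height dist a).

Lemma measurable_Some : measurable_fun setT (@Some X : X -> hatX X).
Proof. by move=> _ B mB; rewrite setTI. Qed.

Lemma measurable_hat (E : set (hatX X)) : measurable ((@Some X) @^-1` E) -> measurable E.
Proof. by []. Qed.

Lemma measurable_image_Some (E : set X) :
  measurable E -> measurable ((@Some X) @` E : set (hatX X)).
Proof.
move=> mE; apply: measurable_hat; rewrite (_ : _ @^-1` _ = E)//.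
by apply/seteqP; split=> [x [y Ey [<-]]//|x Ex]; exists x.
Qed.

Lemma preimage_image_Some (E : set X) :
  (@Some X) @^-1` ((@Some X) @` E : set (hatX X)) = E.
Proof. by apply/seteqP; split=> [x [y Ey [<-]]//|x Ex]; exists x. Qed.

Lemma hat_d_le_dist x y : hat_d (Some x) (Some y) <= dist x y.
Proof.
apply: (le_trans (hat_d_le a distM _ _)); rewrite d_aE ler_piMr//.
  exact: is_metric_ge0.
by rewrite mulr_ile1 ?(height_ge0 a distM) ?(height_le1 a distM).
Qed.

Lemma dopen_Some (O : set (hatX X)) : dopen hat_d O -> dopen dist ((@Some X) @^-1` O).
Proof.
move=> oO x /= /oO[e e0 he]; exists e => // y /= xy; apply: he.
exact: le_lt_trans (hat_d_le_dist x y) xy.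
Qed.

Lemma measurable_hat_dopen (O : set (hatX X)) : dopen hat_d O -> measurable O.
Proof. by move=> /dopen_Some/mO. Qed.

Lemma measurable_hat_ball x r : measurable (dball hat_d x r : set (hatX X)).
Proof. by apply: measurable_hat_dopen; apply: dopen_dball; exact: hat_d_metric. Qed.

Lemma dborel_fun_Some (g : hatX X -> \bar R) :
  dborel_fun hat_d g -> dborel_fun dist (g \o @Some X).
Proof.
move=> gb B mB; rewrite comp_preimage.
apply: (@dborel_sub _ _ _ [set E : set (hatX X) | dborel dist ((@Some X) @^-1` E)]
  _ _ _ (gb _ mB)); last first.
  by move=> O oO; apply: dborel_dopen; exact: dopen_Some.
have [b0 bC bU] := smallest_sigma_algebra setT (dopen dist).
split=> [|E bE|F bF] /=.
- by rewrite preimage_set0.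
- by rewrite setTD preimage_setC -setTD; exact: bC.
- by rewrite preimage_bigcup; exact: bU.
Qed.

Lemma dborel_fun_hat_measurable (g : hatX X -> \bar R) :
  dborel_fun hat_d g -> measurable_fun setT g.
Proof.
move=> gb _ B mB; rewrite setTI.
apply: (@dborel_sub _ _ _ measurable _ _ _ (gb _ mB)) => //; last first.
  exact: measurable_hat_dopen.
split=> // [A mA|F mF]; first by rewrite setTD; exact: measurableC.
exact: bigcup_measurable.
Qed.

Lemma measurable_nrm : measurable_fun setT nrm.
Proof.
apply: (measurability (@RGenOInfty.G R)); first exact: RGenOInfty.measurableE.
move=> /= _ [_ [r ->] <-]; rewrite setTI.
have -> : nrm @^-1` `]r, +oo[ = ~` cball dist a r.
  apply/seteqP; split=> x; rewrite /cball /= in_itv /= andbT /Defs.nrm (is_metric_sym distM).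
    by rewrite ltNge => /negP.
  by move=> /negP; rewrite -ltNge.
exact/mO/dopen_cballC.
Qed.

Lemma measurable_hat_density : measurable_fun setT (hat_density dist a q).
Proof.
have -> : hat_density dist a q = EFin \o (fun x => (1 + nrm x) `^ (- q)).
  by apply/funext => x; rewrite /hat_density /= powRN.
apply/measurable_EFinP; apply: (measurableT_comp (measurable_powR (- q))).
by apply: measurable_funD => //; exact: measurable_nrm.
Qed.

Lemma nrm1_ge1 x : 1 <= 1 + nrm x.
Proof. by have := nrm_ge0 a distM x; lra. Qed.

Lemma hat_density_le P x : 0 < P -> P <= 1 + nrm x ->
  (hat_density dist a q x <= ((P `^ q)^-1)%:E)%E.
Proof.
move=> P0 Px; have N0 := nrm1_gt0 a distM x.
rewrite /hat_density lee_fin lef_pV2 ?posrE ?powR_gt0//.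
by apply: ge0_ler_powR => //; rewrite ?nnegrE; exact: ltW.
Qed.

Lemma hat_density_ge P x : 1 + nrm x <= P ->
  (((P `^ q)^-1)%:E <= hat_density dist a q x)%E.
Proof.
move=> Px; have N0 := nrm1_gt0 a distM x.
have P0 : 0 < P by exact: lt_le_trans Px.
rewrite /hat_density lee_fin lef_pV2 ?posrE ?powR_gt0//.
by apply: ge0_ler_powR => //; rewrite ?nnegrE; exact: ltW.
Qed.

Lemma hat_density_ge0 x : (0 <= hat_density dist a q x)%E.
Proof. by rewrite lee_fin invr_ge0 powR_ge0. Qed.

Lemma nu_le P (E : set (hatX X)) : measurable E -> 0 < P ->
  (forall x, E (Some x) -> P <= 1 + nrm x) ->
  (nu E <= ((P `^ q)^-1)%:E * mu ((@Some X) @^-1` E))%E.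
Proof.
move=> mE P0 EP; rewrite hnu//.
have := @integral_cst _ _ _ mu ((@Some X) @^-1` E) mE ((P `^ q)^-1)%:E; move=> <-.
apply: ge0_le_integral => //.
- by move=> x _; exact: hat_density_ge0.
- by apply: measurable_funTS; exact: measurable_hat_density.
- by move=> x Ex; apply: hat_density_le => //; exact: EP.
Qed.

Lemma nu_ge P (E : set (hatX X)) : measurable E -> 0 < P ->
  (forall x, E (Some x) -> 1 + nrm x <= P) ->
  (mu ((@Some X) @^-1` E) <= (P `^ q)%:E * nu E)%E.
Proof.
move=> mE P0 EP; have Pq : 0 < P `^ q by rewrite powR_gt0.
rewrite -lee_pdivrMl// hnu//.
have := @integral_cst _ _ _ mu ((@Some X) @^-1` E) mE ((P `^ q)^-1)%:E; move=> <-.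
apply: ge0_le_integral => //.
- by move=> x _; rewrite lee_fin invr_ge0 ltW.
- by apply: measurable_funTS; exact: measurable_hat_density.
- by move=> x Ex; apply: hat_density_ge => //; exact: EP.
Qed.

(** On [E] the measure [nu] is at most P^-q times the image of [mu] under [Some]; infinity carries
    no mass, so the condition on [E] concerns points of X only. *)
Lemma le_integral_nu P (E : set (hatX X)) f : measurable E -> 0 < P ->
  (forall x, E (Some x) -> P <= 1 + nrm x) ->
  (forall x, 0 <= f x)%E -> measurable_fun E f ->
  (\int[nu]_(x in E) f x <=
   ((P `^ q)^-1)%:E * \int[mu]_(x in (@Some X) @^-1` E) f (Some x))%E.
Proof.
move=> mE P0 EP f0 mf.
rewrite -(@ge0_integral_pushforward _ _ _ _ _ _ measurable_Some)//.
apply: (@le_integral_of_measure_le _ _ _ _ (pushforward_measure mu measurable_Some)) => //.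
  by rewrite invr_ge0 powR_ge0.
move=> F mF FE; apply: nu_le => // x /FE; exact: EP.
Qed.

Lemma le_integral_mu P (E : set (hatX X)) f : measurable E -> 0 < P ->
  (forall x, E (Some x) -> 1 + nrm x <= P) ->
  (forall x, 0 <= f x)%E -> measurable_fun E f ->
  (\int[mu]_(x in (@Some X) @^-1` E) f (Some x) <=
   (P `^ q)%:E * \int[nu]_(x in E) f x)%E.
Proof.
move=> mE P0 EP f0 mf.
rewrite -(@ge0_integral_pushforward _ _ _ _ _ _ measurable_Some)//.
apply: (@le_integral_of_measure_le _ _ _ (pushforward_measure mu measurable_Some)) => //.
  by rewrite powR_ge0.
move=> F mF FE; apply: nu_ge => // x /FE; exact: EP.
Qed.

End weighted_measure.

(** * Chains in annuli *)

(** The cost of enlarging a radius K times. With n = truncn K + 1 one has K < n < 2^n, so n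
    doublings are enough. *)
Definition dbl_const {R : realType} (C_mu K : R) : R := C_mu ^+ (Num.truncn K).+1.

(** [j] is the first index with value at least y, and [i] the last one up to j with value at most
    x. *)
Lemma nat_crossing {R : realType} (u : nat -> R) (m : nat) (x y : R) :
  u 0%N <= x -> x < y -> y <= u m ->
  exists i j, [/\ (i < j <= m)%N, u i <= x, y <= u j &
    forall k, (i < k < j)%N -> x < u k < y].
Proof.
move=> u0 xy um; have exj : exists j, (y <= u j) by exists m.
case: (ex_minnP exj) => j hj minj.
pose Q i := (i <= j)%N && (u i <= x).
have exQ : exists i, Q i by exists 0%N; rewrite /Q leq0n.
have bQ i : Q i -> (i <= j)%N by case/andP.
case: (ex_maxnP exQ bQ) => i /andP[ij hi] maxi.
exists i, j; split=> //.
  rewrite minj// andbT ltn_neqAle ij andbT; apply/eqP => e.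
  by move: xy; rewrite ltNge (le_trans hj)// -e.
move=> k /andP[ik kj]; rewrite !ltNge; apply/andP; split; apply/negP => h.
- by have := maxi k; rewrite /Q (ltnW kj) h leqNgt ik => /(_ isT).
- by have := minj k h; rewrite leqNgt kj.
Qed.

Section chains.
Context {R : realType} {X : Type} (dist : X -> X -> R).
Hypothesis distM : is_metric dist.

(** A discrete curve. The curves of annular connectivity need not be rectifiable and have no useful
    length; turned into chains they can be shortened and their steps counted. *)
Definition chain (Om : set X) (rho : R) (n : nat) (f : nat -> X) : Prop :=
  (forall i, (i <= n)%N -> Om (f i)) /\
  (forall i, (i < n)%N -> dist (f i) (f i.+1) < rho).

Definition reach (Om : set X) (rho : R) (x y : X) : Prop :=
  exists n f, [/\ chain Om rho n f, f 0%N = x & f n = y].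

Lemma reach_refl Om rho x : Om x -> reach Om rho x x.
Proof. by move=> Ox; exists 0%N, (fun=> x); split=> //; split=> // i _. Qed.

Lemma reach_step Om rho x y : Om x -> Om y -> dist x y < rho -> reach Om rho x y.
Proof.
move=> Ox Oy xy; exists 1%N, (fun i => if i is 0%N then x else y).
by split=> //; split=> -[|i].
Qed.

Lemma reach_trans Om rho y x z : reach Om rho x y -> reach Om rho y z -> reach Om rho x z.
Proof.
move=> [n [f [[fO fs] f0 fn]]] [m [g [[gO gs] g0 gm]]].
pose u i := if (i <= n)%N then f i else g (i - n)%N.
have uf i : (i <= n)%N -> u i = f i by rewrite /u => ->.
have ug i : u (n + i)%N = g i.
  rewrite /u; case: i => [|i]; first by rewrite addn0 leqnn fn g0.
  by rewrite leqNgt addnS ltnS leq_addr /= -addnS addKn.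
exists (n + m)%N, u; split; [split=> i|by rewrite uf|by rewrite ug].
- case: (leqP i n) => [i_n _|n_i i_nm]; first by rewrite uf//; exact: fO.
  by rewrite -(subnKC (ltnW n_i)) ug; apply: gO; lia.
- case: (ltnP i n) => [i_n _|n_i i_nm]; first by rewrite !uf ?(ltnW i_n)//; exact: fs.
  by rewrite -(subnKC n_i) -addnS !ug; apply: gs; lia.
Qed.

Lemma reach_sym Om rho x y : reach Om rho x y -> reach Om rho y x.
Proof.
move=> [n [f [[fO fs] f0 fn]]]; exists n, (fun i => f (n - i)%N).
split; [split=> i i_n|by rewrite subn0|by rewrite subnn].
- by apply: fO; lia.
- by rewrite is_metric_sym// (_ : (n - i)%N = (n - i.+1).+1); [apply: fs|]; lia.
Qed.

Lemma sub_chain Om rho n f i j : chain Om rho n f -> (i <= j)%N -> (j <= n)%N ->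
  reach Om rho (f i) (f j).
Proof.
move=> [fO fs] ij jn; exists (j - i)%N, (fun k => f (i + k)%N); split.
- by split=> k kji; [apply: fO|rewrite addnS; apply: fs]; lia.
- by rewrite addn0.
- by rewrite subnKC.
Qed.

Lemma reach_sub Om Om' rho x y : Om `<=` Om' -> reach Om rho x y -> reach Om' rho x y.
Proof.
move=> OO [n [f [[fO fs] f0 fn]]]; exists n, f; split=> //; split=> // i i_n.
exact/OO/fO.
Qed.

(** In a chain with the least number of steps, two non-consecutive points closer than [rho] would
    allow a shortcut. *)
Lemma reach_minimal Om rho x y : reach Om rho x y ->
  exists n f, [/\ chain Om rho n f, f 0%N = x, f n = y &
    forall i j, (i.+1 < j)%N -> (j <= n)%N -> rho <= dist (f i) (f j)].
Proof.
move=> hr; pose P n := `[<exists f, [/\ chain Om rho n f, f 0%N = x & f n = y]>].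
have exP : exists n, P n.
  by have [n [f h]] := hr; exists n; apply/asboolP; exists f.
case: (ex_minnP exP) => n /asboolP[f [fc f0 fn]] nmin.
exists n, f; split=> // i j ij jn; rewrite leNgt; apply/negP => fij.
have [fO fs] := fc.
pose g k := if (k <= i)%N then f k else f (k + (j - i.+1))%N.
have : P (n - (j - i.+1))%N.
  apply/asboolP; exists g; split.
  - split=> k kn; rewrite /g.
      by case: (leqP k i) => ki; apply: fO; lia.
    case: (ltngtP k i) => ki.
    + by apply: fs; lia.
    + by rewrite addSn; apply: fs; lia.
    + by rewrite ki (_ : (i.+1 + (j - i.+1))%N = j)//; lia.
  - by rewrite /g leq0n.
  - have h : (i < n - (j - i.+1))%N by lia.
    by rewrite /g leqNgt h /= subnK//; lia.
by move/nmin; lia.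
Qed.

Lemma curve_reach Om rho gam : 0 < rho -> dcurve dist gam ->
  (forall t, 0 <= t <= 1 -> Om (gam t)) -> reach Om rho (gam 0) (gam 1).
Proof.
move=> rho0 gC gO.
apply: (@unit_interval_ind _ (fun t => reach Om rho (gam 0) (gam t))) => [|t tI|].
- by apply/reach_refl/gO; rewrite lexx ler01.
- have [e e0 he] := gC t tI rho rho0.
  exists e => // t' t'I tt'.
  have st : reach Om rho (gam t) (gam t') by apply: reach_step; [exact: gO..|exact: he].
  by split=> h; [apply: reach_trans h st|apply: reach_trans h (reach_sym st)].
- by rewrite lexx ler01.
Qed.

End chains.

Section space.
Context {R : realType} (p C_mu C_PI lam s C_s A R_A q : R).
Context {dX : measure_display} {X : measurableType dX}.
Variables (dist : X -> X -> R) (mu : {measure set X -> \bar R}) (a : X).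
Variable nu : {measure set (hatX X) -> \bar R}.
Hypothesis p1 : 1 <= p.
Hypothesis s0 : 0 < s.
Hypothesis Cs0 : 0 < C_s.
Hypothesis sq : s < q.
Hypothesis A1 : 1 <= A.
Hypothesis RA1 : 1 <= R_A.
Hypothesis distM : is_metric dist.
Hypothesis unbounded : forall M : R, exists x, M < dist x a.
Hypothesis mO : forall O, dopen dist O -> measurable O.
Hypothesis mub : forall x r, 0 < r -> (0 < mu (dball dist x r) < +oo)%E.
Hypothesis doubling : forall x r, 0 < r ->
  (mu (dball dist x (2 * r)) <= C_mu%:E * mu (dball dist x r))%E.
Hypothesis PI : supports_PI dist mu p C_PI lam.
Hypothesis decay : forall r R' : R, 1 <= r -> r <= R' ->
  fine (mu (dball dist a r)) / fine (mu (dball dist a R')) >= C_s * (r / R') `^ s.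
Hypothesis annular : forall x y, dist x a = dist y a -> R_A <= dist x a ->
  exists gam : R -> X, [/\ dcurve dist gam, gam 0 = x, gam 1 = y &
    forall t, 0 <= t <= 1 ->
      dball dist a (A * dist x a) (gam t) /\
      ~ dclosure dist (dball dist a (dist x a / A)) (gam t)].
Hypothesis hnu : forall E : set (hatX X), measurable E ->
  nu E = (\int[mu]_(x in (@Some X) @^-1` E) hat_density dist a q x)%E.

Local Notation nrm := (nrm dist a).
Local Notation hat_d := (hat_d dist a).
Local Notation height := (height dist a).
Local Notation vol := (vol dist mu).
Local Notation D := (dbl_const C_mu).

Lemma lam_ge1 : 1 <= lam. Proof. by case: PI. Qed.
Let lam0 : 0 < lam. Proof. exact: lt_le_trans lam_ge1. Qed.
Let A0 : 0 < A. Proof. exact: lt_le_trans A1. Qed.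

Lemma vol_double x r : 0 < r -> vol x (2 * r) <= C_mu * vol x r.
Proof. by move=> r0; rewrite -lee_fin EFinM -!(volE mub)// ?doubling// mulr_gt0. Qed.

Lemma le_vol_radius x r r' : 0 < r -> r <= r' -> vol x r <= vol x r'.
Proof.
move=> r0 rr'; apply: (le_vol distM mO mub) => //; first exact: lt_le_trans rr'.
by move=> y; rewrite /dball /= => /lt_le_trans; exact.
Qed.

Lemma C_mu_ge1 : 1 <= C_mu.
Proof.
have v0 := vol_gt0 mub a (@ltr01 R).
have := vol_double a (@ltr01 R).
have := @le_vol_radius a 1 (2 * 1) ltr01 ltac:(lra) => h1 h2.
by rewrite -(ler_pM2r v0) mul1r; exact: le_trans h2.
Qed.

Lemma dbl_const_ge1 K : 1 <= D K.
Proof. by rewrite /dbl_const exprn_ege1// C_mu_ge1. Qed.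

Lemma vol_dbl x r K : 0 < r -> 0 < K -> vol x (K * r) <= D K * vol x r.
Proof.
move=> r0 K0; have hn n : vol x (2 ^+ n * r) <= C_mu ^+ n * vol x r.
  elim: n => [|n IH]; first by rewrite !expr0 !mul1r.
  rewrite !exprS -!mulrA; apply: (le_trans (vol_double _ _)).
    by rewrite mulr_gt0// exprn_gt0.
  by rewrite ler_wpM2l//; apply: le_trans C_mu_ge1.
apply: le_trans (hn (Num.truncn K).+1); apply: le_vol_radius; first exact: mulr_gt0.
rewrite ler_wpM2r ?ltW//; apply: (lt_le_trans (truncnS_gt K)).
by rewrite -natrX ler_nat ltnW// ltn_expl.
Qed.

Lemma vol_cmp x y r r' K : 0 < r -> 0 < r' -> dist x y + r <= K * r' ->
  vol y r <= D K * vol x r'.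
Proof.
move=> r0 r'0 h; have K0 : 0 < K.
  rewrite -(pmulr_lgt0 _ r'0); apply: lt_le_trans h.
  by rewrite ltr_wpDl// (is_metric_ge0 distM).
apply: le_trans (vol_dbl x r'0 K0); apply: (le_vol distM mO mub) => //.
  by rewrite mulr_gt0.
move=> z; rewrite /dball /= => yz; have := is_metric_tri distM y x z; lra.
Qed.

(** The balls of radius rho/2 about the points are disjoint and lie in B(a, P + rho). Each has at
    least the fraction 1 / D K of its volume, as 2 P + rho <= K (rho/2); this is the condition on
    K. *)
Lemma packing (f : nat -> X) (M : nat) (P rho K : R) : 0 < rho -> 0 < P ->
  (forall i, (i < M)%N -> nrm (f i) < P) ->
  (forall i j, (i < j)%N -> (j < M)%N -> rho <= dist (f i) (f j)) ->
  4 * P + 2 * rho <= K * rho -> M%:R <= D K.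
Proof.
move=> rho0 P0 fP fsep hK.
pose F i := if (i < M)%N then dball dist (f i) (rho / 2) else set0.
have mF i : measurable (F i).
  by rewrite /F; case: ifP => // _; exact: measurable_dball.
have tF : trivIset setT F.
  have aux i j : (i < j)%N -> F i `&` F j = set0.
    move=> ij; apply/seteqP; split=> // z []; rewrite /F.
    case: ifP => // iM; case: ifP => // jM; rewrite /dball /= => iz jz.
    have := fsep i j ij jM; have := is_metric_tri distM z (f i) (f j).
    rewrite (is_metric_sym distM z); lra.
  apply/trivIsetP => i j _ _; rewrite neq_lt => /orP[|ji]; first exact: aux.
  by rewrite setIC; exact: aux.
have mU : measurable (\big[setU/set0]_(i < M) F i) by exact: bigsetU_measurable.
have V0 := vol_gt0 mub a (addr_gt0 P0 rho0).
have hU : (mu (\big[setU/set0]_(i < M) F i) <= (vol a (P + rho))%:E)%E.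
  apply: (mu_sub_dball distM mO mub) => //; first exact: addr_gt0.
  rewrite -bigcup_mkord => z [i /= iM]; rewrite /F iM /dball /= => iz.
  have := fP i iM; rewrite /Defs.nrm (is_metric_sym distM).
  have := is_metric_tri distM (f i) a z; lra.
have D0 : 0 < D K by apply: lt_le_trans (dbl_const_ge1 K).
rewrite -(ler_pM2r V0) -ler_pdivrMl// -lee_fin.
apply: le_trans hU; rewrite measure_semi_additive//.
apply: (@le_trans _ _ (\sum_(i < M) ((D K)^-1 * vol a (P + rho))%:E)%E).
  by rewrite sumEFin lee_fin sumr_const card_ord -[leRHS]mulr_natl mulrCA.
apply: lee_sum => i _; rewrite /F ltn_ord /= (volE mub) ?lee_fin ?ler_pdivrMl//; last by lra.
apply: vol_cmp; [lra|lra|]; rewrite -/(nrm _).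
have := fP i (ltn_ord i); lra.
Qed.

(** A rho-separated family in [E] of maximal size, which exists by [packing], is a rho-net. *)
Lemma finite_cover (E : set X) (P rho K : R) : 0 < rho -> 0 < P ->
  (forall x, E x -> nrm x < P) -> 4 * P + 2 * rho <= K * rho ->
  exists M (f : nat -> X), [/\ M%:R <= D K, forall i, (i < M)%N -> E (f i) &
    forall x, E x -> exists2 i, (i < M)%N & dball dist (f i) rho x].
Proof.
move=> rho0 P0 EP hK.
pose Q M := `[<exists f : nat -> X, (forall i, (i < M)%N -> E (f i)) /\
  (forall i j, (i < j)%N -> (j < M)%N -> rho <= dist (f i) (f j))>].
have exQ : exists M, Q M by exists 0%N; apply/asboolP; exists (fun=> a).
have bQ M : Q M -> (M <= Num.truncn (D K))%N.
  move=> /asboolP[f [fE fs]]; rewrite truncn_ge_nat; last first.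
    by apply: le_trans (dbl_const_ge1 K).
  by apply: (packing rho0 P0 _ fs hK) => i /fE; exact: EP.
case: (ex_maxnP exQ bQ) => M QM maxM; have /asboolP[f [fE fs]] := QM.
exists M, f; split=> //.
  by apply: (packing rho0 P0 _ fs hK) => i /fE; exact: EP.
move=> x Ex; apply: contrapT => h.
have : Q M.+1; last by move/maxM; rewrite ltnn.
apply/asboolP; exists (fun i => if (i < M)%N then f i else x); split.
  by move=> i _; case: ifP => // /fE.
move=> i j ij; rewrite ltnS leq_eqVlt => /orP[/eqP jM|jM]; last first.
  by rewrite jM (ltn_trans ij jM); exact: fs.
rewrite jM ltnn -jM ij leNgt; apply/negP => fix_.
by apply: h; exists i => //; rewrite -jM.
Qed.

(** Every second point of a minimal chain belongs to a rho-separated family, whose size [packing]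
    bounds; hence the factor 2. *)
Lemma reach_short Om (P rho K : R) x y : 0 < rho -> 0 < P ->
  (forall z, Om z -> nrm z < P) -> 4 * P + 2 * rho <= K * rho ->
  reach dist Om rho x y ->
  exists n f, [/\ chain dist Om rho n f, f 0%N = x, f n = y & n%:R <= 2 * D K].
Proof.
move=> rho0 P0 OP hK hr; have [n [f [[fO fs] f0 fn fsep]]] := reach_minimal hr.
exists n, f; split=> //.
have : (n./2.+1)%:R <= D K.
  apply: (@packing (fun i => f i.*2) _ P rho) => // [i i_n|i j ij jn].
    by apply/OP/fO; clear -i_n; lia.
  by apply: fsep; [clear -ij|clear -jn]; lia.
rewrite -(ler_pM2l (@ltr0n R 2)) -natrM; apply: le_trans.
by rewrite ler_nat; clear; lia.
Qed.

(** Being reachable from [a] by eta-steps inside a closed ball is a locally constant property there,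
    so [cball_connected] spreads it to y. *)
Lemma space_reach (eta : R) y : 0 < eta -> reach dist setT eta a y.
Proof.
move=> eta0; have r0 : 0 < dist a y + 1 by have := is_metric_ge0 distM a y; lra.
pose F := cball dist a (lam * (dist a y + 1)).
apply: (@reach_sub _ _ _ F) => //.
have Fa : F a by rewrite /F /cball /= (is_metric_xx distM) ltW// mulr_gt0.
apply: (@cball_connected _ p C_PI lam _ _ dist mu p1 distM mO mub PI a _
   (reach dist F eta a) r0 _ a y) => //.
- move=> z Fz; exists eta => // w Fw zw.
  have st : reach dist F eta z w by exact: reach_step.
  split=> h; first exact: reach_trans h st.
  by apply: reach_trans h _; exact: reach_sym.
- by rewrite /dball /= (is_metric_xx distM).
- by rewrite /dball /=; lra.
- exact: reach_refl.
Qed.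

(** An intermediate value theorem for one step of a chain: if no point of the closed ball had norm
    t, then [nrm < t] would be relatively clopen in it and would separate x from y. *)
Lemma cross_norm x y (r t : R) : 0 < r -> dist x y < r -> nrm x <= t -> t <= nrm y ->
  exists2 z, nrm z = t & dist x z <= lam * r.
Proof.
move=> r0 xy xt ty; apply: contrapT => h.
have nz z : cball dist x (lam * r) z -> nrm z <> t by move=> Fz zt; apply: h; exists z.
have xlt : nrm x < t.
  rewrite lt_neqAle xt andbT; apply/eqP => e; apply: (nz x) => //.
  by rewrite /cball /= (is_metric_xx distM) ltW// mulr_gt0.
have : nrm y < t; last by rewrite ltNge ty.
apply: (@cball_connected _ p C_PI lam _ _ dist mu p1 distM mO mub PI x r
   (fun z => nrm z < t) r0 _ x y) => //.
- move=> z Fz; have := nz z Fz => /eqP; rewrite neq_lt => /orP[zt|tz].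
    exists (t - nrm z); first lra.
    move=> w Fw zw; split=> // _; have := nrm_lip a distM w z.
    by rewrite (is_metric_sym distM w); lra.
  exists (nrm z - t); first lra.
  move=> w Fw zw; have := nrm_lip a distM z w; split=> ?; exfalso; lra.
- by rewrite /dball /= (is_metric_xx distM).
Qed.

Lemma exists_nrm t : 0 <= t -> exists z, nrm z = t.
Proof.
move=> t0; have [y ty] := unbounded t.
have r0 : 0 < dist a y + 1 by have := is_metric_ge0 distM a y; lra.
have at_ : nrm a <= t by rewrite /Defs.nrm (is_metric_xx distM).
by have [z zt _] := @cross_norm a y _ t r0 ltac:(lra) at_ (ltW ty); exists z.
Qed.

(** A chain from [a] to infinity contains a piece crossing the annulus
    [R' <= |.| <= 2 R']. *)
Lemma radial_chain (R' eta : R) : 0 < R' -> 0 < eta ->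
  exists n f, [/\ chain dist [set z | R' - eta <= nrm z <= 2 * R' + eta] eta n f,
    nrm (f 0%N) <= R' & 2 * R' <= nrm (f n)].
Proof.
move=> R0 eta0; have [y hy] := unbounded (2 * R').
have [m [f [[_ fs] f0 fm]]] := space_reach y eta0.
have u0 : nrm (f 0%N) <= R' by rewrite f0 /Defs.nrm (is_metric_xx distM) ltW.
have um : 2 * R' <= nrm (f m) by rewrite fm ltW.
have [i [j [/andP[ij jm] hi hj hk]]] :=
  @nat_crossing _ (fun i => nrm (f i)) m R' (2 * R') u0 ltac:(lra) um.
have step k : (k < m)%N -> nrm (f k) - eta < nrm (f k.+1) < nrm (f k) + eta.
  move=> /fs; have := nrm_lip a distM (f k) (f k.+1); have := nrm_lip a distM (f k.+1) (f k).
  by rewrite (is_metric_sym distM (f k.+1)); lra.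
have low k : (i < k)%N -> (k <= j)%N -> R' < nrm (f k).
  rewrite (leq_eqVlt k) => ik /orP[/eqP ->|kj]; first by lra.
  by have /andP[] := hk k ltac:(by rewrite ik kj).
have upp k : (i <= k)%N -> (k < j)%N -> nrm (f k) < 2 * R'.
  rewrite leq_eqVlt => /orP[/eqP <-|ik] kj; first by lra.
  by have /andP[] := hk k ltac:(by rewrite ik kj).
have fI k : (i <= k)%N -> (k <= j)%N -> R' - eta <= nrm (f k) <= 2 * R' + eta.
  move=> ik kj; apply/andP; split.
    move: ik; rewrite leq_eqVlt => /orP[/eqP <-|ik]; last by have := low k ik kj; lra.
    by have := low i.+1 (leqnn _) ij; have := step i (leq_trans ij jm); lra.
  case: k ik kj => [|k] ik kj; first by lra.
  move: ik; rewrite leq_eqVlt => /orP[/eqP <-|ik]; first by lra.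
  by have := upp k ik kj; have := step k (leq_trans kj jm); lra.
exists (j - i)%N, (fun k => f (i + k)%N); split.
- split=> k kn; last by rewrite addnS; apply: fs; apply: leq_trans jm; rewrite -ltn_subRL.
  by apply: fI; rewrite ?leq_addr// -leq_subRL// ltnW.
- by rewrite addn0.
- by rewrite subnKC// ltnW.
Qed.

(** Every point w of the annulus is linked to the start of one fixed radial chain: the chain passes
    close to a point z with the norm of w, and annular connectivity joins w to z. *)
Lemma annulus_reach (R' rho : R) x y : R_A <= R' -> 0 < rho -> rho <= R' / 2 ->
  R' <= nrm x <= 2 * R' -> R' <= nrm y <= 2 * R' ->
  reach dist [set z | R' / (2 * A) <= nrm z <= 3 * A * R'] rho x y.
Proof.
move=> RAR rho0 rhoR xI yI; set Om := [set z | _ <= nrm z <= _].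
have R0 : 0 < R' by lra.
have hA1 : R' / (2 * A) <= R' / 2.
  by have := A1; rewrite ler_pM2l// lef_pV2 ?posrE ?mulr_gt0//; lra.
have hA2 : R' <= A * R' by rewrite ler_peMl// ltW.
(* The radial chain has steps below rho / (4 lam), so that [cross_norm], which loses a factor lam,
   still finds z closer than rho to the chain. *)
have eta0 : 0 < rho / (4 * lam) by rewrite divr_gt0// mulr_gt0.
have eta_rho : rho / (4 * lam) <= rho / 4.
  rewrite ler_pM2l// lef_pV2 ?posrE ?mulr_gt0//; have := lam_ge1; lra.
have [n [f [fc f0 fn]]] := radial_chain R0 eta0.
have [fO fs] := fc.
have subOm : [set z | R' - rho / (4 * lam) <= nrm z <= 2 * R' + rho / (4 * lam)] `<=` Om.
  by move=> z /=; rewrite /Om /= -mulrA; lra.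
have fcO : chain dist Om rho n f.
  split=> i i_n; first exact/subOm/fO.
  by have := fs i i_n; lra.
have key w : R' <= nrm w <= 2 * R' -> reach dist Om rho w (f 0%N).
  move=> wI.
  have exi : exists i, nrm w <= nrm (f i) by exists n; lra.
  case: (ex_minnP exi) => i hi mini.
  have i_n : (i <= n)%N by apply: mini; lra.
  have [j [z [jn zw jz]]] : exists j z, [/\ (j <= n)%N, nrm z = nrm w & dist (f j) z < rho].
    (* If the first point of the chain already has norm at least that of w, both norms equal R' and
       z is that point itself; otherwise the step from i to i+1 crosses the norm of w. *)
    case: i hi mini i_n => [|i] hi mini i_n.
      by exists 0%N, (f 0%N); split=> //; [lra|rewrite (is_metric_xx distM)].
    have hi' : nrm (f i) <= nrm w.
      by rewrite leNgt; apply/negP => /ltW /mini; rewrite ltnn.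
    have r0 : 0 < rho / (2 * lam) by rewrite divr_gt0// mulr_gt0.
    have hstep : dist (f i) (f i.+1) < rho / (2 * lam).
      apply: lt_le_trans (fs i i_n) _; rewrite ler_pM2l// lef_pV2 ?posrE ?mulr_gt0//.
      by rewrite ler_pM2r//; lra.
    have [z zw dz] := cross_norm r0 hstep hi' hi.
    exists i, z; split=> //; first exact: ltnW.
    apply: (le_lt_trans dz).
    have -> : lam * (rho / (2 * lam)) = rho / 2 by field; rewrite gt_eqF.
    by lra.
  have wz : reach dist Om rho w z.
    have [gam [gC g0 g1 hg]] := annular (esym zw) ltac:(rewrite -/(nrm _); lra).
    rewrite -g0 -g1; apply: curve_reach => // t tI; have [h1 h2] := hg t tI.
    have ga : nrm (gam t) = dist a (gam t) by rewrite /Defs.nrm (is_metric_sym distM).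
    rewrite /Om /= ga; apply/andP; split; last first.
      move: h1; rewrite /dball /= -/(nrm _) => /ltW h1; apply: (le_trans h1).
      by rewrite (mulrC 3) -mulrA ler_pM2l//; lra.
    (* A point outside the closure is outside the ball; it would be its own approximation. *)
    rewrite leNgt; apply/negP => h3; apply: h2 => e e0; exists (gam t); split.
      rewrite /dball /=; apply: (lt_le_trans h3); rewrite -/(nrm w).
      rewrite invfM mulrA ler_pM2r ?invr_gt0//; lra.
    by rewrite (is_metric_xx distM).
  apply: (reach_trans wz); apply/reach_sym/(@reach_trans _ _ _ _ _ (f j)) => //.
    exact: (sub_chain fcO).
  apply: reach_step => //; first by case: fcO => + _; exact.
  by rewrite /Om /= zw -mulrA; lra.
by apply: reach_trans (key x xI) _; apply/reach_sym/key.
Qed.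

(** * Measures of balls of the sphericalization *)

Let q0 : 0 < q. Proof. exact: lt_trans sq. Qed.

(** Up to constants, the [nu]-measure of the ball about infinity of radius 1/P, for P >= 1. *)
Definition weight (P : R) : R := vol a P / P `^ q.

Definition infty_nbhd (P : R) : set (hatX X) := [set y | height y <= P^-1].

Lemma weight_gt0 P : 0 < P -> 0 < weight P.
Proof. by move=> P0; rewrite divr_gt0 ?powR_gt0// (vol_gt0 mub). Qed.

Lemma decay_vol r r' : 1 <= r -> r <= r' ->
  vol a r' <= C_s^-1 * (r' / r) `^ s * vol a r.
Proof.
move=> r1 rr'; have r0 : 0 < r by exact: lt_le_trans r1.
have r'0 : 0 < r' by exact: lt_le_trans rr'.
have := decay r1 rr'; rewrite -/(vol a r) -/(vol a r') ler_pdivlMr ?(vol_gt0 mub)// => h.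
have e : (r' / r) `^ s * (r / r') `^ s = 1.
  by rewrite -powRM ?divr_ge0 ?ltW// mulrA divfK ?gt_eqF// divff ?gt_eqF// powR1.
have -> : vol a r' = C_s^-1 * (r' / r) `^ s * (C_s * (r / r') `^ s * vol a r').
  rewrite (_ : _ * _ * _ = (C_s^-1 * C_s) * ((r' / r) `^ s * (r / r') `^ s) * vol a r').
    by rewrite e mulVf ?gt_eqF// !mul1r.
  by ring.
by rewrite ler_wpM2l// mulr_ge0 ?powR_ge0// invr_ge0 ltW.
Qed.

(** Radii are those of [1 + nrm], the inverse height, as suits the measure [nu]. The annuli of the
    oscillation argument are dyadic in [nrm] and appear as [annulus (1 + Q) (1 + 2 * Q)]. *)
Definition annulus (r r' : R) : set X := [set x | r <= 1 + nrm x < r'].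

Lemma measurable_annulus r r' : measurable (annulus r r').
Proof.
have -> : annulus r r' = dball dist a (r' - 1) `\` dball dist a (r - 1).
  apply/seteqP; split=> x; rewrite /annulus /dball /= -(is_metric_sym distM x) -/(nrm x).
    by move=> /andP[h1 h2]; split; [|apply/negP; rewrite -leNgt]; lra.
  by move=> [h1 /negP]; rewrite -leNgt => h2; apply/andP; split; lra.
by apply: measurableD; exact: measurable_dball.
Qed.

Lemma annulus_cover P x : 0 < P -> P <= 1 + nrm x ->
  exists k, annulus (2 ^+ k * P) (2 ^+ k.+1 * P) x.
Proof.
by move=> P0 Px; have [k hk] := dyadic_bracket P0 Px; exists k.
Qed.

Lemma mu_annulus r r' : 0 < r' -> (mu (annulus r r') <= (vol a r')%:E)%E.
Proof.
move=> r'0; apply: (mu_sub_dball distM mO mub) => //; first exact: measurable_annulus.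
by move=> x /andP[_]; rewrite /dball /= (is_metric_sym distM) -/(nrm x); lra.
Qed.

Definition tail_ratio : R := 2 `^ (s - q).

Lemma tail_ratio_itv : 0 < tail_ratio < 1.
Proof.
rewrite /tail_ratio powR_gt0//=; have := @gt0_ltr_powR R (q - s) _ 1 2.
rewrite subr_gt0 => /(_ sq); rewrite !nnegrE powR1 => /(_ ler01 (ler0n _ _)).
move=> /(_ ltac:(lra)) h; by rewrite -opprB powRN invf_lt1.
Qed.

(** Over k - j doublings the volume grows at most like 2^(s(k-j)) and the denominator like
    2^(q(k-j)). *)
Lemma weight_decay P k j : 1 <= P -> (j <= k)%N ->
  weight (2 ^+ k * P) <= C_s^-1 * tail_ratio ^+ (k - j) * weight (2 ^+ j * P).
Proof.
move=> P1 jk; have P0 : 0 < P by exact: lt_le_trans P1.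
have e2 n : 0 < (2 : R) ^+ n by rewrite exprn_gt0.
have e21 n : 1 <= (2 : R) ^+ n by rewrite exprn_ege1//; lra.
have jP : 1 <= 2 ^+ j * P by rewrite mulr_ege1.
have ek : 2 ^+ k * P = 2 ^+ (k - j) * (2 ^+ j * P) by rewrite mulrA -exprD subnK.
have jP0 : 0 < 2 ^+ j * P by exact: mulr_gt0.
move: jP ek jP0; move: (2 ^+ j * P) (k - j)%N => Q n Q1 -> Q0.
have QnQ : Q <= 2 ^+ n * Q by rewrite ler_peMl// ltW.
have h := decay_vol Q1 QnQ; rewrite /weight ler_pdivrMr ?powR_gt0 ?mulr_gt0//.
apply: (le_trans h); rewrite mulfK ?gt_eqF// (powRM q (ltW (e2 n)) (ltW Q0)).
have -> : tail_ratio ^+ n = (2 ^+ n) `^ s / (2 ^+ n) `^ q.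
  by rewrite !powR_exprn// /tail_ratio powRB ?pnatr_eq0 ?implybT// exprMn exprVn.
rewrite le_eqVlt; apply/orP; left; apply/eqP.
have n1 : (2 ^+ n) `^ q != 0 :> R by rewrite gt_eqF// powR_gt0.
have n2 : Q `^ q != 0 :> R by rewrite gt_eqF// powR_gt0.
by field; rewrite n1 n2 gt_eqF.
Qed.

Lemma weight_scale kap P P' : 0 < kap -> 0 < P -> kap * P' <= P -> P <= P' ->
  weight P <= (kap `^ q)^-1 * weight P'.
Proof.
move=> k0 P0 h1 h2; have P'0 : 0 < P' by exact: lt_le_trans h2.
rewrite /weight mulrCA -invfM -(powRM q (ltW k0) (ltW P'0)); apply: ler_pM.
- exact/ltW/(vol_gt0 mub).
- by rewrite invr_ge0 powR_ge0.
- exact: le_vol_radius.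
rewrite lef_pV2 ?posrE ?powR_gt0 ?mulr_gt0//.
by apply: ge0_ler_powR => //; rewrite ?nnegrE ltW// mulr_gt0.
Qed.

(** Infinity is put into every shell so that the shells cover the whole neighbourhood; being a null
    set it does not affect the sum. *)
Definition shell (P : R) (k : nat) : set (hatX X) :=
  [set y | if y is Some x then annulus (2 ^+ k * P) (2 ^+ k.+1 * P) x else True].

Lemma measurable_shell P k : measurable (shell P k).
Proof. by apply: measurable_hat; exact: measurable_annulus. Qed.

Lemma infty_nbhd_cover P : 0 < P -> infty_nbhd P `<=` \bigcup_k shell P k.
Proof.
move=> P0 [x|]; rewrite /infty_nbhd /=; last by move=> _; exists 0%N.
rewrite lef_pV2 ?posrE ?(nrm1_gt0 a distM)// => /(annulus_cover P0)[k hk]; by exists k.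
Qed.

Lemma measurable_infty_nbhd P : 0 < P -> measurable (infty_nbhd P).
Proof.
move=> P0; apply: measurable_hat.
have -> : Some @^-1` infty_nbhd P = ~` dball dist a (P - 1).
  apply/seteqP; split=> x; rewrite /infty_nbhd /dball /= lef_pV2 ?posrE ?(nrm1_gt0 a distM)//;
    rewrite (is_metric_sym distM) -/(nrm x).
    by move=> h; apply/negP; rewrite -leNgt; lra.
  by move=> /negP; rewrite -leNgt; lra.
by apply: measurableC; exact: measurable_dball.
Qed.

Definition C_shell : R := C_s^-1 * 2 `^ s * C_s^-1.

Lemma nu_shell P k : 1 <= P ->
  (nu (shell P k) <= (C_shell * weight P * tail_ratio ^+ k)%:E)%E.
Proof.
move=> P1; have P0 : 0 < P by exact: lt_le_trans P1.
have kP0 n : 0 < 2 ^+ n * P by rewrite mulr_gt0// exprn_gt0.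
have kP1 n : 1 <= 2 ^+ n * P by rewrite mulr_ege1// exprn_ege1//; lra.
apply: (le_trans (nu_le q0 distM mO hnu (measurable_shell P k) (kP0 k) _)).
  by move=> x /andP[].
apply: (@le_trans _ _ (((2 ^+ k * P) `^ q)^-1 * vol a (2 ^+ k.+1 * P))%:E).
  rewrite EFinM lee_wpmul2l ?lee_fin ?invr_ge0 ?powR_ge0//.
  exact: mu_annulus.
rewrite lee_fin.
have h1 := @decay_vol (2 ^+ k * P) (2 ^+ k.+1 * P) (kP1 k).
have {}h1 := h1 ltac:(by rewrite ler_pM2r// exprS ler_peMl ?exprn_ge0//; lra).
have e : 2 ^+ k.+1 * P / (2 ^+ k * P) = 2.
  by rewrite exprS -(mulrA 2 (2 ^+ k) P) mulfK// gt_eqF.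
rewrite e in h1.
have h2 := @weight_decay P k 0 P1 (leq0n k); rewrite subn0 expr0 mul1r in h2.
apply: (@le_trans _ _ (C_s^-1 * 2 `^ s * weight (2 ^+ k * P))).
  by rewrite /weight mulrA mulrC ler_wpM2r// invr_ge0 powR_ge0.
apply: (@le_trans _ _ (C_s^-1 * 2 `^ s * (C_s^-1 * tail_ratio ^+ k * weight P))).
  by rewrite ler_wpM2l// mulr_ge0 ?powR_ge0// invr_ge0 ltW.
by rewrite /C_shell le_eqVlt; apply/orP; left; apply/eqP; ring.
Qed.

Definition C_tail : R := C_shell * (1 - tail_ratio)^-1.

Lemma C_shell_gt0 : 0 < C_shell.
Proof. by rewrite /C_shell !mulr_gt0 ?invr_gt0// powR_gt0. Qed.

Lemma C_tail_gt0 : 0 < C_tail.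
Proof.
have /andP[_ x1] := tail_ratio_itv.
by rewrite /C_tail mulr_gt0 ?C_shell_gt0// invr_gt0 subr_gt0.
Qed.

Lemma nu_infty_nbhd P : 1 <= P -> (nu (infty_nbhd P) <= (C_tail * weight P)%:E)%E.
Proof.
move=> P1; have P0 : 0 < P by exact: lt_le_trans P1.
have /andP[x0 x1] := tail_ratio_itv.
have w0 : 0 <= C_shell * weight P by rewrite mulr_ge0// ltW ?C_shell_gt0 ?weight_gt0.
apply: (@le_trans _ _ (\sum_(0 <= k <oo) nu (shell P k))%E).
  apply: measure_sigma_subadditive.
  - by move=> k; exact: measurable_shell.
  - exact: measurable_infty_nbhd.
  - exact: infty_nbhd_cover.
apply: (@le_trans _ _ (\sum_(0 <= k <oo) (C_shell * weight P * tail_ratio ^+ k)%:E)%E).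
  by apply: lee_nneseries => // k _; exact: nu_shell.
apply: nneseries_le => [k|n].
  by rewrite mulr_ge0// exprn_ge0// ltW.
rewrite -mulr_sumr /C_tail [leRHS]mulrAC ler_wpM2l//.
by apply: geometric_sum_le => //; exact: ltW.
Qed.

Lemma nu_ge_ball (E : set (hatX X)) z r P : measurable E -> 0 < r -> 0 < P ->
  (forall y, dball dist z r y -> 1 + nrm y <= P /\ E (Some y)) ->
  (((P `^ q)^-1 * vol z r)%:E <= nu E)%E.
Proof.
move=> mE r0 P0 h; have mB : measurable (dball dist z r) by exact: measurable_dball.
have mSB := measurable_image_Some mB.
apply: (@le_trans _ _ (nu ((@Some X) @` dball dist z r))); last first.
  by apply: le_measure; rewrite ?inE// => _ [y /h[_ ?] <-].
rewrite EFinM lee_pdivrMl ?powR_gt0// -(volE mub)//.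
rewrite -[X in mu X](preimage_image_Some (dball dist z r)).
by apply: (nu_ge q0 distM mO hnu) => // x [y /h[hy _] [<-]].
Qed.

Lemma nu_le_ball (E : set (hatX X)) z r P : measurable E -> 0 < r -> 0 < P ->
  (forall y, E (Some y) -> P <= 1 + nrm y /\ dball dist z r y) ->
  (nu E <= ((P `^ q)^-1 * vol z r)%:E)%E.
Proof.
move=> mE r0 P0 h; apply: (le_trans (nu_le q0 distM mO hnu mE P0 _)).
  by move=> x /h[].
rewrite EFinM lee_wpmul2l ?lee_fin ?invr_ge0 ?powR_ge0//.
by apply: (mu_sub_dball distM mO mub) => // x /h[].
Qed.

Definition c_ball (kap : R) : R := (5 `^ q)^-1 / D (8 / kap ^+ 2).

(** The ball contains a ball of X on which [1 + nrm] is at most of order 1/r' and whose volume is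
    comparable with that of B(a, 1/r'). The radius is capped at 1 because heights never exceed 1. *)
Lemma nu_hat_ball_ge (kap : R) x r : 0 < kap -> kap <= 1 -> 0 < r ->
  kap * height x <= Num.min r 1 ->
  ((c_ball kap * weight (Num.min r 1)^-1)%:E <= nu (dball hat_d x r))%E.
Proof.
move=> k0 k1 r0; set r' := Num.min r 1 => hx.
have r'0 : 0 < r' by rewrite lt_min r0 ltr01.
have r'r : r' <= r by rewrite ge_min lexx.
have r'1 : r' <= 1 by rewrite ge_min lexx orbT.
have D0 K : 0 < D K by apply: lt_le_trans (dbl_const_ge1 K).
have kk : 8 <= 8 / kap ^+ 2.
  by rewrite ler_peMr// invf_ge1 ?exprn_gt0// exprn_ile1// ltW.
(* The two choices of (z, t, P) below both satisfy these bounds; 5 is attained by the first and 8 /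
   kap^2 comes from the second. *)
have key z t P : 0 < t -> 0 < P -> P * r' <= 5 ->
    nrm z + r'^-1 <= 8 / kap ^+ 2 * t ->
    (forall y, dball dist z t y -> 1 + nrm y <= P /\ dball hat_d x r (Some y)) ->
    ((c_ball kap * weight r'^-1)%:E <= nu (dball hat_d x r))%E.
  move=> t0 P0 Pr hz hB; have mB := measurable_hat_ball a distM mO x r.
  apply: le_trans (nu_ge_ball mB t0 P0 hB); rewrite lee_fin.
  have v := @vol_cmp z a r'^-1 t _ ltac:(by rewrite invr_gt0) t0 hz.
  have Pr' : P <= 5 * r'^-1 by rewrite ler_pdivlMr.
  rewrite /c_ball /weight.
  have -> : (5 `^ q)^-1 / D (8 / kap ^+ 2) * (vol a r'^-1 / r'^-1 `^ q) =
     ((5 * r'^-1) `^ q)^-1 * (vol a r'^-1 / D (8 / kap ^+ 2)).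
    rewrite powRM ?invr_ge0 ?ltW// (invfM (5 `^ q)) mulrACA [RHS]mulrACA.
    by congr (_ * _); exact: mulrC.
  apply: ler_pM.
  - by rewrite invr_ge0 powR_ge0.
  - by rewrite divr_ge0 ?ltW// (vol_gt0 mub)// invr_gt0.
  - rewrite lef_pV2 ?posrE ?powR_gt0 ?mulr_gt0 ?invr_gt0//.
    by apply: ge0_ler_powR => //; rewrite ?nnegrE ltW// mulr_gt0 ?invr_gt0.
  - by rewrite ler_pdivrMr// mulrC.
have r'i : 1 <= r'^-1 by rewrite invf_ge1.
(* For a low centre, a ball about a point of norm 4/r' - 1 has heights at most r'/3, and r'/2 + r'/3
   < r. *)
have [hx2|hx2] := leP (height x) (r' / 2).
  have [z hz] := @exists_nrm (4 * r'^-1 - 1) ltac:(lra).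
  apply: (key z r'^-1 (5 * r'^-1)); rewrite ?invr_gt0 ?mulr_gt0 ?invr_gt0//.
  - by rewrite mulfVK// gt_eqF.
  - have : 5 * r'^-1 <= 8 / kap ^+ 2 * r'^-1 by rewrite ler_pM2r ?invr_gt0//; lra.
    by rewrite hz; lra.
  move=> y; rewrite /dball /= => zy.
  have h1 := nrm_lip a distM y z; have h2 := nrm_lip a distM z y.
  rewrite (is_metric_sym distM y) in h1; split; first by lra.
  apply: (le_lt_trans (hat_d_le_height a distM _ _)) => /=.
  have h3 : 3 * r'^-1 <= 1 + nrm y by lra.
  have : (1 + nrm y)^-1 <= r' / 3.
    rewrite -[leRHS]invrK lef_pV2 ?posrE ?nrm1_gt0 ?invr_gt0 ?divr_gt0//.
    by rewrite invfM invrK mulrC.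
  by lra.
(* A centre of height above r'/2 is not infinity, and the ball of X about x itself of radius kap (1
   + nrm x) / 4 will do. *)
case: x hx hx2 key => [x|] hx hx2 key; last by exfalso; move: hx2 => /=; lra.
have h0 := height_gt0 a distM x; have hN := height_inv a distM x.
have N0 := nrm1_gt0 a distM x; move: hx hx2.
set h := height (Some x) in h0 hN *; set N := 1 + nrm x in hN N0 * => hx hx2.
have kN0 : 0 < kap * N / 4 by rewrite divr_gt0// mulr_gt0.
have kN : kap * N <= N by rewrite ler_piMl// ltW.
have rN : r'^-1 <= N / kap.
  by rewrite -[leRHS]invrK lef_pV2 ?posrE ?invr_gt0 ?divr_gt0// invf_div.
apply: (key x (kap * N / 4) (5 * N / 4)) => //.
- by rewrite divr_gt0// mulr_gt0.
- have : N * r' <= 2.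
    have := ler_wpM2l (ltW N0) (ltW hx2); rewrite (mulrC N h) hN; lra.
  by lra.
- have -> : 8 / kap ^+ 2 * (kap * N / 4) = 2 * (N / kap) by field; rewrite gt_eqF.
  have : N <= N / kap by rewrite ler_pdivlMr// mulrC.
  by move: rN; rewrite /N; lra.
move=> y; rewrite /dball /= => xy.
have h1 := nrm_lip a distM y x; have h2 := nrm_lip a distM x y.
rewrite (is_metric_sym distM y) in h1.
split; first by move: kN xy; rewrite /N in h1 *; lra.
apply: (le_lt_trans (hat_d_le a distM _ _)); rewrite d_aE//.
set h' := height (Some y); have h'0 : 0 < h' by exact: height_gt0.
have hN' : h' * (1 + nrm y) = 1 by exact: height_inv.
have Ny : 3 / 4 * N <= 1 + nrm y by move: kN xy; rewrite /N in h2 *; lra.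
have hh : h' <= 4 / 3 * h.
  have : h' * (3 / 4 * N) <= 1 by rewrite -[leRHS]hN' ler_pM2l.
  move=> /(ler_wpM2l (ltW h0)).
  have -> : h * (h' * (3 / 4 * N)) = 3 / 4 * h' * (h * N) by ring.
  by rewrite hN; lra.
apply: (@lt_le_trans _ _ (kap * N / 4 * (h * (4 / 3 * h)))).
  apply: (@lt_le_trans _ _ (kap * N / 4 * (h * h'))).
    by rewrite ltr_pM2r// mulr_gt0.
  by rewrite ler_pM2l// ler_pM2l.
have -> : kap * N / 4 * (h * (4 / 3 * h)) = kap * h / 3 * (h * N) by field.
by rewrite hN mulr1; lra.
Qed.

(** All heights in the ball are at most r / kap, so it lies in a neighbourhood of infinity; the
    maximum with 1 keeps [P] in the range of the decay hypothesis. *)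
Lemma nu_hat_ball_le (kap rho : R) x r : 0 < kap -> kap <= 1 -> 0 < r ->
  height x + rho <= r / kap ->
  (nu (dball hat_d x rho) <= (C_tail * (kap `^ q)^-1 * weight (Num.min r 1)^-1)%:E)%E.
Proof.
move=> k0 k1 r0 hx; set r' := Num.min r 1.
have r'0 : 0 < r' by rewrite lt_min r0 ltr01.
have r'1 : r' <= 1 by rewrite ge_min lexx orbT.
pose P := Num.max 1 (kap / r').
have P1 : 1 <= P by rewrite le_max lexx.
have P0 : 0 < P by exact: lt_le_trans P1.
have Pk : kap / r' <= P by rewrite le_max lexx orbT.
have Pr : P <= r'^-1 by rewrite ge_max invf_ge1// r'1 ler_piMl// invr_ge0 ltW.
have sub : dball hat_d x rho `<=` infty_nbhd P.
  move=> y; rewrite /dball /infty_nbhd /= => xy.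
  have [kr|kr] := leP (kap / r') 1.
    by rewrite /P max_l// invr1 height_le1.
  rewrite /P (max_r (ltW kr)) invf_div.
  have r'k : r' < kap by move: kr; rewrite ltr_pdivlMr// mul1r.
  have -> : r' = r by rewrite /r' min_l// leNgt; apply/negP => ?; move: r'k; rewrite /r' min_r ?ltW//; lra.
  have := le_trans (hat_d_height a distM x y) (ltW xy).
  rewrite distrC => /(le_trans (ler_norm _)). lra.
apply: (@le_trans _ _ (nu (infty_nbhd P))).
  apply: le_measure; rewrite ?inE//; first exact: measurable_hat_ball.
  exact: measurable_infty_nbhd.
apply: (le_trans (nu_infty_nbhd P1)); rewrite lee_fin -mulrA ler_pM2l ?C_tail_gt0//.
exact: weight_scale.
Qed.

(** * Oscillation along dyadic annuli *)

Section functions.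
Variables (u g : hatX X -> \bar R).
Hypothesis iu : nu.-integrable setT u.
Hypothesis ug : upper_gradient hat_d u g.

Let g0 y : (0 <= g y)%E. Proof. by case: ug. Qed.
Let gb : dborel_fun hat_d g. Proof. by case: ug. Qed.
Let p0 : 0 < p. Proof. exact: lt_le_trans p1. Qed.
Let mg : measurable_fun setT g.
Proof. exact: (dborel_fun_hat_measurable distM mO gb). Qed.
Let mU : measurable_fun setT u. Proof. by case/integrableP: iu. Qed.
Let mgp : measurable_fun setT (fun y => poweR (g y) p).
Proof. exact: (measurableT_comp (measurable_poweR p)). Qed.

Definition pull (x : X) : \bar R := u (Some x).

Lemma measurable_pull : measurable_fun setT pull.
Proof. exact: (measurableT_comp mU (@measurable_Some _ X)). Qed.

(** With K * g as upper gradient in X, the factor K^p leaves the p-th root as K. The bound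
    [1 + nrm <= P] gives mu <= P^q nu on the ball, which yields both the integrability of [u]
    against [mu] and the bound for g^p. *)
Lemma hat_local_poincare (x : X) (rho K P G : R) (E : set (hatX X)) :
  0 < rho -> 0 < K -> 0 < P ->
  (forall y z, cball dist x (lam * rho) y -> cball dist x (lam * rho) z ->
    hat_d (Some y) (Some z) <= K * dist y z) ->
  (forall y, cball dist x (lam * rho) y -> 1 + nrm y <= P) ->
  measurable E -> (forall y, dball dist x (lam * rho) y -> E (Some y)) ->
  0 <= G -> (\int[nu]_(y in E) poweR (g y) p <= G%:E)%E ->
  exists c, osc mu pull (dball dist x rho) c
    (vol x rho * (C_PI * rho * K * (P `^ q * G / vol x (lam * rho)) `^ p^-1)).
Proof.
move=> rho0 K0 P0 hK hP mE BE G0 hG.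
have lr0 : 0 < lam * rho by rewrite mulr_gt0.
set F := cball dist x (lam * rho) in hK hP; set B := dball dist x (lam * rho) in BE.
have mF : measurable F by exact: measurable_cball.
have mB : measurable B by exact: measurable_dball.
have mSF := measurable_image_Some mF; have mSB := measurable_image_Some mB.
have iF : (\int[mu]_(y in F) `|pull y| < +oo)%E.
  rewrite -(preimage_image_Some F).
  apply: (le_lt_trans (@le_integral_mu _ _ _ _ _ _ _ _ q0 distM mO hnu P _
    (fun y => `|u y|%E) mSF P0 _ _ _)) => //.
  - by move=> y [z Fz [<-]]; exact: hP.
  - by apply: measurable_funTS; apply: (measurableT_comp (@abse_measurable R setT)).
  have : (\int[nu]_(y in (@Some X) @` F) `|u y| < +oo)%E.
    by have /integrableP[_ ] := integrableS measurableT mSF (@subsetT _ _) iu.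
  rewrite -!ge0_fin_numE ?mule_ge0 ?lee_fin ?powR_ge0 ?integral_ge0// => h.
  by rewrite fin_numM.
have g'b : dborel_fun dist (fun y => (K%:E * g (Some y))%E).
  apply/dborel_funP; apply: measurable_funeM; apply/dborel_funP.
  exact: (dborel_fun_Some distM gb).
have hM := hat_d_metric a distM.
have [|||c hc] := @local_poincare _ p C_PI lam _ _ dist mu p1 distM mO mub PI x rho pull
    (fun y => K%:E * g (Some y))%E (K `^ p * (P `^ q * G)) rho0 measurable_pull iF _ g'b.
- by move=> y; rewrite mule_ge0// lee_fin ltW.
- move=> gam gC gR [t [tI gt]] gF.
  have gK t1 t2 : 0 <= t1 <= 1 -> 0 <= t2 <= 1 ->
      hat_d (Some (gam t1)) (Some (gam t2)) <= K * dist (gam t1) (gam t2).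
    by move=> h1 h2; apply: hK; exact: gF.
  have C' := dcurve_lipschitz K0 gK gC; have R' := rectifiable_lipschitz distM K0 gK gR.
  have N' : nonconstant ((@Some X : X -> hatX X) \o gam).
    by exists t; split=> //= -[].
  case: ug => _ _ /(_ _ C' R' N') h; apply: (le_trans h).
  apply: (le_trans (line_integral_lipschitz distM hM K0 gK gC gR g0 gb)).
  rewrite /line_integral ge0_integralZl_EFin//; last exact: ltW.
  exact: (measurable_arclength_param distM gC gR (dborel_fun_Some distM gb)).
- rewrite (@eq_integral _ _ _ mu B (fun y => (K `^ p)%:E * poweR (g (Some y)) p))%E; last first.
    by move=> y _; rewrite poweRM ?lee_fin// ltW.
  have mgS : measurable_fun B (fun y => poweR (g (Some y)) p).
    by apply: measurable_funTS; exact: (measurableT_comp mgp (@measurable_Some _ X)).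
  rewrite ge0_integralZl_EFin ?powR_ge0//; last by move=> y _; exact: poweR_ge0.
  rewrite EFinM lee_wpmul2l ?lee_fin ?powR_ge0//.
  rewrite -(preimage_image_Some B).
  apply: (le_trans (@le_integral_mu _ _ _ _ _ _ _ _ q0 distM mO hnu P _
    (fun y => poweR (g y) p) mSB P0 _ _ _)).
  + by move=> y [z Bz [<-]]; apply: hP; exact: ltW.
  + by move=> y; exact: poweR_ge0.
  + exact: measurable_funTS.
  rewrite EFinM lee_wpmul2l ?lee_fin ?powR_ge0//; apply: le_trans hG.
  apply: ge0_subset_integral => //; first exact: measurable_funTS.
    by move=> y _; exact: poweR_ge0.
  by move=> _ [y By <-]; exact: BE.
exists c; apply: osc_le hc.
have v0 := vol_gt0 mub x lr0.
have Kp : (K `^ p) `^ p^-1 = K by rewrite -powRrM divff ?gt_eqF// powRr1// ltW.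
rewrite -(mulrA (K `^ p)) powRM ?powR_ge0//; last first.
  by rewrite divr_ge0 ?mulr_ge0 ?powR_ge0// ltW.
by rewrite Kp le_eqVlt; apply/orP; left; apply/eqP; ring.
Qed.

(** * Oscillation on a neighbourhood of infinity *)

Section tail.
Variables (E : set (hatX X)) (G : R).
Hypotheses (mE : measurable E) (G0 : 0 <= G).
Hypothesis hG : (\int[nu]_(y in E) poweR (g y) p <= G%:E)%E.

(** Chosen so that lam times the radius [2 * mesh Q] is Q / (6 A): around points of norm at least Q
    / (2 A) the dilated balls stay at norm at least Q / (3 A). *)
Definition mesh (Q : R) : R := Q / (12 * lam * A).

(** The size of the oscillation at level Q: a radius of order Q times the Lipschitz factor of order
    Q^-2, times the L^p mean of [g] on a set of measure about [weight Q]. *)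
Definition slope (Q : R) : R := Q^-1 * (G / weight Q) `^ p^-1.

(** 3/2 A / lam is what remains of [2 * mesh Q] times (3 A / Q)^2, where 3 A / Q bounds the heights;
    (5 A)^q comes from [1 + nrm <= 5 * A * Q], and the doubling factor from comparing B(a, Q) with
    the dilated ball. *)
Definition C_level : R :=
  C_PI * (3 / 2 * A / lam) * ((5 * A) `^ q * D (24 * A ^+ 2)) `^ p^-1.

Let C_PI0 : 0 < C_PI. Proof. by case: PI. Qed.

Let D0 K : 0 < D K. Proof. exact: lt_le_trans (dbl_const_ge1 K). Qed.

Lemma C_level_ge0 : 0 <= C_level.
Proof. by rewrite !mulr_ge0 ?powR_ge0 ?invr_ge0// ltW. Qed.

Lemma slope_ge0 Q : 0 < Q -> 0 <= slope Q.
Proof. by move=> Q0; rewrite mulr_ge0 ?powR_ge0// invr_ge0 ltW. Qed.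

Lemma mesh_gt0 Q : 0 < Q -> 0 < mesh Q.
Proof. by move=> Q0; rewrite divr_gt0// !mulr_gt0. Qed.

Lemma mesh_le Q : 0 < Q -> mesh Q <= Q / 12.
Proof.
move=> Q0; rewrite ler_pM2l// lef_pV2 ?posrE ?mulr_gt0//.
by rewrite -mulrA ler_peMr// mulr_ege1// lam_ge1.
Qed.

Lemma level_osc Q x : 1 <= Q -> (forall y, Q / (3 * A) <= nrm y -> E (Some y)) ->
  Q / (2 * A) <= nrm x <= 3 * A * Q ->
  exists c, osc mu pull (dball dist x (2 * mesh Q)) c
    (C_level * slope Q * vol x (2 * mesh Q)).
Proof.
move=> Q1 hE /andP[xl xu]; have Q0 : 0 < Q by exact: lt_le_trans Q1.
have A1' := A1; have l1 := lam_ge1.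
have rho0 : 0 < 2 * mesh Q by rewrite mulr_gt0// mesh_gt0.
have elr : lam * (2 * mesh Q) = Q / (6 * A).
  by rewrite /mesh; field; rewrite !gt_eqF.
have QA0 : 0 < Q / A by rewrite divr_gt0.
have e6 : Q / (6 * A) = Q / A / 6 by field; rewrite gt_eqF.
have e2 : Q / (2 * A) = Q / A / 2 by field; rewrite gt_eqF.
have e3 : Q / (3 * A) = Q / A / 3 by field; rewrite gt_eqF.
have QA : Q / A <= Q by rewrite ler_pdivrMr// ler_peMr// ltW.
have AQ : Q <= A * Q by rewrite ler_peMl// ltW.
rewrite e2 in xl; rewrite e3 in hE.
have inF y : cball dist x (lam * (2 * mesh Q)) y ->
    Q / A / 3 <= nrm y /\ 1 + nrm y <= 5 * A * Q.
  rewrite elr e6 /cball /= => xy; have h1 := nrm_lip a distM y x.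
  have h2 := nrm_lip a distM x y; rewrite (is_metric_sym distM y) in h1.
  by rewrite -mulrA in xu *; split; lra.
have hh y : cball dist x (lam * (2 * mesh Q)) y -> height (Some y) <= 3 * A / Q.
  move=> /inF[h _]; rewrite -[leRHS]invrK /= lef_pV2 ?posrE ?nrm1_gt0 ?invr_gt0 ?divr_gt0 ?mulr_gt0//.
  by rewrite invf_div e3; lra.
have K0 : 0 < (3 * A / Q) ^+ 2 by rewrite exprn_gt0// divr_gt0// mulr_gt0.
have P0 : 0 < 5 * A * Q by rewrite !mulr_gt0.
have hK y z : cball dist x (lam * (2 * mesh Q)) y -> cball dist x (lam * (2 * mesh Q)) z ->
    hat_d (Some y) (Some z) <= (3 * A / Q) ^+ 2 * dist y z.
  move=> /hh hy /hh hz; apply: (le_trans (hat_d_le a distM _ _)).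
  rewrite d_aE// mulrC ler_wpM2r ?(is_metric_ge0 distM)// expr2.
  by rewrite ler_pM// (height_ge0 a distM).
have hB y : dball dist x (lam * (2 * mesh Q)) y -> E (Some y).
  by move=> /ltW /inF[h _]; exact: hE.
have [c hc] := hat_local_poincare rho0 K0 P0 hK (fun y h => (inF y h).2) mE hB G0 hG.
exists c; apply: osc_le hc; rewrite mulrC ler_pM2r ?(vol_gt0 mub)//.
have lr0 : 0 < lam * (2 * mesh Q) by rewrite mulr_gt0.
have v0 := vol_gt0 mub x lr0; have va0 := vol_gt0 mub a Q0.
have w0 := weight_gt0 Q0.
have hv : vol a Q <= D (24 * A ^+ 2) * vol x (lam * (2 * mesh Q)).
  apply: vol_cmp => //; rewrite -/(nrm x) elr.
  have -> : 24 * A ^+ 2 * (Q / (6 * A)) = 4 * (A * Q) by field; rewrite gt_eqF.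
  by rewrite -mulrA in xu; lra.
have hpow : (5 * A * Q) `^ q * G / vol x (lam * (2 * mesh Q))
    <= (5 * A) `^ q * D (24 * A ^+ 2) * (G / weight Q).
  rewrite ler_pdivrMr// /weight invf_div powRM ?mulr_ge0 ?(ltW A0) ?(ltW Q0)//.
  have -> : (5 * A) `^ q * D (24 * A ^+ 2) * (G * (Q `^ q / vol a Q)) * vol x (lam * (2 * mesh Q))
     = (5 * A) `^ q * Q `^ q * G * (D (24 * A ^+ 2) * vol x (lam * (2 * mesh Q)) / vol a Q).
    by ring.
  by rewrite ler_peMr ?mulr_ge0 ?powR_ge0// ler_pdivlMr// mul1r.
have h1 : ((5 * A * Q) `^ q * G / vol x (lam * (2 * mesh Q))) `^ p^-1 <=
    ((5 * A) `^ q * D (24 * A ^+ 2)) `^ p^-1 * (G / weight Q) `^ p^-1.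
  have n1 : 0 <= (5 * A) `^ q * D (24 * A ^+ 2) by rewrite mulr_ge0 ?powR_ge0// ltW.
  have n2 : 0 <= G / weight Q by rewrite divr_ge0// ltW.
  rewrite -powRM//; apply: ge0_ler_powR => //; rewrite ?nnegrE.
  - by rewrite invr_ge0 ltW.
  - by rewrite divr_ge0 ?mulr_ge0 ?powR_ge0// ltW.
  - exact: mulr_ge0.
have -> : C_PI * (2 * mesh Q) * (3 * A / Q) ^+ 2 = C_PI * (3 / 2 * A / lam) * Q^-1.
  by rewrite /mesh; field; rewrite !gt_eqF.
have -> : C_level * slope Q = C_PI * (3 / 2 * A / lam) * Q^-1 *
    (((5 * A) `^ q * D (24 * A ^+ 2)) `^ p^-1 * (G / weight Q) `^ p^-1).
  by rewrite /C_level /slope; ring.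
rewrite ler_wpM2l// !mulr_ge0 ?invr_ge0// ltW//.
Qed.

(** Solves 4 P + 2 rho = K rho for rho = [mesh Q] and P = 4 A Q, so the number of steps and balls
    does not depend on Q. *)
Definition K_level : R := 192 * lam * A ^+ 2 + 2.

Definition C_chain : R := 2 * D K_level * (2 * D 3 * C_level).

(** Balls of radius [2 * mesh Q] about consecutive chain points both contain the ball of radius
    [mesh Q] about the second, so each step costs a multiple of [slope Q], and the number of steps
    is bounded. *)
Lemma level_chain Q : R_A <= Q -> (forall y, Q / (3 * A) <= nrm y -> E (Some y)) ->
  exists c : X -> R,
    (forall x, Q <= nrm x <= 2 * Q -> osc mu pull (dball dist x (2 * mesh Q)) (c x)
      (C_level * slope Q * vol x (2 * mesh Q))) /\
    (forall x y, Q <= nrm x <= 2 * Q -> Q <= nrm y <= 2 * Q ->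
      `|c x - c y| <= C_chain * slope Q).
Proof.
move=> RQ hE; have Q1 : 1 <= Q by exact: le_trans RQ.
have Q0 : 0 < Q by exact: lt_le_trans Q1.
have A1' := A1.
have AQ : Q <= A * Q by rewrite ler_peMl// ltW.
have r0 := mesh_gt0 Q0; have rQ := mesh_le Q0; have s0' := slope_ge0 Q0.
have C0 := C_level_ge0.
pose Om := [set z | Q / (2 * A) <= nrm z <= 3 * A * Q].
have /choice[c hc] : forall x, exists c, Om x ->
    osc mu pull (dball dist x (2 * mesh Q)) c (C_level * slope Q * vol x (2 * mesh Q)).
  move=> x; case: (pselect (Om x)) => [Ox|]; last by exists 0.
  by have [c hc] := level_osc Q1 hE Ox; exists c.
have sub x : Q <= nrm x <= 2 * Q -> Om x.
  move=> /andP[x1 x2]; rewrite /Om /= -mulrA; apply/andP; split; last by lra.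
  apply: le_trans x1; rewrite ler_pdivrMr ?mulr_gt0// ler_peMr// ?ltW//.
  by rewrite (le_lt_trans A1')//; lra.
exists c; split=> [x /sub/hc //|x y xI yI].
have step z w : Om z -> Om w -> dist z w < mesh Q ->
    `|c z - c w| <= 2 * D 3 * C_level * slope Q.
  move=> Oz Ow zw; have v0 := vol_gt0 mub w r0.
  have mB t r : measurable (dball dist t r) by exact: measurable_dball.
  have h1 : osc mu pull (dball dist w (mesh Q)) (c z) (C_level * slope Q * vol z (2 * mesh Q)).
    apply: (osc_sub measurable_pull (mB _ _) (mB _ _) _ (hc z Oz)).
    by move=> t; rewrite /dball /=; have := is_metric_tri distM w z t; lra.
  have h2 : osc mu pull (dball dist w (mesh Q)) (c w) (C_level * slope Q * vol w (2 * mesh Q)).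
    apply: (osc_sub measurable_pull (mB _ _) (mB _ _) _ (hc w Ow)).
    by move=> t; rewrite /dball /=; lra.
  have := osc_diff measurable_pull (mB _ _) _ h1 h2.
  move=> /(_ (vol w (mesh Q))); rewrite (volE mub)// lexx => /(_ isT).
  rewrite -mulrDr => h; rewrite -(ler_pM2r v0); apply: (le_trans h).
  have e : 2 * D 3 * C_level * slope Q * vol w (mesh Q) =
    C_level * slope Q * (D 3 * vol w (mesh Q) + D 3 * vol w (mesh Q)) by ring.
  rewrite e ler_wpM2l ?(mulr_ge0 C0 s0')// lerD//; apply: vol_cmp => //; try by rewrite mulr_gt0.
    by rewrite (is_metric_sym distM); lra.
  by rewrite (is_metric_xx distM); lra.
have hr := @annulus_reach Q (mesh Q) x y RQ r0 ltac:(lra) xI yI.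
have P0 : 0 < 4 * (A * Q) by rewrite !mulr_gt0.
have OP z : Om z -> nrm z < 4 * (A * Q).
  by move=> /andP[_]; rewrite -mulrA; have := mulr_gt0 A0 Q0; lra.
have hK : 4 * (4 * (A * Q)) + 2 * mesh Q <= K_level * mesh Q.
  have -> : K_level * mesh Q = 16 * (A * Q) + 2 * mesh Q.
    by rewrite /K_level /mesh; field; rewrite !gt_eqF.
  by lra.
have [n [f [[fO fs] f0 fn nK]]] := reach_short r0 P0 OP hK hr.
have chainb k : (k <= n)%N -> `|c (f 0%N) - c (f k)| <= k%:R * (2 * D 3 * C_level * slope Q).
  elim: k => [|k IH] kn; first by rewrite subrr normr0 mul0r.
  have := step _ _ (fO k (ltnW kn)) (fO k.+1 kn) (fs k kn).
  have := IH (ltnW kn); have := ler_normD (c (f 0%N) - c (f k)) (c (f k) - c (f k.+1)).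
  rewrite addrA subrK -natr1 mulrDl mul1r; lra.
have := chainb n (leqnn n); rewrite f0 fn => /le_trans; apply.
rewrite /C_chain -[leRHS]mulrA ler_wpM2r//.
by apply: mulr_ge0 s0'; apply: mulr_ge0 C0; rewrite mulr_ge0// ltW.
Qed.

Definition C_ring : R := D K_level * ((C_level + C_chain) * D 4).

Lemma C_chain_ge0 : 0 <= C_chain.
Proof.
by apply: mulr_ge0; [|apply: mulr_ge0 C_level_ge0]; rewrite mulr_ge0// ltW.
Qed.

(** The ring is covered by boundedly many balls of radius [mesh Q]; on each, the local constant is
    replaced by [b]. *)
Lemma ring_osc Q (c : X -> R) b : 0 < Q ->
  (forall x, Q <= nrm x <= 2 * Q -> osc mu pull (dball dist x (2 * mesh Q)) (c x)
      (C_level * slope Q * vol x (2 * mesh Q))) ->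
  (forall x, Q <= nrm x <= 2 * Q -> `|c x - b| <= C_chain * slope Q) ->
  osc mu pull (annulus (1 + Q) (1 + 2 * Q)) b (C_ring * (vol a Q * slope Q)).
Proof.
move=> Q0 hc hb; have r0 := mesh_gt0 Q0; have rQ := mesh_le Q0.
have A1' := A1; have AQ : Q <= A * Q by rewrite ler_peMl// ltW.
have AAQ : A * Q <= A * (A * Q) by rewrite ler_pM2l.
have EP x : annulus (1 + Q) (1 + 2 * Q) x -> nrm x < 3 * Q by move=> /andP[]; lra.
have EI x : annulus (1 + Q) (1 + 2 * Q) x -> Q <= nrm x <= 2 * Q.
  by move=> /andP[h1 h2]; apply/andP; split; lra.
have P0 : 0 < 3 * Q by rewrite mulr_gt0.
have hK : 4 * (3 * Q) + 2 * mesh Q <= K_level * mesh Q.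
  have -> : K_level * mesh Q = 16 * (A * Q) + 2 * mesh Q.
    by rewrite /K_level /mesh; field; rewrite !gt_eqF// (lt_le_trans _ lam_ge1).
  by lra.
have s0' := slope_ge0 Q0.
have [M [f [MK fE cov]]] := finite_cover r0 P0 EP hK.
have mB t r : measurable (dball dist t r) by exact: measurable_dball.
have b0 : 0 <= (C_level + C_chain) * D 4 * (vol a Q * slope Q).
  rewrite mulr_ge0 ?(mulr_ge0 _ s0') ?(ltW (vol_gt0 mub _ _))//.
  by rewrite mulr_ge0 ?(addr_ge0 C_level_ge0 C_chain_ge0)// ltW.
apply: (osc_le _ (@osc_cover _ _ _ mu pull measurable_pull M
   (fun i => dball dist (f i) (mesh Q)) _ b ((C_level + C_chain) * D 4 * (vol a Q * slope Q)) _ _ cov _)).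
- by rewrite /C_ring -[leRHS]mulrA ler_wpM2r.
- exact: measurable_annulus.
- by move=> i; exact: mB.
move=> i iM; have fI := EI _ (fE i iM).
have fv : vol (f i) (2 * mesh Q) <= D 4 * vol a Q.
  apply: vol_cmp => //; first by rewrite mulr_gt0.
  by rewrite (is_metric_sym distM) -/(nrm (f i)); lra.
have h1 : osc mu pull (dball dist (f i) (2 * mesh Q)) b
   (C_level * slope Q * vol (f i) (2 * mesh Q) + `|c (f i) - b| * vol (f i) (2 * mesh Q)).
  apply: (osc_shift measurable_pull) => //; last exact: hc.
  by rewrite (volE mub)// mulr_gt0.
apply: (osc_le _ (osc_sub measurable_pull (mB _ _) (mB _ _) _ h1)); last first.
  by move=> t; rewrite /dball /=; lra.
rewrite -mulrDl.
have -> : (C_level + C_chain) * D 4 * (vol a Q * slope Q) =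
  (C_level * slope Q + C_chain * slope Q) * (D 4 * vol a Q) by ring.
apply: ler_pM => //; last by rewrite lerD2l hb.
  by rewrite addr_ge0// mulr_ge0// C_level_ge0.
by apply/ltW/(vol_gt0 mub); rewrite mulr_gt0.
Qed.

(** Passing to the next level means moving within a level ([C_chain]), then comparing two levels at
    one point, where the mesh doubles ([C_mu]). *)
Definition C_step : R := C_chain + C_level * C_mu.

Definition C_far : R := C_ring + 2 * C_step * D 3.

Definition C_infty : R :=
  C_far * (C_s^-1 * Num.max 1 C_s^-1) * ((1 - tail_ratio)^-1 * (1 - 2^-1)^-1).

Lemma C_step_ge0 : 0 <= C_step.
Proof.
apply: addr_ge0 C_chain_ge0 _; apply: mulr_ge0 C_level_ge0 _.
by apply: le_trans C_mu_ge1.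
Qed.

Lemma C_far_ge0 : 0 <= C_far.
Proof.
apply: addr_ge0.
  apply: mulr_ge0; first exact: ltW.
  by apply: mulr_ge0; [exact: addr_ge0 C_level_ge0 C_chain_ge0|exact: ltW].
by apply: mulr_ge0; [apply: mulr_ge0 C_step_ge0|exact: ltW].
Qed.

(** [weight_decay] brings the weight from level j down to level i. There m (G/m)^(1/p) is
    essentially monotone in m, so it is bounded by its value at R', and the factor Q^-1 of the slope
    contributes 2^-i. *)
Lemma weight_slope R' i j : 1 <= R' -> (i <= j)%N ->
  weight (2 ^+ j * R') * slope (2 ^+ i * R') <=
  C_s^-1 * Num.max 1 C_s^-1 * (weight R' * slope R') *
    (tail_ratio ^+ (j - i) * (2^-1) ^+ i).
Proof.
move=> R1 ij; have R0 : 0 < R' by exact: lt_le_trans R1.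
have /andP[x0 x1] := tail_ratio_itv.
have e2 n : 0 < 2 ^+ n * R' by rewrite mulr_gt0// exprn_gt0.
have Ci0 : 0 < C_s^-1 by rewrite invr_gt0.
have h1 := weight_decay R1 ij.
have h2 := weight_decay R1 (leq0n i); rewrite subn0 expr0 mul1r in h2.
have w0 := weight_gt0 R0; have wi := weight_gt0 (e2 i).
have h3 : weight (2 ^+ i * R') <= Num.max 1 C_s^-1 * weight R'.
  apply: (le_trans h2); rewrite ler_pM2r//.
  apply: (@le_trans _ _ (C_s^-1 * 1)); last by rewrite mulr1 le_max lexx orbT.
  by rewrite ler_pM2l// exprn_ile1// ltW.
have max1 : 1 <= Num.max 1 C_s^-1 by rewrite le_max lexx.
have h4 := mul_powR_div_le p1 wi w0 max1 h3 G0.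
rewrite /slope; set X1 := (G / weight (2 ^+ i * R')) `^ p^-1 in h4 *.
set X0 := (G / weight R') `^ p^-1 in h4 *.
have X10 : 0 <= X1 by exact: powR_ge0.
have -> : (2 ^+ i * R')^-1 = R'^-1 * (2^-1) ^+ i by rewrite invfM exprVn mulrC.
apply: (@le_trans _ _ (C_s^-1 * tail_ratio ^+ (j - i) * weight (2 ^+ i * R') *
    (R'^-1 * (2^-1) ^+ i * X1))).
  by rewrite ler_wpM2r// !mulr_ge0// ?invr_ge0 ?exprn_ge0 ?invr_ge0// ltW.
have -> : C_s^-1 * tail_ratio ^+ (j - i) * weight (2 ^+ i * R') * (R'^-1 * 2^-1 ^+ i * X1) =
  (C_s^-1 * tail_ratio ^+ (j - i) * (R'^-1 * 2^-1 ^+ i)) * (weight (2 ^+ i * R') * X1) by ring.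
have -> : C_s^-1 * Num.max 1 C_s^-1 * (weight R' * (R'^-1 * X0)) *
    (tail_ratio ^+ (j - i) * 2^-1 ^+ i) =
  (C_s^-1 * tail_ratio ^+ (j - i) * (R'^-1 * 2^-1 ^+ i)) * (Num.max 1 C_s^-1 * (weight R' * X0)).
  by move: (Num.max 1 C_s^-1) => mx; ring.
by rewrite ler_wpM2l// !mulr_ge0// ?invr_ge0 ?exprn_ge0 ?invr_ge0// ltW.
Qed.

(** One constant [b] serves all annuli: the constants at points [z j] of norm 2^j R' differ from it
    by a partial sum of slopes. The clause about the ball at [z] allows [b] to be compared later
    with a constant on a ball about [a]. *)
Lemma tail_bound R' : R_A <= R' -> (forall y, R' / (3 * A) <= nrm y -> E (Some y)) ->
  exists b z, [/\ nrm z = R',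
    osc mu pull (dball dist z (2 * mesh R')) b (C_level * slope R' * vol z (2 * mesh R')) &
    (\int[nu]_(y in infty_nbhd (1 + R')) `|u y - b%:E| <=
      (C_infty * (weight R' * slope R'))%:E)%E].
Proof.
move=> RR hE; have R1 : 1 <= R' by exact: le_trans RR.
have R0 : 0 < R' by exact: lt_le_trans R1.
have /andP[x0 x1] := tail_ratio_itv.
pose Q j := 2 ^+ j * R'.
have e2 n : 1 <= (2 : R) ^+ n by rewrite exprn_ege1//; lra.
have RQ j : R' <= Q j by rewrite ler_peMl// ltW.
have Q0 j : 0 < Q j by exact: lt_le_trans (RQ j).
have Q1 j : 1 <= Q j by exact: le_trans (RQ j).
have QS j : Q j.+1 = 2 * Q j by rewrite /Q exprS mulrA.
have hEj j y : Q j / (3 * A) <= nrm y -> E (Some y).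
  move=> h; apply: hE; apply: le_trans h; rewrite ler_pM2r//.
  by rewrite invr_gt0 mulr_gt0.
have /choice[c hc] j := level_chain (le_trans RR (RQ j)) (hEj j).
have /choice[z hz] j := exists_nrm (ltW (Q0 j)).
pose d j := c j (z j).
have zj j : Q j <= nrm (z j) <= 2 * Q j by rewrite hz lexx /=; have := Q0 j; lra.
(* The point [z j.+1] is on the outer rim of level j and the inner rim of level j + 1; there the two
   levels are compared. *)
have zS j : Q j <= nrm (z j.+1) <= 2 * Q j by rewrite hz QS lexx andbT; have := Q0 j; lra.
have sl j := slope_ge0 (Q0 j).
have st0 := C_step_ge0; have C0 := C_level_ge0; have Cc0 := C_chain_ge0.
have mB t r : measurable (dball dist t r) by exact: measurable_dball.
have step j : `|d j - d j.+1| <= C_step * (slope (Q j) + slope (Q j.+1)).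
  have h1 := (hc j).2 _ _ (zj j) (zS j).
  have h2 := (hc j).1 _ (zS j); have h3 := (hc j.+1).1 _ (zj j.+1).
  have r0 := mesh_gt0 (Q0 j).
  have eS : mesh (Q j.+1) = 2 * mesh (Q j) by rewrite /mesh QS mulrA.
  rewrite eS in h3; have r20 : 0 < 2 * mesh (Q j) by rewrite mulr_gt0.
  have h4 : osc mu pull (dball dist (z j.+1) (2 * mesh (Q j))) (c j.+1 (z j.+1))
      (C_level * slope (Q j.+1) * vol (z j.+1) (2 * (2 * mesh (Q j)))).
    apply: (osc_sub measurable_pull (mB _ _) (mB _ _) _ h3).
    by move=> t; rewrite /dball /=; lra.
  have := osc_diff measurable_pull (mB _ _) _ h2 h4.
  move=> /(_ (vol (z j.+1) (2 * mesh (Q j)))); rewrite (volE mub)// lexx => /(_ isT).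
  have v0 := vol_gt0 mub (z j.+1) r20; have vd := vol_double (z j.+1) r20.
  have h5 := ler_wpM2l (mulr_ge0 C0 (sl j.+1)) vd.
  have h6 : 0 <= (C_mu - 1) * (C_level * slope (Q j) * vol (z j.+1) (2 * mesh (Q j))).
    apply: mulr_ge0; first by rewrite subr_ge0 C_mu_ge1.
    exact: mulr_ge0 (mulr_ge0 C0 (sl j)) (ltW v0).
  move=> h7; have h8 : `|c j (z j.+1) - c j.+1 (z j.+1)| <=
      C_level * C_mu * (slope (Q j) + slope (Q j.+1)).
    by rewrite -(ler_pM2r v0); exact: telescope_step h5 h6 h7.
  have := ler_normD (c j (z j) - c j (z j.+1)) (c j (z j.+1) - c j.+1 (z j.+1)).
  rewrite addrA subrK /C_step -/(d j) -/(d j.+1) => h9.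
  apply: (le_trans h9); rewrite mulrDl lerD// (le_trans h1)// mulrDr lerDl.
  exact: mulr_ge0.
pose S j := \sum_(i < j.+1) slope (Q i).
(* The surplus term on the left absorbs the [slope (Q j)] that the next step uses again, so that the
   induction closes. *)
have dS j : `|d j - d 0%N| + C_step * slope (Q j) <= 2 * C_step * S j.
  elim: j => [|j IH].
    by rewrite subrr normr0 add0r /S big_ord1 -mulrA ler_peMl ?(mulr_ge0 st0 (sl 0%N))// ler1n.
  have h := ler_normD (d j.+1 - d j) (d j - d 0%N).
  rewrite addrA subrK (distrC (d j.+1) (d j)) in h.
  have -> : S j.+1 = S j + slope (Q j.+1) by rewrite /S big_ord_recr.
  exact: telescope_sum IH (step j) h.
have rg j := ring_osc (Q0 j) (hc j).1 (fun x xI => (hc j).2 x (z j) xI (zj j)).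
have mA j : measurable (annulus (1 + Q j) (1 + 2 * Q j)) by exact: measurable_annulus.
have nuj j : (\int[nu]_(y in (@Some X) @` annulus (1 + Q j) (1 + 2 * Q j)) `|u y - (d 0%N)%:E|
    <= (C_far * (weight (Q j) * S j))%:E)%E.
  have h1 : osc mu pull (annulus (1 + Q j) (1 + 2 * Q j)) (d 0%N)
     (C_ring * (vol a (Q j) * slope (Q j)) + `|d j - d 0%N| * (D 3 * vol a (Q j))).
    apply: (osc_shift measurable_pull) (rg j) => //.
    apply: (le_trans (mu_annulus _ _)); first by have := Q0 j; lra.
    rewrite lee_fin; apply: vol_cmp => //; first by have := Q0 j; lra.
    by rewrite (is_metric_xx distM); have := Q1 j; lra.
  apply: (le_trans (@le_integral_nu _ _ _ _ _ _ _ _ q0 distM mO hnu (Q j) _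
     (fun y => `|u y - (d 0%N)%:E|%E) (measurable_image_Some (mA j)) (Q0 j) _ _ _)) => //.
  - by move=> y [t /andP[ht _] [<-]]; have := Q0 j; lra.
  - exact: measurable_abse_subr.
  rewrite preimage_image_Some.
  have Pq : 0 < Q j `^ q by rewrite powR_gt0.
  rewrite lee_pdivrMl//; apply: (le_trans h1); rewrite -EFinM lee_fin.
  have -> : Q j `^ q * (C_far * (weight (Q j) * S j)) = C_far * (vol a (Q j) * S j).
    by rewrite /weight; field; rewrite gt_eqF.
  have v0 := vol_gt0 mub a (Q0 j).
  have slS : slope (Q j) <= S j.
    by rewrite /S big_ord_recr /= lerDr sumr_ge0.
  have h2 : `|d j - d 0%N| <= 2 * C_step * S j.
    by apply: le_trans (dS j); rewrite lerDl (mulr_ge0 st0 (sl j)).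
  have h3 := ler_wpM2r (mulr_ge0 (ltW (D0 3)) (ltW v0)) h2.
  have Cr0 : 0 <= C_ring.
    apply: mulr_ge0; first exact: ltW.
    by apply: mulr_ge0; [exact: addr_ge0 C0 Cc0|exact: ltW].
  have h4 := ler_wpM2l (mulr_ge0 Cr0 (ltW v0)) slS.
  exact: telescope_osc h3 h4.
exists (d 0%N), (z 0%N); split.
- by rewrite hz /Q expr0 mul1r.
- by have := (hc 0%N).1 _ (zj 0%N); rewrite /Q expr0 mul1r.
have mI : measurable (infty_nbhd (1 + R')) by apply: measurable_infty_nbhd; lra.
have mN : measurable ([set None] : set (hatX X)).
  apply: measurable_hat; rewrite (_ : _ @^-1` _ = set0)//.
  by apply/seteqP; split=> // x.
(* Infinity lies in no annulus and is removed as a null set. *)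
rewrite (@ge0_negligible_integral _ _ _ nu _ [set None])//; first last.
- rewrite hnu// (_ : _ @^-1` _ = set0) ?integral_set0//.
  by apply/seteqP; split=> // x.
- exact: measurable_abse_subr.
have -> : infty_nbhd (1 + R') `\ None =
    \bigcup_j ((@Some X) @` annulus (1 + Q j) (1 + 2 * Q j)).
  apply/seteqP; split=> [[x|] []|_ [j _ [x /andP[hx _] <-]]]; rewrite /infty_nbhd /=.
  - rewrite lef_pV2 ?posrE ?(nrm1_gt0 a distM) ?addr_gt0// lerD2l => Rx _.
    have [k /andP[k1 k2]] := dyadic_bracket R0 Rx.
    exists k => //; exists x => //; rewrite /annulus /= lerD2l ltrD2l.
    by rewrite /Q k1 mulrA -exprS.
  - by move=> _ [].
  - split=> //; rewrite lef_pV2 ?posrE ?(nrm1_gt0 a distM) ?addr_gt0//.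
    by apply: le_trans hx; rewrite lerD2l.
rewrite ge0_integral_bigcup//; last 3 first.
- by move=> j; exact: (measurable_image_Some (mA j)).
- exact: measurable_abse_subr.
- apply/trivIsetP.
  have aux i j : (i < j)%N -> ((@Some X) @` annulus (1 + Q i) (1 + 2 * Q i)) `&`
      ((@Some X) @` annulus (1 + Q j) (1 + 2 * Q j)) = set0.
    move=> ij; apply/seteqP; split=> // _ [[x /andP[_ h1] <-] [y /andP[h2 _] [exy]]].
    move: h2; rewrite exy; have : Q i.+1 <= Q j by rewrite ler_pM2r// ler_weXn2l//; lra.
    by rewrite QS; lra.
  move=> i j _ _; rewrite neq_lt => /orP[|ji]; first exact: aux.
  by rewrite setIC; exact: aux.
apply: (@le_trans _ _ (\sum_(0 <= j <oo) (C_far * (weight (Q j) * S j))%:E)%E).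
  apply: lee_nneseries => [j _ _|j _]; last exact: nuj.
  by apply: integral_ge0.
have S0 j : 0 <= S j by apply: sumr_ge0.
apply: nneseries_le => [j|n].
  by rewrite mulr_ge0 ?C_far_ge0// mulr_ge0// ltW// weight_gt0.
rewrite /C_infty; set cw := C_s^-1 * Num.max 1 C_s^-1.
set w := weight R' * slope R'.
have cw0 : 0 <= cw.
  by rewrite mulr_ge0 ?invr_ge0 ?(ltW Cs0)// le_max ler01.
have w0 : 0 <= w by rewrite mulr_ge0 ?slope_ge0// ltW// weight_gt0.
apply: (@le_trans _ _ (\sum_(j < n) C_far * (cw * w *
    \sum_(i < j.+1) tail_ratio ^+ (j - i) * 2^-1 ^+ i))).
  apply: ler_sum => j _; rewrite ler_wpM2l ?C_far_ge0// /S !mulr_sumr.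
  by apply: ler_sum => i _; apply: weight_slope => //; rewrite -ltnS.
rewrite -mulr_sumr -mulr_sumr.
have -> : C_far * cw * ((1 - tail_ratio)^-1 * (1 - 2^-1)^-1) * w =
  C_far * (cw * w * ((1 - tail_ratio)^-1 * (1 - 2^-1)^-1)) by ring.
rewrite ler_wpM2l ?C_far_ge0// ler_wpM2l ?(mulr_ge0 cw0 w0)//.
by apply: double_geometric_sum_le => //; [exact: ltW|lra..].
Qed.

End tail.

(** * Balls of the sphericalization *)

(** Of the 100, 16 bound the height of a centre near infinity and 84 are left for the other points,
    see [far_dilated]. The factor A admits points down to norm R' / (3 A), and 2 R_A makes the
    dilated ball the whole space once r is too large for the tail estimate. *)
Definition lam_hat : R := 100 * lam * Num.max A (2 * R_A).

Lemma integral_infty_None (F : set (hatX X)) b :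
  measurable F -> (\int[nu]_(y in F) `|u y - b%:E| =
    \int[nu]_(y in F `\ None) `|u y - b%:E|)%E.
Proof.
move=> mF.
have mN : measurable ([set None] : set (hatX X)).
  by apply: measurable_hat; rewrite (_ : _ @^-1` _ = set0)//; apply/seteqP; split=> // x.
rewrite (@ge0_negligible_integral _ _ _ nu _ [set None])//.
- exact: measurable_abse_subr.
- rewrite hnu// (_ : _ @^-1` _ = set0) ?integral_set0//.
  by apply/seteqP; split=> // x.
Qed.

(** The common last step of all cases: [m] stands for the measure of the ball and of its dilation up
    to the constants c1 and C2. The factor 2 is that of [osc_mean]. *)
Lemma ball_poincare x (r m c1 C1 C2 : R) : 0 < r -> 0 < m -> 0 < c1 -> 0 < C1 -> 0 < C2 ->
  1 <= lam_hat ->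
  ((c1 * m)%:E <= nu (dball hat_d x r))%E ->
  (nu (dball hat_d x (lam_hat * r)) <= (C2 * m)%:E)%E ->
  (forall G, 0 <= G ->
    (\int[nu]_(y in dball hat_d x (lam_hat * r)) poweR (g y) p <= G%:E)%E ->
    exists c, osc nu u (dball hat_d x r) c (C1 * r * (m * (G / m) `^ p^-1))) ->
  (avg nu (dball hat_d x r) (fun y => `|u y - avg nu (dball hat_d x r) u|%E)
    <= (2 * C1 / c1 * C2 `^ p^-1 * r)%:E *
       poweR (avg nu (dball hat_d x (lam_hat * r)) (fun y => poweR (g y) p)) p^-1)%E.
Proof.
move=> r0 m0 c10 C10 C20 L1 hB hD hosc.
set B := dball hat_d x r; set DD := dball hat_d x (lam_hat * r).
have mB : measurable B by exact: measurable_hat_ball.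
have mDD : measurable DD by exact: measurable_hat_ball.
have BD : B `<=` DD.
  move=> y; rewrite /B /DD /dball /= => /lt_le_trans; apply.
  by rewrite ler_peMl// ltW.
have BDn : (nu B <= nu DD)%E by apply: le_measure; rewrite ?inE.
have fD : nu DD \is a fin_num.
  by rewrite ge0_fin_numE// (le_lt_trans hD)// ltry.
have fB : nu B \is a fin_num.
  by rewrite ge0_fin_numE// (le_lt_trans BDn)// -ge0_fin_numE.
set vB := fine (nu B); set vD := fine (nu DD).
have eB : nu B = vB%:E by rewrite fineK.
have eD : nu DD = vD%:E by rewrite fineK.
have vBm : c1 * m <= vB by rewrite -lee_fin -eB.
have vDm : vD <= C2 * m by rewrite -lee_fin -eD.
have vBD : vB <= vD by rewrite -lee_fin -eD -eB.
have vB0 : 0 < vB by apply: lt_le_trans vBm; rewrite mulr_gt0.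
have vD0 : 0 < vD by exact: lt_le_trans vBD.
have Cf0 : 0 < 2 * C1 / c1 * C2 `^ p^-1 * r.
  by rewrite !mulr_gt0 ?invr_gt0// powR_gt0.
have I0 : (0 <= \int[nu]_(y in DD) poweR (g y) p)%E.
  by apply: integral_ge0 => y _; exact: poweR_ge0.
have pi0 : p^-1 != 0 by rewrite invr_eq0 gt_eqF.
rewrite [X in (_ <= _ * poweR X _)%E]/avg eD /=; case eI : (\int[nu]_(y in DD) poweR (g y) p)%E => [G||]; last 2 first.
(* If g^p is not integrable on the dilated ball, the right-hand side is +oo. *)
- by rewrite gt0_muley ?lte_fin ?invr_gt0// poweRyr// gt0_muley ?lte_fin// leey.
- by rewrite eI in I0.
have G0 : 0 <= G by rewrite eI in I0.
have [c hc] := hosc G G0 ltac:(by rewrite -/DD eI).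
have iB : nu.-integrable B u by apply: integrableS iu.
have fA : avg nu B u \is a fin_num.
  by rewrite fin_numM//; exact: integrable_fin_num.
have := osc_mean mU mB eB vB0 iB hc; rewrite /osc fineK// => h.
rewrite [X in (_ <= _ * X)%E](_ : _ = ((vD^-1 * G) `^ p^-1)%:E)// -[leRHS]EFinM.
rewrite [leLHS]/avg -/vB lee_pdivrMl// -EFinM.
apply: (le_trans h); rewrite lee_fin.
have hp : (G / m) `^ p^-1 <= C2 `^ p^-1 * (vD^-1 * G) `^ p^-1.
  rewrite -powRM ?(ltW C20)//; last by rewrite mulr_ge0// invr_ge0 ltW.
  apply: ge0_ler_powR; rewrite ?nnegrE ?invr_ge0 ?(ltW p0)//.
  - by rewrite divr_ge0// ltW.
  - by rewrite mulr_ge0 ?(ltW C20)// mulr_ge0// invr_ge0 ltW.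
  rewrite ler_pdivrMr//; have -> : C2 * (vD^-1 * G) * m = G * (C2 * m / vD) by ring.
  by rewrite ler_peMr// ler_pdivlMr// mul1r.
set X1 := (vD^-1 * G) `^ p^-1 in hp *; have X10 : 0 <= X1 by exact: powR_ge0.
apply: (@le_trans _ _ (2 * (C1 * r * (m * (C2 `^ p^-1 * X1))))).
  by rewrite !ler_pM2l// mulr_gt0.
have -> : vB * (2 * C1 / c1 * C2 `^ p^-1 * r * X1) =
   (vB / c1) * (2 * C1 * C2 `^ p^-1 * r * X1) by ring.
have -> : 2 * (C1 * r * (m * (C2 `^ p^-1 * X1))) = m * (2 * C1 * C2 `^ p^-1 * r * X1) by ring.
apply: ler_wpM2r; last by rewrite ler_pdivlMr// mulrC.
by rewrite !mulr_ge0 ?powR_ge0// ltW.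
Qed.

Let D0 K : 0 < D K. Proof. exact: lt_le_trans (dbl_const_ge1 K). Qed.
Let C_PI0 : 0 < C_PI. Proof. by case: PI. Qed.

Lemma lam_hat_ge : 100 * lam <= lam_hat.
Proof.
rewrite /lam_hat ler_peMr ?mulr_ge0 ?(ltW lam0)//.
by rewrite le_max A1.
Qed.

Lemma lam_hat_ge1 : 1 <= lam_hat.
Proof. by apply: le_trans lam_hat_ge; have := lam_ge1; lra. Qed.

Let L0 : 0 < lam_hat. Proof. exact: lt_le_trans lam_hat_ge1. Qed.

(** * Balls that are small compared with the height of their centre *)

Definition near_weight (x : X) (r : R) : R :=
  vol x (r * (1 + nrm x) ^+ 2) / (1 + nrm x) `^ q.

Definition C_near : R :=
  2 `^ q * D 5 * (C_PI * 20) * (2 `^ q) `^ p^-1.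

Definition C_near_dil : R :=
  Num.max (2 `^ q * D (8 * lam_hat))
    (C_tail * (((3 * lam_hat)^-1) `^ q)^-1 * D (8 * lam_hat ^+ 2)).

(** Since r is at most 1/16 of the height of x, all heights in the ball differ from it by a factor
    between 15/16 and 17/16. As d_a < 4 r there, the distance in X is below 4 (16/15) r (1 + nrm
    x)^2, whence the 5. *)
Lemma near_ball (x : X) (r : R) : 0 < r -> 16 * lam * r * (1 + nrm x) <= 1 ->
  forall y, dball hat_d (Some x) r (Some y) ->
  dball dist x (5 * (r * (1 + nrm x) ^+ 2)) y /\ (1 + nrm x) / 2 <= 1 + nrm y.
Proof.
move=> r0 rN y; rewrite /dball /= => xy.
have l1 := lam_ge1; have h0 := height_gt0 a distM x; have hN := height_inv a distM x.
have N0 := nrm1_gt0 a distM x; have h'0 := height_gt0 a distM y.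
have hN' := height_inv a distM y; have N'0 := nrm1_gt0 a distM y.
have := le_trans (hat_d_height a distM (Some x) (Some y)) (ltW xy).
have := le_lt_trans (d_a_le_hat a distM (Some x) (Some y)) (_ : _ < 4 * r).
rewrite ltr_pM2l// => /(_ xy); rewrite d_aE//.
move: h0 hN h'0 hN'; set h := height (Some x); set h' := height (Some y).
set N := 1 + nrm x in rN N0 *; set N' := 1 + nrm y in N'0 * => h0 hN h'0 hN' hd hh.
have rN16 : 16 * (r * N) <= 1.
  apply: le_trans rN; rewrite -(mulrA (16 * lam)) (mulrC 16 lam) -mulrA ler_peMl//.
  by rewrite !mulr_ge0// ltW.
have rh : 16 * r <= h.
  have := ler_wpM2l (ltW h0) rN16.
  by rewrite (_ : h * (16 * (r * N)) = 16 * r * (h * N)); [rewrite hN !mulr1|ring].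
have hh' : 15 / 16 * h <= h'.
  by move: hh; rewrite ler_norml; lra.
have hh'' : h' <= 17 / 16 * h by move: hh; rewrite ler_norml; lra.
split; last first.
  have := ler_wpM2r (mulr_ge0 (ltW N0) (ltW N'0)) hh''.
  have -> : h' * (N * N') = N * (h' * N') by ring.
  have -> : 17 / 16 * h * (N * N') = 17 / 16 * N' * (h * N) by ring.
  rewrite hN hN'; lra.
have e : dist x y = dist x y * (h * h') * (N * N').
  have -> : dist x y * (h * h') * (N * N') = dist x y * (h * N) * (h' * N') by ring.
  by rewrite hN hN' !mulr1.
have NN : N' <= 16 / 15 * N.
  have := ler_wpM2r (mulr_ge0 (ltW N0) (ltW N'0)) hh'.
  have -> : h' * (N * N') = N * (h' * N') by ring.
  have -> : 15 / 16 * h * (N * N') = 15 / 16 * N' * (h * N) by ring.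
  rewrite hN hN'; lra.
rewrite e; apply: (@lt_le_trans _ _ (4 * r * (N * N'))).
  by rewrite ltr_pM2r// mulr_gt0.
have := ler_wpM2l (mulr_ge0 (ltW r0) (ltW N0)) NN.
have : 0 <= r * (N * N) by rewrite !mulr_ge0// ltW.
rewrite expr2; lra.
Qed.

Lemma near_osc (x : X) (r G : R) : 0 < r -> 16 * lam * r * (1 + nrm x) <= 1 -> 0 <= G ->
  (\int[nu]_(y in dball hat_d (Some x) (lam_hat * r)) poweR (g y) p <= G%:E)%E ->
  exists c, osc nu u (dball hat_d (Some x) r) c
    (C_near * r * (near_weight x r * (G / near_weight x r) `^ p^-1)).
Proof.
move=> r0 rN G0 hG; have hnear := near_ball r0 rN.
have l1 := lam_ge1; have N0 := nrm1_gt0 a distM x.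
have h0 := height_gt0 a distM x; have hN := height_inv a distM x.
rewrite /near_weight; set N := 1 + nrm x in rN N0 hN hnear *.
set h := height (Some x) in h0 hN.
have rN2 : 0 < r * N ^+ 2 by rewrite mulr_gt0// exprn_gt0.
set rho := 5 * (r * N ^+ 2) in hnear.
have rho0 : 0 < rho by rewrite mulr_gt0.
(* The smallness of r leaves 1 + nrm between 11/16 N and 2 N on the dilated ball; (16/11)^2 <= 4
   then gives the Lipschitz factor 4 h^2. *)
have lrho : lam * rho <= 5 / 16 * N.
  have -> : lam * rho = 5 / 16 * N * (16 * lam * r * N) by rewrite /rho; field.
  by rewrite ler_piMr// mulr_ge0// ltW.
have inF y : cball dist x (lam * rho) y -> 11 / 16 * N <= 1 + nrm y <= 2 * N.
  rewrite /cball /= => xy; have h1 := nrm_lip a distM y x; have h2 := nrm_lip a distM x y.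
  rewrite (is_metric_sym distM y) in h1; rewrite /N in lrho *; lra.
have hF y : cball dist x (lam * rho) y -> height (Some y) <= 16 / 11 * h.
  move=> /inF /andP[h1 _]; have hy := height_gt0 a distM y; have hNy := height_inv a distM y.
  have := ler_wpM2l (mulr_ge0 (ltW h0) (ltW hy)) h1.
  have -> : h * height (Some y) * (11 / 16 * N) = 11 / 16 * height (Some y) * (h * N) by ring.
  have -> : h * height (Some y) * (1 + nrm y) = h * (height (Some y) * (1 + nrm y)) by ring.
  by rewrite hN hNy; lra.
have K0 : 0 < 4 * h ^+ 2 by rewrite mulr_gt0// exprn_gt0.
have hK y z : cball dist x (lam * rho) y -> cball dist x (lam * rho) z ->
    hat_d (Some y) (Some z) <= 4 * h ^+ 2 * dist y z.
  move=> /hF hy /hF hz; apply: (le_trans (hat_d_le a distM _ _)).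
  rewrite d_aE// mulrC ler_wpM2r ?(is_metric_ge0 distM)//.
  apply: (@le_trans _ _ ((16 / 11 * h) * (16 / 11 * h))).
    by rewrite ler_pM// (height_ge0 a distM).
  have : 0 <= h * h by rewrite mulr_ge0// ltW.
  by rewrite expr2; lra.
have mD : measurable (dball hat_d (Some x) (lam_hat * r)) by exact: measurable_hat_ball.
(* The dilated ball of X has spherical radius at most 80/11 lam r, well below 100 lam r. *)
have BD y : dball dist x (lam * rho) y -> dball hat_d (Some x) (lam_hat * r) (Some y).
  rewrite /dball /= => xy; apply: (le_lt_trans (hat_d_le a distM _ _)); rewrite d_aE// -/h.
  have hy := hF y (ltW xy).
  apply: (@le_lt_trans _ _ (lam * rho * (h * (16 / 11 * h)))).
    apply: ler_pM => //; [exact: is_metric_ge0|by rewrite mulr_ge0 ?(height_ge0 a distM)// ltW|exact: ltW|].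
    by rewrite ler_pM2l.
  have -> : lam * rho * (h * (16 / 11 * h)) = 80 / 11 * (lam * r) * (h * N) ^+ 2.
    by rewrite /rho; ring.
  rewrite hN expr1n mulr1; have lr : 0 < lam * r by rewrite mulr_gt0.
  have := ler_wpM2r (ltW r0) lam_hat_ge; lra.
have [c hc] := hat_local_poincare rho0 K0 (mulr_gt0 (ltr0n R 2) N0) hK
  (fun y hy => (andP (inF y hy)).2) mD BD G0 hG.
exists c; rewrite /osc integral_infty_None; last exact: measurable_hat_ball.
have mB : measurable (dball dist x rho) by exact: measurable_dball.
have mSB := measurable_image_Some mB.
have N2 : 0 < N / 2 by rewrite divr_gt0.
set B' := dball hat_d (Some x) r `\ None.
have mB' : measurable B'.
  apply: measurableD; first exact: measurable_hat_ball.
  by apply: measurable_hat; rewrite (_ : _ @^-1` _ = set0)//; apply/seteqP; split=> // z.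
apply: (le_trans (@le_integral_nu _ _ _ _ _ _ _ _ q0 distM mO hnu (N / 2) _
   (fun y => `|u y - c%:E|%E) mB' N2 _ _ _)) => //.
- by move=> y [/hnear[_ hy] _].
- exact: measurable_abse_subr.
have Pq : 0 < (N / 2) `^ q by rewrite powR_gt0.
rewrite lee_pdivrMl// -EFinM.
apply: (@le_trans _ _ (\int[mu]_(y in dball dist x rho) `|pull y - c%:E|)%E).
  apply: ge0_subset_integral => //; first exact: (measurable_abse_subr measurable_pull).
  by move=> y [/hnear[hy _] _].
apply: (le_trans hc); rewrite lee_fin.
set v1 := vol x (r * N ^+ 2).
have v10 : 0 < v1 by exact: vol_gt0.
have vr : vol x rho <= D 5 * v1 by exact: vol_dbl.
have lr0 : 0 < lam * rho by rewrite mulr_gt0.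
have vl : v1 <= vol x (lam * rho).
  by apply: le_vol_radius => //; rewrite /rho; nra.
have vl0 : 0 < vol x (lam * rho) by exact: vol_gt0.
have Nq : 0 < N `^ q by rewrite powR_gt0.
have e1 : C_PI * rho * (4 * h ^+ 2) = C_PI * 20 * r.
  have -> : C_PI * rho * (4 * h ^+ 2) = C_PI * 20 * r * (h * N) ^+ 2 by rewrite /rho; ring.
  by rewrite hN expr1n mulr1.
have w0 : 0 < v1 / N `^ q by rewrite divr_gt0.
have hpow : ((2 * N) `^ q * G / vol x (lam * rho)) `^ p^-1 <=
    (2 `^ q) `^ p^-1 * (G / (v1 / N `^ q)) `^ p^-1.
  rewrite -powRM ?powR_ge0//; last by rewrite divr_ge0// ltW.
  apply: ge0_ler_powR; rewrite ?nnegrE ?invr_ge0 ?(ltW p0)//.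
  - by rewrite divr_ge0 ?mulr_ge0 ?powR_ge0// ltW.
  - by rewrite mulr_ge0 ?powR_ge0// divr_ge0// ltW.
  rewrite invf_div (powRM q (ler0n _ 2) (ltW N0)).
  have -> : 2 `^ q * (G * (N `^ q / v1)) = 2 `^ q * N `^ q * G * v1^-1 by ring.
  rewrite ler_wpM2l ?mulr_ge0 ?powR_ge0//.
  by rewrite lef_pV2.
rewrite e1.
set X1 := (G / (v1 / N `^ q)) `^ p^-1 in hpow *.
have X10 : 0 <= X1 by exact: powR_ge0.
have -> : (N / 2) `^ q * (C_near * r * (v1 / N `^ q * X1)) =
    D 5 * v1 * (C_PI * 20 * r * ((2 `^ q) `^ p^-1 * X1)).
  rewrite /C_near powR_div ?(ltW N0)//.
  by field; rewrite !gt_eqF// powR_gt0.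
apply: ler_pM => //.
- exact/ltW/(vol_gt0 mub).
- by rewrite !mulr_ge0 ?powR_ge0// ltW.
by rewrite ler_pM2l// !mulr_gt0.
Qed.

Lemma near_nu_ge (x : X) (r : R) : 0 < r -> 16 * lam * r * (1 + nrm x) <= 1 ->
  (((2 `^ q)^-1 / C_mu * near_weight x r)%:E <= nu (dball hat_d (Some x) r))%E.
Proof.
move=> r0 rN; have l1 := lam_ge1; have N0 := nrm1_gt0 a distM x.
have h0 := height_gt0 a distM x; have hN := height_inv a distM x.
rewrite /near_weight; set N := 1 + nrm x in rN N0 hN *.
set h := height (Some x) in h0 hN.
have rN16 : r * N <= 1 / 16.
  have : lam * (r * N) <= 1 / 16 by move: rN; lra.
  by apply: le_trans; rewrite ler_peMl// mulr_ge0// ltW.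
have rN2 : 0 < r * N ^+ 2 by rewrite mulr_gt0// exprn_gt0.
have rN2' : r * N ^+ 2 <= N / 16.
  by rewrite expr2 mulrA; have := ler_wpM2r (ltW N0) rN16; lra.
have t0 : 0 < r * N ^+ 2 / 2 by rewrite divr_gt0.
have hB y : dball dist x (r * N ^+ 2 / 2) y ->
    1 + nrm y <= 2 * N /\ dball hat_d (Some x) r (Some y).
  rewrite /dball /= => xy; have h1 := nrm_lip a distM y x; have h2 := nrm_lip a distM x y.
  rewrite (is_metric_sym distM y) in h1; rewrite /N in rN2' N0 xy h1 h2 *; split; first by lra.
  apply: (le_lt_trans (hat_d_le a distM _ _)); rewrite d_aE// -/h.
  have hy := height_gt0 a distM y; have hNy := height_inv a distM y.
  have hh : height (Some y) <= 2 * h.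
    have h3 : (1 + nrm x) / 2 <= 1 + nrm y by lra.
    have := ler_wpM2l (mulr_ge0 (ltW h0) (ltW hy)) h3.
    have -> : h * height (Some y) * ((1 + nrm x) / 2) = height (Some y) / 2 * (h * (1 + nrm x)) by ring.
    have -> : h * height (Some y) * (1 + nrm y) = h * (height (Some y) * (1 + nrm y)) by ring.
    by rewrite hN hNy; lra.
  apply: (@lt_le_trans _ _ (r * (1 + nrm x) ^+ 2 / 2 * (h * (2 * h)))).
    apply: (@lt_le_trans _ _ (r * (1 + nrm x) ^+ 2 / 2 * (h * height (Some y)))).
      by rewrite ltr_pM2r// mulr_gt0.
    by rewrite ler_pM2l// ler_pM2l.
  have -> : r * (1 + nrm x) ^+ 2 / 2 * (h * (2 * h)) = r * (h * (1 + nrm x)) ^+ 2 by field.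
  by rewrite hN expr1n mulr1.
apply: le_trans (nu_ge_ball (measurable_hat_ball a distM mO _ _) t0 (mulr_gt0 (ltr0n R 2) N0) hB).
have Cm0 : 0 < C_mu by exact: lt_le_trans C_mu_ge1.
have Nq : 0 < N `^ q by rewrite powR_gt0.
have q2 : 0 < (2 : R) `^ q by rewrite powR_gt0.
rewrite lee_fin (powRM q (ler0n _ 2) (ltW N0)).
have := vol_double x t0; rewrite (_ : 2 * (r * N ^+ 2 / 2) = r * N ^+ 2); last by field.
move=> hv.
have -> : (2 `^ q)^-1 / C_mu * (vol x (r * N ^+ 2) / N `^ q) =
  (2 `^ q * N `^ q)^-1 * (vol x (r * N ^+ 2) / C_mu).
  by field; rewrite !gt_eqF.
rewrite ler_pM2l ?invr_gt0 ?mulr_gt0// ler_pdivrMr// [leRHS]mulrC.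
exact: hv.
Qed.

(** Smallness of r does not make [lam_hat * r] small. If the dilated ball still keeps away from
    infinity it lies in a ball of X about x; otherwise r is comparable with the height of x, and the
    estimate by neighbourhoods of infinity applies. *)
Lemma near_nu_le (x : X) (r : R) : 0 < r -> 16 * lam * r * (1 + nrm x) <= 1 ->
  (nu (dball hat_d (Some x) (lam_hat * r)) <= (C_near_dil * near_weight x r)%:E)%E.
Proof.
move=> r0 rN; have l1 := lam_ge1; have N0 := nrm1_gt0 a distM x.
have h0 := height_gt0 a distM x; have hN := height_inv a distM x.
have N1 : 1 <= 1 + nrm x by exact: nrm1_ge1.
have L1 := lam_hat_ge1.
rewrite /near_weight; set N := 1 + nrm x in rN N0 hN N1 *.
set h := height (Some x) in h0 hN.
have rN16 : r * N <= 1 / 16.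
  have : lam * (r * N) <= 1 / 16 by move: rN; lra.
  by apply: le_trans; rewrite ler_peMl// mulr_ge0// ltW.
have rN2 : 0 < r * N ^+ 2 by rewrite mulr_gt0// exprn_gt0.
have Nq : 0 < N `^ q by rewrite powR_gt0.
have q2 : 0 < (2 : R) `^ q by rewrite powR_gt0.
have v0 := vol_gt0 mub x rN2.
have w0 : 0 < vol x (r * N ^+ 2) / N `^ q by rewrite divr_gt0.
have Lr0 : 0 < lam_hat * r by rewrite mulr_gt0.
have mD := measurable_hat_ball a distM mO (Some x) (lam_hat * r).
have [LN|LN] := leP (lam_hat * r * N) (1 / 2).
  have t0 : 0 < 8 * lam_hat * (r * N ^+ 2) by exact: mulr_gt0 (mulr_gt0 (ltr0n R 8) L0) rN2.
  apply: (le_trans (@nu_le_ball _ x (8 * lam_hat * (r * N ^+ 2)) (N / 2) mD t0 _ _)).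
  - by rewrite divr_gt0.
  - move=> y; rewrite /dball /= => xy.
    have hy := height_gt0 a distM y; have hNy := height_inv a distM y.
    have N'0 := nrm1_gt0 a distM y.
    have Lh : lam_hat * r <= h / 2.
      have := ler_wpM2r (ltW h0) LN.
      have -> : lam_hat * r * N * h = lam_hat * r * (h * N) by ring.
      by rewrite hN mulr1; lra.
    have := le_trans (hat_d_height a distM (Some x) (Some y)) (ltW xy).
    have := d_a_le_hat a distM (Some x) (Some y); rewrite d_aE// -/h.
    move: hy hNy N'0; set h' := height (Some y); set N' := 1 + nrm y => h'0 hN' N'0 hd.
    rewrite ler_norml => /andP[hl hu].
    have h1 : h' <= 3 / 2 * h by lra.
    have h2 : h / 2 <= h' by lra.
    have NN' : 0 <= N * N' by rewrite mulr_ge0// ltW.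
    have e1 : h' * (N * N') = N.
      have -> : h' * (N * N') = N * (h' * N') by ring.
      by rewrite hN' mulr1.
    have e2 : h * (N * N') = N'.
      have -> : h * (N * N') = N' * (h * N) by ring.
      by rewrite hN mulr1.
    have h3 := ler_wpM2r NN' h1; rewrite -(mulrA (3 / 2)) e1 e2 in h3.
    have h4 := ler_wpM2r NN' h2; rewrite (mulrAC h) e1 e2 in h4.
    split; first by lra.
    have e : dist x y = dist x y * (h * h') * (N * N').
      have -> : dist x y * (h * h') * (N * N') = dist x y * (h * N) * (h' * N') by ring.
      by rewrite hN hN' !mulr1.
    have NN0 : 0 < N * N' by rewrite mulr_gt0.
    rewrite e; apply: (@lt_le_trans _ _ (4 * (lam_hat * r) * (N * N'))).
      by rewrite ltr_pM2r//; apply: le_lt_trans hd _; rewrite ltr_pM2l.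
    have -> : 8 * lam_hat * (r * N ^+ 2) = 4 * (lam_hat * r) * (N * (2 * N)) by ring.
    rewrite (ler_pM2l (mulr_gt0 (ltr0n R 4) Lr0)) (ler_pM2l N0).
    by lra.
  rewrite lee_fin; apply: (@le_trans _ _ (2 `^ q * D (8 * lam_hat) * (vol x (r * N ^+ 2) / N `^ q))); last first.
    by rewrite ler_pM2r// le_max lexx.
  have -> : 2 `^ q * D (8 * lam_hat) * (vol x (r * N ^+ 2) / N `^ q) =
      ((N / 2) `^ q)^-1 * (D (8 * lam_hat) * vol x (r * N ^+ 2)).
    rewrite powR_div ?(ltW N0)//.
    by field; rewrite !gt_eqF.
  rewrite ler_wpM2l ?invr_ge0 ?powR_ge0//; apply: vol_dbl => //.
  by rewrite mulr_gt0.
have L3 : 0 < 3 * lam_hat by exact: mulr_gt0 (ltr0n R 3) L0.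
have k0 : 0 < (3 * lam_hat)^-1 by rewrite invr_gt0.
have k1 : (3 * lam_hat)^-1 <= 1 by rewrite invf_le1//; lra.
have hL : h <= 2 * (lam_hat * r).
  have := ler_wpM2l (ltW h0) (ltW LN).
  have -> : h * (lam_hat * r * N) = lam_hat * r * (h * N) by ring.
  by rewrite hN mulr1; lra.
have r16 : r <= 1 / 16 by apply: le_trans rN16; rewrite ler_peMr// ltW.
apply: (le_trans (nu_hat_ball_le k0 k1 r0 _)).
  by rewrite invrK -/h; lra.
have -> : Num.min r 1 = r by rewrite min_l//; lra.
rewrite lee_fin; apply: (@le_trans _ _ (C_tail * (((3 * lam_hat)^-1) `^ q)^-1 * D (8 * lam_hat ^+ 2)
   * (vol x (r * N ^+ 2) / N `^ q))); last first.
  by rewrite ler_pM2r// le_max lexx orbT.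
rewrite -[leRHS]mulrA ler_wpM2l//.
  by rewrite mulr_ge0 ?invr_ge0 ?powR_ge0// ltW// C_tail_gt0.
rewrite /weight mulrA; apply: ler_pM.
- by apply/ltW/(vol_gt0 mub); rewrite invr_gt0.
- by rewrite invr_ge0 powR_ge0.
- apply: vol_cmp => //; first by rewrite invr_gt0.
  rewrite -/(nrm x); have e : nrm x = N - 1 by rewrite /N; ring.
  have r'0 : 0 < r^-1 by rewrite invr_gt0.
  have Nr : N <= r^-1 by rewrite -[N]mulr1 -ler_pdivlMl// -invfM -[leLHS]invr1 lef_pV2 ?posrE ?mulr_gt0// mulrC; lra.
  have : 2 * r^-1 <= 8 * lam_hat ^+ 2 * (r * N ^+ 2).
    have -> : 8 * lam_hat ^+ 2 * (r * N ^+ 2) = 8 * (lam_hat * r * N) ^+ 2 * r^-1.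
      by field; rewrite gt_eqF.
    rewrite ler_pM2r//; have : 1 / 2 * (1 / 2) <= (lam_hat * r * N) * (lam_hat * r * N).
      by rewrite ler_pM// ltW.
    by rewrite expr2; lra.
  by rewrite e; lra.
- rewrite lef_pV2 ?posrE ?powR_gt0 ?invr_gt0//.
  apply: ge0_ler_powR; rewrite ?nnegrE ?invr_ge0 ?(ltW q0) ?(ltW N0) ?(ltW r0)//.
  rewrite -[N]mulr1 -ler_pdivlMl// -invfM -[leLHS]invr1 lef_pV2 ?posrE ?mulr_gt0//.
  by rewrite mulrC; lra.
Qed.

(** * Balls near infinity *)

Let M_ : R := Num.max A (2 * R_A).
Let MA : A <= M_. Proof. by rewrite le_max lexx. Qed.
Let MR : 2 * R_A <= M_. Proof. by rewrite le_max lexx orbT. Qed.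
Let lam_hatE : lam_hat = 100 * lam * M_. Proof. by []. Qed.

(** The spherical distance is at most the sum of the heights, and 16 + 84 = 100. *)
Lemma far_dilated x r y : 0 < r -> height x < 16 * lam * r ->
  height y < 84 * (lam * r * M_) -> dball hat_d x (lam_hat * r) y.
Proof.
move=> r0 hx hy; rewrite /dball /=.
apply: (le_lt_trans (hat_d_le_height a distM x y)).
have lr0 : 0 < lam * r by rewrite mulr_gt0.
have : lam * r <= lam * r * M_ by rewrite ler_peMr ?(ltW lr0)// (le_trans A1).
have -> : lam_hat * r = 100 * (lam * r * M_) by rewrite lam_hatE; ring.
by move: (lam * r * M_) hx hy => t; rewrite -(mulrA 16); lra.
Qed.

Definition kap_far : R := (16 * lam)^-1.

Definition C_far_dil : R := C_tail * (((16 * lam + lam_hat)^-1) `^ q)^-1.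

Lemma far_nu_ge x r : 0 < r -> height x < 16 * lam * r ->
  ((c_ball kap_far * weight (Num.min r 1)^-1)%:E <= nu (dball hat_d x r))%E.
Proof.
move=> r0 hx; have l1 := lam_ge1; have l16 : 0 < 16 * lam by rewrite mulr_gt0.
apply: nu_hat_ball_ge => //; first by rewrite invr_gt0.
  by rewrite invf_le1//; lra.
rewrite le_min; apply/andP; split; first by rewrite ler_pdivrMl// ltW.
by rewrite ler_pdivrMl//; have := height_le1 a distM x; lra.
Qed.

Lemma far_nu_le x r : 0 < r -> height x < 16 * lam * r ->
  (nu (dball hat_d x (lam_hat * r)) <= (C_far_dil * weight (Num.min r 1)^-1)%:E)%E.
Proof.
move=> r0 hx; have l1 := lam_ge1; have L1 := lam_hat_ge1.
have l0 : 0 < 16 * lam + lam_hat by apply: addr_gt0 => //; rewrite mulr_gt0.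
apply: nu_hat_ball_le => //; first by rewrite invr_gt0.
  by rewrite invf_le1//; lra.
by rewrite invrK mulrDr; lra.
Qed.

Definition C_small : R := C_infty * (34 * lam) * (((34 * lam)^-1) `^ q)^-1.

Let C_infty0 : 0 <= C_infty.
Proof.
have /andP[_ x1] := tail_ratio_itv.
apply: mulr_ge0; first apply: (mulr_ge0 C_far_ge0).
  by apply: mulr_ge0; [rewrite invr_ge0 ltW|rewrite le_max ler01].
by apply: mulr_ge0; rewrite invr_ge0 ?subr_ge0 ?(ltW x1)//; lra.
Qed.

Lemma powR_inv_ge1 (t : R) : 1 <= t -> 1 <= (t^-1 `^ q)^-1.
Proof.
move=> t1; have t0 : 0 <= t by exact: le_trans t1.
by rewrite -[t^-1]mul1r powR_div// powR1 div1r invrK powR_ge1// ltW.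
Qed.

(** All heights in the ball are at most 16 lam r + r <= 17 lam r = 1/T, so it lies in the
    neighbourhood of infinity for R' = T - 1, and the bound on r says that R' >= R_A. *)
Lemma far_osc_small x (r G : R) : 0 < r -> height x < 16 * lam * r ->
  17 * lam * r * (1 + R_A) <= 1 -> 0 <= G ->
  (\int[nu]_(y in dball hat_d x (lam_hat * r)) poweR (g y) p <= G%:E)%E ->
  exists c, osc nu u (dball hat_d x r) c
    (C_small * r * (weight (Num.min r 1)^-1 * (G / weight (Num.min r 1)^-1) `^ p^-1)).
Proof.
move=> r0 hx rR G0 hG; have l1 := lam_ge1; have R1 := RA1; have A1' := A1.
have lr0 : 0 < lam * r by rewrite mulr_gt0.
have rlr : r <= lam * r by rewrite ler_peMl// ltW.
have S0 : 0 < 17 * (lam * r) by rewrite mulr_gt0.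
rewrite -(mulrA 17) in rR; pose T := (17 * (lam * r))^-1.
have T0 : 0 < T by rewrite invr_gt0.
have ST : 17 * (lam * r) * T = 1 by rewrite divff// gt_eqF.
have TR : 1 + R_A <= T by rewrite -[leRHS]mulr1 ler_pdivlMl.
pose R' := T - 1; have RR : R_A <= R' by rewrite /R'; lra.
have R0 : 0 < R' by lra.
have eT : 1 + R' = T by rewrite /R'; ring.
have mD : measurable (dball hat_d x (lam_hat * r)) by exact: measurable_hat_ball.
have hE y : R' / (3 * A) <= nrm y -> dball hat_d x (lam_hat * r) (Some y).
  move=> hy; apply: far_dilated => //=.
  have N0 := nrm1_gt0 a distM y; rewrite -[ltLHS]mul1r ltr_pdivrMr//.
  have MA' : R' / 3 <= M_ * nrm y.
    apply: (@le_trans _ _ (A * (R' / (3 * A)))); last first.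
      by apply: ler_pM => //; rewrite ?(ltW A0)// divr_ge0 ?(ltW R0)// mulr_ge0// ltW.
    by rewrite le_eqVlt; apply/orP; left; apply/eqP; field; rewrite gt_eqF.
  have h1 : 1 + R' / 3 <= M_ * (1 + nrm y).
    by rewrite mulrDr mulr1 lerD// (le_trans A1).
  have h2 := ler_wpM2l (ltW lr0) h1.
  have -> : 84 * (lam * r * M_) * (1 + nrm y) = 84 * (lam * r * (M_ * (1 + nrm y))) by ring.
  apply: (@lt_le_trans _ _ (84 * (lam * r * (1 + R' / 3)))); last by rewrite ler_pM2l.
  by rewrite /R' in R0 *; lra.
have [b [z [_ _ hb]]] := tail_bound mD G0 hG RR hE.
exists b; have -> : Num.min r 1 = r by rewrite min_l//; nra.
set m := weight r^-1.
have ri0 : 0 < r^-1 by rewrite invr_gt0.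
have m0 : 0 < m by exact: weight_gt0.
have mB : measurable (dball hat_d x r) by exact: measurable_hat_ball.
have sub : dball hat_d x r `<=` infty_nbhd (1 + R').
  move=> y; rewrite /dball /infty_nbhd /= eT invrK => xy.
  have := le_trans (hat_d_height a distM x y) (ltW xy).
  by rewrite distrC => /(le_trans (ler_norm _)); lra.
have l34 : 0 < 34 * lam by rewrite mulr_gt0.
have ek : (34 * lam)^-1 * r^-1 = T / 2 by rewrite /T; field; rewrite !gt_eqF.
(* As T >= 1 + R_A >= 2, R' is comparable with T; this turns 17 into 34 in the constants. *)
have T2 : T / 2 <= R' by rewrite /R'; lra.
have wR : weight R' <= (((34 * lam)^-1) `^ q)^-1 * m.
  apply: weight_scale => //; [by rewrite invr_gt0|by rewrite ek|].
  apply: (@le_trans _ _ T); first by rewrite /R'; lra.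
  by rewrite lef_pV2 ?posrE//; lra.
have k1 : 1 <= (((34 * lam)^-1) `^ q)^-1 by apply: powR_inv_ge1; lra.
have w0 := weight_gt0 R0.
have h := mul_powR_div_le p1 w0 m0 k1 wR G0.
have hR : R'^-1 <= 34 * lam * r.
  have T20 : 0 < T / 2 by rewrite divr_gt0.
  have -> : 34 * lam * r = (T / 2)^-1 by rewrite -ek -invfM invrK.
  by rewrite lef_pV2.
apply: (osc_le _ (osc_sub mU mB _ sub hb)); last first.
  by apply: measurable_infty_nbhd; rewrite eT.
rewrite /C_small.
have -> : C_infty * (weight R' * slope G R') =
   C_infty * (R'^-1 * (weight R' * (G / weight R') `^ p^-1)) by rewrite /slope; ring.
set X0 := m * (G / m) `^ p^-1 in h *.
move: hR h k1; set k := (((34 * lam)^-1) `^ q)^-1 => hR h k1.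
have -> : C_infty * (34 * lam) * k * r * X0 = C_infty * (34 * lam * r * (k * X0)) by ring.
rewrite ler_wpM2l//.
apply: ler_pM => //.
- by rewrite invr_ge0 ltW.
- by rewrite mulr_ge0 ?powR_ge0// ltW.
Qed.

(** * Balls whose dilation is the whole space *)

Definition C_core : R :=
  C_mu * R_A `^ q * (C_PI * (2 * R_A) * ((1 + lam * (2 * R_A)) `^ q) `^ p^-1).

Definition C_whole : R :=
  C_core + D (18 * lam * A) * (C_core + C_level * (C_mu * R_A `^ q)) + C_infty.

Definition C_big : R :=
  C_whole * (D R_A * (((34 * lam * R_A)^-1) `^ q)^-1) * (34 * lam * R_A).

Lemma C_core_ge0 : 0 <= C_core.
Proof.
have Cm0 : 0 <= C_mu by exact: le_trans C_mu_ge1.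
have RA0 : 0 <= R_A by exact: le_trans RA1.
apply: mulr_ge0; first by rewrite mulr_ge0 ?powR_ge0.
by rewrite mulr_ge0 ?powR_ge0// mulr_ge0 ?(ltW C_PI0)// mulr_ge0.
Qed.

Lemma C_whole_ge0 : 0 <= C_whole.
Proof.
have Cm0 : 0 <= C_mu by exact: le_trans C_mu_ge1.
apply: addr_ge0 => //; apply: addr_ge0; first exact: C_core_ge0.
apply: mulr_ge0; first exact: ltW.
apply: addr_ge0; first exact: C_core_ge0.
by apply: mulr_ge0; [exact: C_level_ge0|rewrite mulr_ge0 ?powR_ge0].
Qed.

(** B(a, 2 R_A) and the neighbourhood of infinity beyond R_A cover everything. The Poincare
    inequality on the former, with [hat_d <= dist], gives a constant [cB], the tail estimate gives
    [b], and the two are compared on the ball about [z] from [tail_bound]. *)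
Lemma whole_osc G : 0 <= G -> (\int[nu]_y poweR (g y) p <= G%:E)%E ->
  exists c, osc nu u setT c (C_whole * (weight R_A * (G / weight R_A) `^ p^-1)).
Proof.
move=> G0 hG; have l1 := lam_ge1; have R1 := RA1; have A1' := A1.
have RA0 : 0 < R_A by exact: lt_le_trans RA1.
have RA20 : 0 < 2 * R_A by rewrite mulr_gt0.
have Cm1 := C_mu_ge1; have Cm0 : 0 < C_mu by exact: lt_le_trans Cm1.
have [b [z [zR hz hb]]] := tail_bound measurableT G0 hG (lexx R_A) (fun _ _ => I).
set w := weight R_A; set Y := (G / w) `^ p^-1.
have w0 : 0 < w by exact: weight_gt0.
have Y0 : 0 <= Y by exact: powR_ge0.
have Rq : 0 < R_A `^ q by rewrite powR_gt0.
have Rq1 : 1 <= R_A `^ q by rewrite powR_ge1// ltW.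
have eV : vol a R_A = w * R_A `^ q by rewrite /w /weight divfK// gt_eqF.
have lR0 : 0 < lam * (2 * R_A) by rewrite mulr_gt0.
have P0 : 0 < 1 + lam * (2 * R_A) by lra.
have hK y y' : cball dist a (lam * (2 * R_A)) y -> cball dist a (lam * (2 * R_A)) y' ->
    hat_d (Some y) (Some y') <= 1 * dist y y'.
  by move=> _ _; rewrite mul1r; exact: hat_d_le_dist.
have hP y : cball dist a (lam * (2 * R_A)) y -> 1 + nrm y <= 1 + lam * (2 * R_A).
  by rewrite /cball /= lerD2l /Defs.nrm (is_metric_sym distM).
have [cB hcB] := hat_local_poincare RA20 (@ltr01 R) P0 hK hP measurableT (fun _ _ => I) G0 hG.
set OB := vol a (2 * R_A) * _ in hcB.
have v2 := vol_double a RA0; have v20 := vol_gt0 mub a RA20.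
have vl : vol a R_A <= vol a (lam * (2 * R_A)).
  by apply: le_vol_radius => //; nra.
have vl0 : 0 < vol a (lam * (2 * R_A)) by exact: vol_gt0.
set Pq := ((1 + lam * (2 * R_A)) `^ q) `^ p^-1.
have Pq0 : 0 <= Pq by exact: powR_ge0.
have hOB : OB <= C_core * (w * Y).
  have hpow : ((1 + lam * (2 * R_A)) `^ q * G / vol a (lam * (2 * R_A))) `^ p^-1 <= Pq * Y.
    rewrite /Pq /Y -powRM ?powR_ge0//; last by rewrite divr_ge0// ltW.
    apply: ge0_ler_powR; rewrite ?nnegrE ?invr_ge0 ?(ltW p0)//.
    - by rewrite divr_ge0 ?mulr_ge0 ?powR_ge0// ltW.
    - by rewrite mulr_ge0 ?powR_ge0// divr_ge0// ltW.
    rewrite -(mulrA _ G) ler_wpM2l ?powR_ge0// ler_wpM2l// lef_pV2 ?posrE//.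
    by apply: le_trans vl; rewrite eV ler_peMr// ltW.
  have -> : C_core * (w * Y) = C_mu * vol a R_A * (C_PI * (2 * R_A) * 1 * (Pq * Y)).
    by rewrite /C_core eV -/Pq; ring.
  rewrite /OB; apply: ler_pM; [exact: ltW| |exact: v2|].
    by rewrite mulr_ge0 ?powR_ge0// mulr1 mulr_ge0 ?(ltW C_PI0) ?(ltW RA20).
  by rewrite ler_wpM2l// mulr1 mulr_ge0 ?(ltW C_PI0) ?(ltW RA20).
have sl : slope G R_A <= Y.
  by rewrite /slope -/w -/Y ler_piMl// invf_le1.
have sl0 := slope_ge0 G RA0.
have r0 := mesh_gt0 RA0; have rQ := mesh_le RA0.
have r20 : 0 < 2 * mesh R_A by rewrite mulr_gt0.
set v := vol z (2 * mesh R_A) in hz.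
have v0 : 0 < v by exact: vol_gt0.
have zsub : dball dist z (2 * mesh R_A) `<=` dball dist a (2 * R_A).
  move=> y; rewrite /dball /= => zy; have := is_metric_tri distM z a y.
  by rewrite (is_metric_sym distM a z) -/(nrm z) zR; lra.
have vv : v <= vol a (2 * R_A) by exact: (le_vol distM mO mub).
have vD : vol a (2 * R_A) <= D (18 * lam * A) * v.
  apply: vol_cmp => //; rewrite -/(nrm z) zR.
  have -> : 18 * lam * A * (2 * mesh R_A) = 3 * R_A.
    by rewrite /mesh; field; rewrite !gt_eqF.
  by lra.
have mB t r : measurable (dball dist t r) by exact: measurable_dball.
have h1 := osc_sub measurable_pull (mB z (2 * mesh R_A)) (mB a (2 * R_A)) zsub hcB.
have := osc_diff measurable_pull (mB _ _) _ h1 hz.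
move=> /(_ v); rewrite (volE mub)// lexx => /(_ isT) hd.
have h2 : osc mu pull (dball dist a (2 * R_A)) b (OB + `|cB - b| * vol a (2 * R_A)).
  by apply: (osc_shift measurable_pull) hcB => //; rewrite (volE mub).
have hC : C_level * slope G R_A * v <= C_level * (C_mu * R_A `^ q) * (w * Y).
  have -> : C_level * (C_mu * R_A `^ q) * (w * Y) = C_level * Y * (C_mu * vol a R_A).
    by rewrite eV; ring.
  apply: ler_pM; [exact: mulr_ge0 C_level_ge0 sl0|exact: ltW| |exact: le_trans vv v2].
  exact: (ler_wpM2l C_level_ge0).
have hd2 : `|cB - b| * vol a (2 * R_A) <=
    D (18 * lam * A) * ((C_core + C_level * (C_mu * R_A `^ q)) * (w * Y)).
  apply: (@le_trans _ _ (D (18 * lam * A) * (`|cB - b| * v))).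
    by rewrite mulrCA ler_wpM2l.
  by rewrite ler_pM2l// mulrDl (le_trans hd)// lerD.
exists b; set Sa : set (hatX X) := (@Some X) @` dball dist a (2 * R_A).
have mSa : measurable Sa by exact: measurable_image_Some.
have mI : measurable (infty_nbhd (1 + R_A)).
  exact/measurable_infty_nbhd/addr_gt0.
have h3 : osc nu u Sa b (OB + `|cB - b| * vol a (2 * R_A)).
  apply: (le_trans (@le_integral_nu _ _ _ _ _ _ _ _ q0 distM mO hnu 1 _
     (fun y => `|u y - b%:E|%E) mSa ltr01 _ _ _)) => //.
  - by move=> y _; exact: nrm1_ge1.
  - exact: measurable_abse_subr.
  by rewrite powR1 invr1 mul1e preimage_image_Some.
have := osc_setU mU mSa mI h3 hb.
have -> : Sa `|` infty_nbhd (1 + R_A) = setT.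
  apply/seteqP; split=> // [[y|]] _; last by right; rewrite /infty_nbhd /= invr_ge0 addr_ge0// ltW.
  have [yR|yR] := ltP (nrm y) (2 * R_A).
    by left; exists y => //; rewrite /dball /= (is_metric_sym distM).
  right; rewrite /infty_nbhd /= lef_pV2 ?posrE ?(nrm1_gt0 a distM) ?addr_gt0// lerD2l.
  by apply: le_trans yR; rewrite ler_peMl ?ler1n// ltW.
apply: osc_le.
have hw : weight R_A * slope G R_A <= w * Y by rewrite ler_pM2l.
have := ler_wpM2l C_infty0 hw.
rewrite /C_whole (mulrDl _ C_infty) (mulrDl C_core) -(mulrA (D _)) => h4.
by rewrite lerD// lerD.
Qed.

(** Here r is at least 1 / (34 lam R_A). Hence all weights involved are comparable with
    [weight R_A], and the factor r of the claim is gained from 34 lam R_A r >= 1. *)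
Lemma far_osc_big x (r G : R) : 0 < r -> height x < 16 * lam * r ->
  1 < 17 * lam * r * (1 + R_A) -> 0 <= G ->
  (\int[nu]_(y in dball hat_d x (lam_hat * r)) poweR (g y) p <= G%:E)%E ->
  exists c, osc nu u (dball hat_d x r) c
    (C_big * r * (weight (Num.min r 1)^-1 * (G / weight (Num.min r 1)^-1) `^ p^-1)).
Proof.
move=> r0 hx rR G0 hG; have l1 := lam_ge1; have R1 := RA1; have A1' := A1.
have RA0 : 0 < R_A by exact: lt_le_trans RA1.
have lr0 : 0 < lam * r by rewrite mulr_gt0.
rewrite -(mulrA 17) in rR.
have eT : dball hat_d x (lam_hat * r) = setT.
  apply/seteqP; split=> // y _; apply: far_dilated => //.
  apply: (le_lt_trans (height_le1 a distM y)).
  (* The factor [2 * R_A >= 1 + R_A] in the dilation is used here: every height, being at most 1, is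
     small enough for [far_dilated]. *)
  have h : lam * r * (1 + R_A) <= lam * r * M_.
    by rewrite ler_pM2l//; apply: le_trans MR; lra.
  by move: h rR; rewrite -(mulrA 17); lra.
rewrite eT in hG; have [c hc] := whole_osc G0 hG; exists c.
have mB : measurable (dball hat_d x r) by exact: measurable_hat_ball.
apply: (osc_le _ (osc_sub mU mB measurableT (@subsetT _ _) hc)).
set r' := Num.min r 1; have r'0 : 0 < r' by rewrite lt_min r0 ltr01.
have ri0 : 0 < r'^-1 by rewrite invr_gt0.
have K0 : 0 < 34 * lam * R_A by rewrite !mulr_gt0.
have lR1 : 1 <= lam * R_A by rewrite mulr_ege1.
have rK : 1 <= 34 * lam * R_A * r.
  have h : lam * r * (1 + R_A) <= lam * r * (2 * R_A) by rewrite ler_pM2l//; lra.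
  have -> : 34 * lam * R_A * r = 17 * (lam * r * (2 * R_A)) by ring.
  by rewrite -(mulrA 17) in rR; lra.
have kr : (34 * lam * R_A)^-1 <= r'.
  rewrite le_min; apply/andP; split; first by rewrite -[leLHS]mulr1 ler_pdivrMl.
  by rewrite invf_le1//; rewrite -mulrA; lra.
set m := weight r'^-1; have m0 : 0 < m by exact: weight_gt0.
have w1 : weight 1 <= (((34 * lam * R_A)^-1) `^ q)^-1 * m.
  apply: weight_scale; rewrite ?invr_gt0 ?ltr01//.
    by rewrite ler_pdivrMr// mul1r.
  by rewrite invf_ge1// ge_min lexx orbT.
have wR : weight R_A <= D R_A * (((34 * lam * R_A)^-1) `^ q)^-1 * m.
  rewrite -mulrA; apply: (@le_trans _ _ (D R_A * weight 1)); last by rewrite ler_pM2l.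
  rewrite /weight powR1 divr1; apply: (@le_trans _ _ (vol a R_A)); last first.
    by have := vol_dbl a (@ltr01 R) RA0; rewrite mulr1.
  rewrite ler_pdivrMr ?powR_gt0// ler_peMr ?(ltW (vol_gt0 mub _ RA0))//.
  by rewrite powR_ge1// ltW.
have k1 : 1 <= D R_A * (((34 * lam * R_A)^-1) `^ q)^-1.
  rewrite mulr_ege1 ?dbl_const_ge1//; apply: powR_inv_ge1.
  by rewrite -mulrA; lra.
have h := mul_powR_div_le p1 (weight_gt0 RA0) m0 k1 wR G0.
set Z := m * (G / m) `^ p^-1 in h *.
have Z0 : 0 <= Z by rewrite mulr_ge0 ?powR_ge0// ltW.
apply: (le_trans (ler_wpM2l C_whole_ge0 h)).
set k := D R_A * _ in k1 *.
have -> : C_big * r * Z = C_whole * (k * Z) * (34 * lam * R_A * r) by rewrite /C_big -/k; ring.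
rewrite ler_peMr// mulr_ge0 ?C_whole_ge0// mulr_ge0//.
exact: le_trans k1.
Qed.

(** A sum serves both cases at once. The expression involves only the numerical data and neither the
    space nor its measure, as the order of quantifiers in the theorem demands; the summand 1 ensures
    positivity. *)
Definition C_hat : R :=
  2 * C_near / ((2 `^ q)^-1 / C_mu) * C_near_dil `^ p^-1 +
  2 * (1 + C_small + C_big) / c_ball kap_far * C_far_dil `^ p^-1.

Lemma C_hat_terms : [/\ 0 < C_near, 0 < C_near_dil, 0 < 1 + C_small + C_big,
  0 < c_ball kap_far & 0 < C_far_dil].
Proof.
have L1 := lam_hat_ge1; have RA0 : 0 < R_A by exact: lt_le_trans RA1.
have ll : 0 < 16 * lam + lam_hat by apply: addr_gt0 => //; rewrite mulr_gt0.
split.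
- by rewrite !mulr_gt0 ?powR_gt0.
- by rewrite lt_max mulr_gt0 ?powR_gt0.
- have s1 : 0 <= C_small.
    apply: mulr_ge0; last by rewrite invr_ge0 powR_ge0.
    by apply: mulr_ge0 => //; rewrite mulr_ge0// ltW.
  have s2 : 0 <= C_big.
    apply: mulr_ge0; last by rewrite !mulr_ge0// ltW.
    apply: mulr_ge0; first exact: C_whole_ge0.
    by apply: mulr_ge0; [exact: ltW|rewrite invr_ge0 powR_ge0].
  by rewrite -addrA; apply: ltr_wpDr; [exact: addr_ge0|exact: ltr01].
- by rewrite /c_ball divr_gt0 ?invr_gt0 ?powR_gt0.
- by rewrite /C_far_dil mulr_gt0 ?C_tail_gt0// invr_gt0 powR_gt0// invr_gt0.
Qed.

Lemma hat_poincare x (r : R) : 0 < r ->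
  (avg nu (dball hat_d x r) (fun y => `|u y - avg nu (dball hat_d x r) u|%E)
    <= (C_hat * r)%:E *
       poweR (avg nu (dball hat_d x (lam_hat * r)) (fun y => poweR (g y) p)) p^-1)%E.
Proof.
move=> r0; have [cn0 cd0 cf0 cb0 cfd0] := C_hat_terms.
have L1 := lam_hat_ge1; have Cm0 : 0 < C_mu by exact: lt_le_trans C_mu_ge1.
have cm0 : 0 < (2 `^ q)^-1 / C_mu by rewrite divr_gt0 ?invr_gt0 ?powR_gt0.
have n0 : 0 <= 2 * C_near / ((2 `^ q)^-1 / C_mu) * C_near_dil `^ p^-1.
  by rewrite mulr_ge0 ?powR_ge0// divr_ge0 ?(ltW cm0)// mulr_ge0// ltW.
have f0 : 0 <= 2 * (1 + C_small + C_big) / c_ball kap_far * C_far_dil `^ p^-1.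
  by rewrite mulr_ge0 ?powR_ge0// divr_ge0 ?(ltW cb0)// mulr_ge0// ltW.
have far : height x < 16 * lam * r ->
    (avg nu (dball hat_d x r) (fun y => `|u y - avg nu (dball hat_d x r) u|%E)
    <= (C_hat * r)%:E *
       poweR (avg nu (dball hat_d x (lam_hat * r)) (fun y => poweR (g y) p)) p^-1)%E.
  move=> hx; have ri0 : 0 < (Num.min r 1)^-1 by rewrite invr_gt0 lt_min r0 ltr01.
  apply: (le_trans (ball_poincare r0 (weight_gt0 ri0) cb0 cf0 cfd0 L1
     (far_nu_ge r0 hx) (far_nu_le r0 hx) _)); last first.
    by rewrite lee_wpmul2r ?poweR_ge0// lee_fin ler_pM2r// lerDr.
  move=> G G0 hG; set Z := weight _ * _.
  have Z0 : 0 <= Z by rewrite mulr_ge0 ?powR_ge0// ltW// weight_gt0.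
  have [s1 s2] : 0 <= C_small /\ 0 <= C_big.
    split.
      apply: mulr_ge0; last by rewrite invr_ge0 powR_ge0.
      by apply: mulr_ge0 => //; rewrite mulr_ge0// ltW.
    apply: mulr_ge0; last by rewrite !mulr_ge0 ?(ltW lam0)// (le_trans ler01 RA1).
    apply: mulr_ge0; first exact: C_whole_ge0.
    by apply: mulr_ge0; [exact: ltW|rewrite invr_ge0 powR_ge0].
  case: (leP (17 * lam * r * (1 + R_A)) 1) => rR.
    have [c hc] := far_osc_small r0 hx rR G0 hG; exists c; apply: osc_le hc.
    by rewrite -/Z ler_wpM2r// ler_pM2r//; lra.
  have [c hc] := far_osc_big r0 hx rR G0 hG; exists c; apply: osc_le hc.
  by rewrite -/Z ler_wpM2r// ler_pM2r//; lra.
(* Infinity has height 0, so every ball about it falls under the far case. *)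
case: x far => [x|] far; last by apply: far; rewrite /= !mulr_gt0.
case: (leP (16 * lam * r * (1 + nrm x)) 1) => rN; last first.
  apply: far; rewrite /= -[ltLHS]mul1r ltr_pdivrMr//; exact: nrm1_gt0.
have m0 : 0 < near_weight x r.
  have N0 := nrm1_gt0 a distM x.
  by rewrite divr_gt0 ?powR_gt0// (vol_gt0 mub)// mulr_gt0// exprn_gt0.
apply: (le_trans (ball_poincare r0 m0 cm0 cn0 cd0 L1 (near_nu_ge r0 rN) (near_nu_le r0 rN)
   (fun G => @near_osc x r G r0 rN))).
by rewrite lee_wpmul2r ?poweR_ge0// lee_fin ler_pM2r// lerDl.
Qed.

End functions.

Lemma supports_PI_hat : supports_PI hat_d nu p C_hat lam_hat.
Proof.
have [cn0 cd0 cf0 cb0 cfd0] := C_hat_terms.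
have Cm0 : 0 < C_mu by exact: lt_le_trans C_mu_ge1.
split.
- have q2 : 0 < (2 : R) `^ q by rewrite powR_gt0.
  apply: addr_gt0; apply: mulr_gt0; rewrite ?powR_gt0//; apply: divr_gt0 => //.
  + exact: mulr_gt0.
  + by rewrite divr_gt0 ?invr_gt0.
  + exact: mulr_gt0.
- exact: lam_hat_ge1.
- by move=> x r r0 u g iu ug; exact: hat_poincare.
Qed.

End space.

Unset Implicit Arguments.

Theorem theorem5p3 (R : realType)
  (p C_mu C_PI lam s C_s A R_A q : R) :
  1 <= p -> 0 < s -> 0 < C_s -> 1 <= A -> 1 <= R_A -> s < q ->
  exists C_hat : R,
  forall (dX : measure_display) (X : measurableType dX)
    (dist : X -> X -> R) (mu : {measure set X -> \bar R}) (a : X),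
    (* (X,d) is a complete, unbounded metric space *)
    is_metric dist ->
    complete_metric dist ->
    (forall M : R, exists x, M < dist x a) ->
    (* mu is a positive complete Borel measure, 0 < mu(B) < oo on balls *)
    (forall O, dopen dist O -> measurable O) ->
    (forall N, measurable N -> mu N = 0%E ->
       forall E, E `<=` N -> measurable E) ->
    (forall x r, 0 < r -> (0 < mu (dball dist x r) < +oo)%E) ->
    (* mu is doubling *)
    (forall x r, 0 < r ->
       (mu (dball dist x (2 * r)) <= C_mu%:E * mu (dball dist x r))%E) ->
    (* p-Poincare inequality with constants C_PI, lam *)
    supports_PI dist mu p C_PI lam ->
    (* relative lower volume decay around a *)
    (forall r R' : R, 1 <= r -> r <= R' ->
       fine (mu (dball dist a r)) / fine (mu (dball dist a R'))
         >= C_s * (r / R') `^ s) ->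
    (* annular connectivity for large radii around a *)
    (forall x y, dist x a = dist y a -> R_A <= dist x a ->
       exists gam : R -> X,
         [/\ dcurve dist gam, gam 0 = x, gam 1 = y &
           forall t, 0 <= t <= 1 ->
             dball dist a (A * dist x a) (gam t) /\
             ~ dclosure dist (dball dist a (dist x a / A)) (gam t)]) ->
    (* conclusion for the sphericalization (hatX, hat_d, hat mu_q) *)
    forall nu : {measure set (hatX X) -> \bar R},
      (forall E : set (hatX X), measurable E ->
         nu E = (\int[mu]_(x in (@Some X) @^-1` E) hat_density dist a q x)%E) ->
      supports_PI (hat_d dist a) nu p C_hat (100 * lam * Num.max A (2 * R_A)).
Proof.
move=> p1 s0 Cs0 A1 RA1 sq; exists (C_hat p C_mu C_PI lam s C_s A R_A q).
move=> dX X dist mu a distM _ unb mO _ mub dbl PI decay ann nu hnu.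
exact: (supports_PI_hat p1 s0 Cs0 sq A1 RA1 distM unb mO mub dbl PI decay ann hnu).
Qed.
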